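(* Let $\mathbb{F}$ be a field of characteristic zero. For each positive integer $n$ define $C_n(X)=\operatorname{Imm}_{(2^n)}(X)$, a polynomial over $\mathbb{F}$ in the $4n^2$ entries of the $2n\times 2n$ matrix $X$. Then the polynomial family $(C_n)_{n\geq 1}$ is $\mathrm{VNP}$-complete under $p$-projections. Furthermore, there exist a function $N(n)=O(n^2)$ and a $p$-projection $(\Pi_n)_{n\ge 1}$, where $\Pi_n$ maps $n\times n$ matrices to $2N(n)\times 2N(n)$ matrices, such that for every $n\ge 1$ and every $A\in\mathbb{F}^{n\times n}$, $$\operatorname{Imm}_{(2^{N(n)})}(\Pi_n(A))=\operatorname{per}(A).$$
   Context: Immanants. For a partition $\lambda\vdash m$ let $\chi_\lambda$ be the irreducible character of the symmetric group $S_m$ indexed by $\lambda$ (integer-valued, hence viewed in $\mathbb{F}$; $\chi_{(m)}$ is trivial and $\chi_{(1^m)}$ is the sign character). For an $m\times m$ matrix $B=[b_{ij}]$, $\operatorname{Imm}_\lambda(B)=\sum_{\pi\in S_m}\chi_\lambda(\pi)\prod_{i=1}^m b_{i\pi(i)}$. Here $(2^n)=(2,\ldots,2)$ ($n$ parts), a partition of $2n$, and $\operatorname{per}$ is the permanent. Complexity notions (non-uniform algebraic model; all constants of $\mathbb{F}$ are allowed, and may depend on the index). A function of $n$ is $p$-bounded if it is bounded by a polynomial in $n$. A $p$-family is a sequence $(f_n)$ with $f_n\in\mathbb{F}[X_1,\ldots,X_{v(n)}]$ such that $v(n)$ and $\deg f_n$ are $p$-bounded. $L(f)$ is the minimum number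 of arithmetic operations $(+,-,\times)$ needed to compute $f$ from its variables and constants in $\mathbb{F}$ by a straight-line program. A $p$-family $(f_n)$ is $p$-computable if $L(f_n)$ is $p$-bounded. A $p$-family $(f_n)$ is $p$-definable if there are a $p$-bounded $u(n)$ and a $p$-computable family $(g_n)$, $g_n\in\mathbb{F}[X_1,\ldots,X_{v(n)},Y_1,\ldots,Y_{u(n)}]$, with $f_n(X)=\sum_{e\in\{0,1\}^{u(n)}}g_n(X,e)$ for all $n$; $\mathrm{VNP}$ is the class of all $p$-definable families. For $p$-families $(f_n)$ and $(g_m)$ with $f_n\in\mathbb{F}[X_1,\ldots,X_{v(n)}]$, $g_m\in\mathbb{F}[Y_1,\ldots,Y_{u(m)}]$, write $(f_n)\le_p(g_m)$ (the family $(f_n)$ is a $p$-projection of $(g_m)$) if there is a $p$-bounded $t:\mathbb{N}\to\mathbb{N}$ such that for every $n$ there are $a_1,\ldots,a_{u(t(n))}\in\mathbb{F}\cup\{X_1,\ldots,X_{v(n)}\}$ with $f_n=g_{t(n)}(a_1,\ldots,a_{u(t(n))})$. A family $(g_m)$ is $\mathrm{VNP}$-complete under $p$-projections if $(g_m)\in\mathrm{VNP}$ and $(f_n)\le_p(g_m)$ for every $(f_n)\in\mathrm{VNP}$. A $p$-projection $(\Pi_n)$ on matrices means: for each $n$, $\Pi_n(A)$ is obtained by a fixed substitution in which every entry of the output matrix is either one of the entries $a_{ij}$ of $A=[a_{ij}]$ (in a fixed position independent of $A$) or a fixed constant of $\mathbb{F}$, and the size of $\Pi_n(A)$ is $p$-bounded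 in $n$. *)

(* Defs.v *)
From HB Require Import structures.
From mathcomp Require Import all_boot all_order all_algebra all_fingroup.
From mathcomp Require Import all_solvable all_field all_character.
From mathcomp Require Export mpoly.

Set Implicit Arguments.
Unset Strict Implicit.
Unset Printing Implicit Defensive.

Import Order.TTheory GRing.Theory Num.Theory.
Local Open Scope ring_scope.

Record partition_of (m : nat) := PartitionOf {
  parts :> seq nat;
  partsP : [&& sorted geq parts, all (leq 1) parts & sumn parts == m]
}.

Definition fiber_stab (m : nat) (f : nat -> nat) : {set 'S_m} :=
  [set s : 'S_m | [forall k : 'I_m, f (s k) == f k]].

Lemma fiber_stab_group_set (m : nat) (f : nat -> nat) :
  group_set (fiber_stab m f).
Proof.
apply/group_setP; split=> [|s t].
  by rewrite inE; apply/forallP=> k; rewrite perm1.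
rewrite !inE => /forallP fs /forallP ft; apply/forallP=> k.
by rewrite permM (eqP (ft _)).
Qed.
Canonical fiber_stab_group (m : nat) (f : nat -> nat) : {group 'S_m} :=
  Group (fiber_stab_group_set m f).

(* The Young diagram of la is filled row by row with 0, 1, ..., m - 1, so that
   k lies in row [reshape_index la k] and column [reshape_offset la k]. *)
Definition row_group (m : nat) (la : partition_of m) : {group 'S_m} :=
  [group of fiber_stab m (reshape_index la)].
Definition column_group (m : nat) (la : partition_of m) : {group 'S_m} :=
  [group of fiber_stab m (reshape_offset la)].

Fact sign_cfun_subproof (m : nat) :
  is_class_fun <<[set: 'S_m]>>%g [ffun s : 'S_m => (-1) ^+ odd_perm s].
Proof.
rewrite genGid; apply: intro_class_fun => [s t _ _ | s]; last by rewrite inE.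
by rewrite odd_permJ.
Qed.
Definition sign_cfun (m : nat) : 'CF([set: 'S_m]) :=
  Cfun 0 (sign_cfun_subproof m).

(* The irreducible character indexed by la is the unique common irreducible
   constituent of the trivial character induced from the row group and the sign
   character induced from the column group of a tableau of shape la (James and
   Kerber, The Representation Theory of the Symmetric Group, Section 2.1).  Since
   a common constituent always exists, the value 0 below is never used. *)
Definition specht_char (m : nat) (la : partition_of m) : 'CF([set: 'S_m]) :=
  if [pick i : Iirr [set: 'S_m]
       | (i \in irr_constt ('Ind[[set: 'S_m], row_group la] 1))
       & (i \in irr_constt ('Ind[[set: 'S_m], column_group la]
                              ('Res[column_group la] (sign_cfun m))))]
  is Some i then 'chi_i else 0.

(* Characters of symmetric groups are integer-valued, so the floor only changes
   the type of the value from algC to int. *)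
Definition chi (m : nat) (la : partition_of m) (s : 'S_m) : int :=
  Num.floor (specht_char la s).

Definition Imm (R : comNzRingType) (m : nat) (la : partition_of m)
    (B : 'M[R]_m) : R :=
  \sum_(s : 'S_m) (chi la s)%:~R * \prod_(i < m) B i (s i).

Definition per (R : comNzRingType) (m : nat) (B : 'M[R]_m) : R :=
  \sum_(s : 'S_m) \prod_(i < m) B i (s i).

Fact two_parts_subproof (n : nat) :
  [&& sorted geq (nseq n 2), all (leq 1) (nseq n 2)
    & sumn (nseq n 2) == (2 * n)%N].
Proof.
rewrite sumn_nseq eqxx all_nseq orbT !andbT /=.
by case: n => //= n; elim: n.
Qed.
Definition two_parts (n : nat) : partition_of (2 * n) :=
  PartitionOf (two_parts_subproof n).

(* Sequences are indexed by the positive integers: the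
   value of a family at index 0 is always ignored. *)

Definition p_bounded (f : nat -> nat) : Prop :=
  exists p : {poly nat}, forall n, (0 < n)%N -> (f n <= p.[n])%N.

Record mpoly_family (F : fieldType) := MPolyFamily {
  nvars : nat -> nat;
  member :> forall n, {mpoly F[nvars n]}
}.

(* [msize f] is one more than the degree of a nonzero f. *)
Definition p_family (F : fieldType) (f : mpoly_family F) : Prop :=
  p_bounded (nvars f) /\ p_bounded (fun n => (msize (f n)).-1).

(* [OpRes k] is the result of the k-th instruction of the program (from 0); a
   reference to an instruction not yet executed denotes the constant 0. *)
Inductive operand (F : fieldType) (v : nat) :=
  | OpVar of 'I_v
  | OpConst of F
  | OpRes of nat.

Inductive arith_op := OpAdd | OpSub | OpMul.

Record instruction (F : fieldType) (v : nat) := Instr {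
  instr_op : arith_op;
  instr_left : operand F v;
  instr_right : operand F v
}.

Section StraightLinePrograms.
Variables (F : fieldType) (v : nat).
Implicit Types (r : seq {mpoly F[v]}) (P : seq (instruction F v)).

Definition operand_val r (o : operand F v) : {mpoly F[v]} :=
  match o with
  | OpVar i => 'X_i
  | OpConst c => c%:MP
  | OpRes k => r`_k
  end.

Definition instr_val r (i : instruction F v) : {mpoly F[v]} :=
  let x := operand_val r (instr_left i) in
  let y := operand_val r (instr_right i) in
  match instr_op i with
  | OpAdd => x + y
  | OpSub => x - y
  | OpMul => x * y
  end.

Definition slp_results P : seq {mpoly F[v]} :=
  foldl (fun r i => rcons r (instr_val r i)) [::] P.

Definition slp_computes P (f : {mpoly F[v]}) : Prop :=
  exists o : operand F v, operand_val (slp_results P) o = f.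

Definition complexity (f : {mpoly F[v]}) (l : nat) : Prop :=
  (exists2 P, slp_computes P f & size P = l) /\
  (forall P, slp_computes P f -> (l <= size P)%N).

End StraightLinePrograms.

Definition p_computable (F : fieldType) (f : mpoly_family F) : Prop :=
  p_family f /\
  exists2 L : nat -> nat,
    p_bounded L & forall n, (0 < n)%N -> complexity (f n) (L n).

(* Substitution Y := e in a polynomial in X_1, ..., X_v, Y_1, ..., Y_u. *)
Definition eval_bools (F : fieldType) (v u : nat) (g : {mpoly F[v + u]})
    (e : {ffun 'I_u -> bool}) : {mpoly F[v]} :=
  comp_mpoly [tuple match split i with
                    | inl j => 'X_j
                    | inr k => ((e k)%:R)%:MP
                    end | i < v + u] g.

Definition p_definable (F : fieldType) (f : mpoly_family F) : Prop :=
  p_family f /\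
  exists (u : nat -> nat) (g : forall n, {mpoly F[nvars f n + u n]}),
    [/\ p_bounded u,
        p_computable (MPolyFamily g)
      & forall n, (0 < n)%N ->
          f n = \sum_(e : {ffun 'I_(u n) -> bool}) eval_bools (g n) e].

Definition VNP (F : fieldType) (f : mpoly_family F) : Prop := p_definable f.

Definition is_projection (F : fieldType) (v u : nat) (f : {mpoly F[v]})
    (g : {mpoly F[u]}) : Prop :=
  exists a : 'I_u -> F + 'I_v,
    f = comp_mpoly [tuple match a i with
                          | inl c => c%:MP
                          | inr j => 'X_j
                          end | i < u] g.

Definition p_projection (F : fieldType) (f g : mpoly_family F) : Prop :=
  exists2 t : nat -> nat, p_bounded t &
    forall n, (0 < n)%N -> (0 < t n)%N /\ is_projection (f n) (g (t n)).

Definition VNP_complete (F : fieldType) (g : mpoly_family F) : Prop :=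
  VNP g /\
  forall f : mpoly_family F, VNP f -> p_projection f g.

Definition generic_mx (F : fieldType) (m : nat) : 'M[{mpoly F[m * m]}]_m :=
  \matrix_(i, j) 'X_(mxvec_index i j).

Definition imm_two_family (F : fieldType) : mpoly_family F :=
  MPolyFamily (fun n => Imm (two_parts n) (generic_mx F (2 * n))).

(* A substitution matrix with k rows and columns: each entry is a constant of F
   or a position in an n x n matrix. *)
Definition mx_pattern (F : fieldType) (n k : nat) :=
  'M[(F + 'I_n * 'I_n)%type]_k.

Definition mx_subst (F : fieldType) (n k : nat) (P : mx_pattern F n k)
    (A : 'M[F]_n) : 'M[F]_k :=
  \matrix_(i, j) match P i j with
                 | inl c => c
                 | inr (p, q) => A p q
                 end.

(* Main.v *)
(* The sign characters induced from the set stabilizers of S, for #|S| = n and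
   #|S| = n + 1, differ by a class function of norm 1, which is the character of (2^n).
   Hence Imm_(2^n)(B) is the sum over #|S| = n minus the sum over #|S| = n + 1 of
   det B[S] * det B[~S].

   Permanent.  Every entry (i, j) is carried by two vertices with opposite weights;
   summing over which of them belong to S acts as the Godsil-Gutman estimator: the mixed
   terms of the two determinants cancel, and each permutation contributes the product of
   its entries times one nonzero constant, a difference of consecutive binomials.

   Membership.  The sign of a permutation is a quotient of Vandermonde products, so the
   formula above is a boolean sum, over a matrix with one-hot rows and the indicator of
   S, of a short formula.

   Hardness.  The homogeneous components of the results of a straight-line program are
   computed with intervals of slot variables, whose squares can be neglected.  The value of
   the program then is the coefficient of the product of all variables in a product of
   polynomials X_g + Q_g, one for each gate: extracting X_g substitutes Q_g for X_g because
   the value of Q_g squares to 0.  Products, and the equality of all occurrences of a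
   boolean variable, are expressed by quadratic forms C * D - A * B, which are themselves
   coefficients in products of four affine forms.  Such a coefficient in a product of
   affine forms is a permanent, up to a factorial. *)
From HB Require Import structures.
Require Import Defs.
From Stdlib Require Import Classical IndefiniteDescription.
From mathcomp Require Import all_boot all_order all_algebra all_fingroup.
From mathcomp Require Import all_solvable all_field all_character.
From mathcomp Require Import zify ring.

Set Implicit Arguments.
Unset Strict Implicit.
Unset Printing Implicit Defensive.

Import Order.TTheory GRing.Theory Num.Theory.
Local Open Scope ring_scope.

(** * The character of (2^n) *)

(** Hardness passes through the permanent: a boolean sum of a program becomes a permanent of
    polynomial size, and a permanent becomes an immanant. Both steps produce constants, which a
    projection cannot divide out. Each is absorbed by a row consisting of constants only, scaled by
    the inverse; characteristic zero makes it invertible. The gadget has 2(n + n^2) vertices, whence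
    N(n) = n + n^2. Its generating polynomial in #|S| is a multiple of X^(2n) (1 + X)^(2(n^2 - n)),
    and the immanant compares the central coefficient, of degree n + n^2, with the next one.
    Replacing X_g by Q_g is exact only if the value of Q_g squares to 0. A component of degree j > 0
    is therefore multiplied by j distinct slot variables, while components of degree 0 are field
    constants and never become gates. The slots of two factors must be disjoint, lest their product
    vanish as well, so a component is computed anew for each first slot. Intermediate results may
    have exponential degree, but components above the degree of the final polynomial are dropped,
    which keeps the number of gates polynomial. *)

Lemma perm_of_equal_fibres (m : nat) (C : finType) (f g : 'I_m -> C) :
  (forall c, #|[set i | f i == c]| = #|[set i | g i == c]|) ->
  exists s : 'S_m, forall i, f i = g (s i).
Proof.
move=> fg.
have cnt h c : count_mem c (mktuple h) = #|[set i : 'I_m | h i == c]|.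
  rewrite -sum1_count -sum1_card /= big_map big_enum_cond /=.
  by apply: eq_bigl => i; rewrite inE.
have : perm_eq (mktuple f) (mktuple g) by apply/allP=> c _ /=; rewrite !cnt fg.
case/tuple_permP=> s /val_inj es; exists s => i.
by have := congr1 (fun t => tnth t i) es; rewrite !tnth_mktuple.
Qed.

Lemma perm_of_card_eq (m : nat) (S T : {set 'I_m}) :
  #|S| = #|T| -> exists s : 'S_m, s @: S = T.
Proof.
move=> ST.
have [|s fg] := @perm_of_equal_fibres m bool (mem S) (mem T).
  have e (A : {set 'I_m}) c : #|[set i | (i \in A) == c]| = if c then #|A| else (m - #|A|)%N.
    case: c; first by apply: eq_card => i; rewrite inE eqb_id.
    have -> : (m - #|A| = #|~: A|)%N by rewrite -[X in (X - _)%N](card_ord m) -(cardsC A) addKn.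
    by apply: eq_card => i; rewrite !inE eqbF_neg.
  by move=> c; rewrite !e ST.
exists s; apply/setP=> i; rewrite -[i](permKV s) mem_imset //; last exact: perm_inj.
exact: fg.
Qed.

Definition fixed_sets (m k : nat) (s : 'S_m) : {set {set 'I_m}} :=
  [set T : {set 'I_m} | (#|T| == k) && (s @: T == T)].

Lemma imset_permM (m : nat) (s t : 'S_m) (A : {set 'I_m}) :
  (s * t)%g @: A = t @: (s @: A).
Proof. by rewrite -imset_comp; apply: eq_imset => x; rewrite permM. Qed.

Lemma imset_perm_inv (m : nat) (s : 'S_m) (A B : {set 'I_m}) :
  ((s^-1)%g @: A == B) = (s @: B == A).
Proof.
apply/eqP/eqP=> <-; rewrite -imset_permM ?mulVg ?mulgV;
by rewrite -[RHS]imset_id; apply: eq_imset => x; rewrite perm1.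
Qed.

(** The sign is a class function, so it leaves the averaging sum of the induced character. What
    remains is the permutation character of S_m on the cosets of H, the stabilizer of S, and these
    cosets correspond to the sets of size k. *)
Lemma Ind_sign (m k : nat) (H : {group 'S_m}) (S : {set 'I_m}) (s : 'S_m) :
  (forall t, (t \in H) = (t @: S == S)) -> #|S| = k ->
  'Ind[[set: 'S_m], H] ('Res[H] (sign_cfun m)) s =
    (-1) ^+ odd_perm s * #|fixed_sets k s|%:R.
Proof.
move=> HS Sk; rewrite cfIndE ?subsetT // (eq_bigl xpredT); last by move=> y; rewrite inE.
transitivity (#|H|%:R^-1 *
    \sum_(y : 'S_m) (-1) ^+ odd_perm s * (s @: (y @: S) == y @: S)%:R : algC).
  congr (_ * _); rewrite (reindex_inj invg_inj) /=; apply: eq_bigr => y _.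
  have e : ((s ^ y^-1)%g \in H) = (s @: (y @: S) == y @: S).
    by rewrite HS /conjg invgK !imset_permM imset_perm_inv eq_sym.
  rewrite -e; case: (boolP ((s ^ y^-1)%g \in H)) => Hy.
    by rewrite cfResE ?subsetT // mulr1 cfunE odd_permJ.
  by rewrite cfun0 // mulr0.
rewrite -mulr_sumr mulrCA; congr (_ * _); rewrite -natr_sum.
set Q := fun T : {set 'I_m} => #|T| == k.
(* The elements y carrying S to a given T form one coset of H, so each fixed T is counted #|H|
   times, which cancels the denominator of induction. *)
rewrite (partition_big (fun y : 'S_m => y @: S) Q) /=; last first.
  by move=> y _; rewrite /Q card_imset ?Sk //; apply: perm_inj.
have E (T : {set 'I_m}) : Q T ->
    (\sum_(y : 'S_m | y @: S == T) (s @: (y @: S) == y @: S) = (s @: T == T) * #|H|)%N.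
  move/eqP=> Tk; have [|y0 ey0] := @perm_of_card_eq _ S T; first by rewrite Tk.
  rewrite (eq_bigr (fun=> (s @: T == T) : nat)); last by move=> y /= /eqP->.
  rewrite sum_nat_const mulnC; congr (_ * _)%N.
  rewrite -(card_rcoset H y0); apply: eq_card => y.
  rewrite mem_rcoset HS imset_permM imset_perm_inv ey0.
  by rewrite unfold_in /= eq_sym.
rewrite (eq_bigr _ E) -big_distrl /= -big_mkcondr /= sum1_card natrM mulrC mulfK.
  by congr (_%:R); apply: eq_card => T; rewrite inE.
by rewrite pnatr_eq0 -lt0n cardG_gt0.
Qed.

(** Both images are in bijection with the image of x -> (f x, g x). In the orbit count below this
    replaces orbits by the values of a complete invariant. *)
Lemma card_imset_ker (A B C : finType) (f : A -> B) (g : A -> C) (X : {set A}) :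
  {in X &, forall x y, (f x == f y) = (g x == g y)} -> #|f @: X| = #|g @: X|.
Proof.
move=> fg; set h := fun x => (f x, g x).
have -> : f @: X = fst @: (h @: X) by rewrite -imset_comp.
have -> : g @: X = snd @: (h @: X) by rewrite -imset_comp.
rewrite (@card_in_imset _ _ fst) ?(@card_in_imset _ _ snd) // =>
  _ _ /imsetP[x Xx ->] /imsetP[y Xy ->] /= /eqP e.
  by rewrite /h; have := e; rewrite -fg // => /eqP->; rewrite (eqP e).
by rewrite /h; have := e; rewrite fg // => /eqP->; rewrite (eqP e).
Qed.

Definition pair_act (m : nat) (p : {set 'I_m} * {set 'I_m}) (s : 'S_m) :=
  (s @: p.1, s @: p.2).

Fact pair_act1 (m : nat) : (@pair_act m)^~ 1%g =1 id.
Proof.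
case=> A B; rewrite /pair_act /=; congr pair;
by rewrite -[RHS]imset_id; apply: eq_imset => x; rewrite perm1.
Qed.

Fact pair_actM (m : nat) p : act_morph (@pair_act m) p.
Proof. by case: p => A B s t; rewrite /pair_act /= !imset_permM. Qed.

Definition pair_action (m : nat) := TotalAction (@pair_act1 m) (@pair_actM m).

Lemma card_ord_interval (m a b : nat) (P : pred nat) : (b <= m)%N ->
  (forall j, (j < m)%N -> P j = (a <= j < b)%N) -> #|[set j : 'I_m | P j]| = (b - a)%N.
Proof.
move=> bm PE; rewrite -sum1_card (eq_bigl (fun i : 'I_m => a <= i < b)%N).
  rewrite -(big_ord_widen_cond m (fun i => a <= i)%N (fun=> 1%N) bm) big_mkcond /=.
  rewrite -(big_mkord xpredT (fun i => if a <= i then 1 else 0)%N) -big_mkcond /=.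
  by rewrite -(big_nat_widenl a 0 b xpredT) // sum_nat_const_nat muln1.
by move=> i; rewrite inE PE.
Qed.

(** Burnside's lemma for S_m acting on pairs (T, U) with #|T| = k and #|U| = l: each summand counts
    fixed pairs, and the orbit of (T, U) is determined by j = #|T :&: U|. The conditions on j say
    that such an intersection exists, the union having to fit into m points. *)
Lemma sum_card_fixed_sets (m k l : nat) :
  (\sum_(s : 'S_m) #|fixed_sets k s| * #|fixed_sets l s| =
   #|[set j : 'I_m.+1 | [&& k + l <= j + m, j <= k & j <= l]]| * m`!)%N.
Proof.
pose X := setX [set T : {set 'I_m} | #|T| == k] [set T : {set 'I_m} | #|T| == l].
have actX : [acts [set: 'S_m], on X | pair_action m].
  apply/actsP=> s _ [T U] /=.
  by rewrite !inE /= !card_imset //; exact: perm_inj.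
have := Frobenius_Cauchy actX; rewrite cardsT card_Sn => e.
transitivity (\sum_(a in [set: 'S_m]) #|('Fix_(X | pair_action m)[a])%g|)%N.
  rewrite (eq_bigl xpredT); last by move=> s; rewrite inE.
  apply: eq_bigr => s _; rewrite -cardsX; apply: eq_card => -[T U].
  rewrite in_setX !inE /= sub1set inE /= /pair_act xpair_eqE /=.
  by rewrite andbACA.
rewrite {}e; congr (_ * _)%N.
pose f (p : {set 'I_m} * {set 'I_m}) : 'I_m.+1 := inord #|p.1 :&: p.2|.
have fE p : f p = #|p.1 :&: p.2| :> nat.
  by rewrite inordK // ltnS -[leqRHS]card_ord max_card.
rewrite (@card_imset_ker _ _ _ _ f); last first.
  move=> [T U] [T' U']; rewrite !inE /= => /andP[/eqP cT /eqP cU] /andP[/eqP cT' /eqP cU'].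
  rewrite eq_sym; apply/eqP/eqP => [e|/(congr1 (@nat_of_ord _))].
    have : (T', U') \in orbit (pair_action m) [set: 'S_m] (T, U) by rewrite -e orbit_refl.
    case/imsetP=> s _ [-> ->]; apply/ord_inj; rewrite !fE /= -imsetI ?card_imset //.
    - exact: perm_inj.
    - exact: in2W (@perm_inj _ s).
  rewrite !fE /= => cTU.
  (* Equal sizes and equal intersections make all four regions of the Venn diagram equal in size, so
     a permutation matches the regions. *)
  have [|s es] := @perm_of_equal_fibres m _ (fun i => (i \in T,
    i \in U)) (fun i => (i \in T', i \in U')).
    have cc (A B : {set 'I_m}) (b c : bool) : #|[set i | (i \in A, i \in B) == (b, c)]| =
      if b then if c then #|A :&: B| else (#|A| - #|A :&: B|)%N
      else if c then (#|B| - #|A :&: B|)%N else (m - (#|A| + #|B| - #|A :&: B|))%N.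
      rewrite -cardsU -cardsD setIC -cardsD.
      rewrite -[X in (X - _)%N](card_ord m) -(cardsC (A :|: B)) addKn.
      by case: b; case: c; apply: eq_card => i; rewrite !inE xpair_eqE; do !case: (_ \in _).
    by case=> b c; rewrite !cc cT cU cT' cU' cTU.
  apply/eqP; rewrite orbit_eq_mem; apply/orbitP; exists s; rewrite ?inE //= /pair_act.
  have ims (A B : {set 'I_m}) : (forall i, (i \in A) = (s i \in B)) -> s @: A = B.
    move=> AB; apply/setP=> i; rewrite -[i](permKV s) mem_imset //; exact: perm_inj.
  by congr pair; apply/ims => i; case: (es i).
apply: eq_card => j; apply/imsetP/idP.
  case=> -[T U]; rewrite !inE /= => /andP[/eqP cT /eqP cU] ->; rewrite fE /=.
  rewrite -cT -cU subset_leq_card ?subsetIl // subset_leq_card ?subsetIr // !andbT.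
  rewrite -[X in (_ <= _ + X)%N](card_ord m) -leq_subLR.
  by rewrite -(cardsUI T U) addnK max_card.
rewrite inE => /and3P[kl jk jl].
pose I a b := [set i : 'I_m | (a <= i < b)%N].
have cI a b : (b <= m)%N -> #|I a b| = (b - a)%N.
  by move=> bm; apply: (@card_ord_interval _ a b (fun j => a <= j < b)%N).
have am : (k - j + l <= m)%N by lia.
have km : (k <= m)%N by lia.
(* Two intervals of lengths k and l that overlap exactly in the last j points of the first. *)
exists (I 0 k, I (k - j) (k - j + l))%N.
  by rewrite !inE /= !cI // subn0 addKn !eqxx.
apply/ord_inj; rewrite fE /=.
have -> : I 0%N k :&: I (k - j)%N (k - j + l)%N = I (k - j)%N k.
  by apply/setP=> i; rewrite !inE; lia.
by rewrite cI // subKn.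
Qed.

(** * The row and column groups of the shape (2^n) *)

Lemma reshape_two_parts (n i : nat) : (i < 2 * n)%N ->
  reshape_index (two_parts n) i = i./2 /\ reshape_offset (two_parts n) i = odd i.
Proof.
move=> lti; have e : flatten_index (nseq n 2) i./2 (odd i) = i.
  rewrite /flatten_index take_nseq ?sumn_nseq; lia.
have h : (odd i < nth 0 (nseq n 2) i./2)%N by rewrite nth_nseq; case: ifP; lia.
by rewrite /= -{1 3}e flatten_indexKl // flatten_indexKr.
Qed.

Lemma mem_row_group (n : nat) (s : 'S_(2 * n)) :
  (s \in row_group (two_parts n)) = [forall k, (s k)./2 == k./2].
Proof.
rewrite inE; apply: eq_forallb => k.
by have [-> _] := reshape_two_parts (ltn_ord (s k)); have [-> _] := reshape_two_parts (ltn_ord k).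
Qed.

Definition even_points (n : nat) : {set 'I_(2 * n)} := [set k : 'I_(2 * n) | ~~ odd k].

Lemma card_even_points (n : nat) : #|even_points n| = n.
Proof.
rewrite -sum1_card (eq_bigl (fun k : 'I_(2 * n) => ~~ odd k)); last by move=> k; rewrite inE.
rewrite -(big_mkord (fun k => ~~ odd k) (fun=> 1%N)).
elim: n => [|n IH]; first by rewrite big_nil.
by rewrite big_mkcond mulnS add2n big_nat_recr //= big_nat_recr //= -big_mkcond IH /= oddM /=
  addn1 addn0.
Qed.

(** The two columns are the parity classes, and a permutation preserving one of them preserves its
    complement. In this form the column group falls under [Ind_sign]. *)
Lemma mem_column_group (n : nat) (s : 'S_(2 * n)) :
  (s \in column_group (two_parts n)) = (s @: even_points n == even_points n).
Proof.
transitivity [forall k, odd (s k) == odd k].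
  rewrite inE; apply: eq_forallb => k.
  have [_ ->] := reshape_two_parts (ltn_ord (s k)); have [_ ->] := reshape_two_parts (ltn_ord k).
  by do 2!case: odd.
apply/forallP/eqP => [h|h k].
  apply/setP=> i; rewrite -[i](permKV s) mem_imset; last exact: perm_inj.
  by rewrite !inE (eqP (h _)).
have := mem_imset (mem (even_points n)) k (@perm_inj _ s).
by rewrite /= h !inE => /(congr1 negb); rewrite !negbK => ->.
Qed.

(** By [Ind_sign], the value at s of the sign character induced from the stabilizer of a set of size
    k. *)
Definition sgnfix (m k : nat) (s : 'S_m) : algC := (-1) ^+ odd_perm s * #|fixed_sets k s|%:R.

Lemma sgnfix_conj m k (s : 'S_m) : (sgnfix k s)^* = sgnfix k s.
Proof. by rewrite /sgnfix rmorphM rmorph_nat rmorph_sign. Qed.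

Lemma cfdot_sgnfix (m k l : nat) (phi psi : 'CF([set: 'S_m])) :
  phi =1 sgnfix k -> psi =1 sgnfix l ->
  '[phi, psi] = #|[set j : 'I_m.+1 | [&& k + l <= j + m, j <= k & j <= l]%N]|%:R.
Proof.
move=> phiE psiE; rewrite cfdotE cardsT card_Sn.
rewrite (eq_bigr (fun s => (#|fixed_sets k s| * #|fixed_sets l s|)%:R)); last first.
  move=> s _; rewrite phiE psiE sgnfix_conj /sgnfix mulrACA -expr2 sqrr_sign mul1r.
  by rewrite natrM.
rewrite (eq_bigl xpredT); last by move=> s; rewrite inE.
rewrite -natr_sum sum_card_fixed_sets natrM mulrC mulfK //.
by rewrite pnatr_eq0 -lt0n fact_gt0.
Qed.

Section RowSum.
Variable n : nat.
Let R := row_group (two_parts n).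
Implicit Type T : {set 'I_(2 * n)}.

Definition signed_stab T : algC :=
  \sum_(s in R | s @: T == T) (-1) ^+ odd_perm s.

Definition splits_rows T :=
  [forall i : 'I_(2 * n), forall j : 'I_(2 * n),
    (i./2 == j./2) && ((i \in T) == (j \in T)) ==> (i == j)].

(** If two distinct points of one row lie on the same side of T, multiplication by their
    transposition pairs terms of opposite sign. Otherwise only the identity preserves both the rows
    and T. *)
Lemma signed_stabE T : signed_stab T = (splits_rows T)%:R.
Proof.
case: (boolP (splits_rows T)) => [/forallP sT|].
  rewrite /signed_stab (big_pred1 1%g) ?odd_perm1 // => s; apply/andP/eqP => [[]|->].
    rewrite mem_row_group => /forallP rs /eqP eT; apply/permP=> i; rewrite perm1.
    apply/eqP; have /forallP/(_ i)/implyP := sT (s i); apply; rewrite (rs i) /=.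
    by rewrite -{1}eT mem_imset //; apply: perm_inj.
  split; first by apply: group1.
  by apply/eqP; rewrite -[RHS]imset_id; apply: eq_imset => x; rewrite perm1.
case/forallPn=> i /forallPn[j]; rewrite negb_imply => /andP[/andP[/eqP ij /eqP Tij] neq].
pose t := tperm i j.
have Rt : t \in R.
  rewrite mem_row_group; apply/forallP=> k; rewrite permE /=.
  by have [->|_] := eqVneq k i; [rewrite ij | have [->|_] := eqVneq k j; rewrite ?ij].
have tT : t @: T = T.
  apply/setP=> k; rewrite -[k](permKV t) mem_imset; last exact: perm_inj.
  set k' := (t^-1)%g k; rewrite permE /=.
  by have [->|_] := eqVneq k' i; [rewrite Tij | have [->|_] := eqVneq k' j; rewrite ?Tij].
suff e : signed_stab T = - signed_stab T.
  have /eqP : signed_stab T *+ 2 = 0 by rewrite mulr2n {2}e subrr.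
  by rewrite mulrn_eq0 /= => /eqP.
rewrite /signed_stab {1}(reindex_inj (mulgI t)) /= -sumrN; apply: eq_big => s.
  by rewrite groupMl // imset_permM tT.
by move=> _; rewrite odd_permM odd_tperm neq /= signrN.
Qed.

Lemma sum_sgnfix_rows k :
  \sum_(s in R) sgnfix k s = #|[set T : {set 'I_(2 * n)} | (#|T| == k) && splits_rows T]|%:R.
Proof.
transitivity (\sum_(T : {set 'I_(2 * n)} | #|T| == k) signed_stab T).
  rewrite /signed_stab [RHS](exchange_big_dep (mem R)) /=; last by move=> T s _ /andP[].
  apply: eq_bigr => s Rs; rewrite sumr_const /sgnfix mulr_natr; congr (_ *+ _).
  apply: eq_card => T; rewrite inE; apply/idP/idP => [/andP[kT sT]|/and3P[-> _ ->]] //.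
  exact/and3P.
rewrite (eq_bigr _ (fun T _ => signed_stabE T)) -natr_sum -sum1_card.
rewrite big_mkcond [in RHS]big_mkcond /=; congr _%:R.
by apply: eq_bigr => T _; rewrite inE; case: (#|T| == k) => //=; case: (splits_rows T).
Qed.
End RowSum.

(** Frobenius reciprocity turns the inner product into the average of [sgnfix] over the row group,
    which is a positive multiple of the number of k-sets separating the two points of every row. *)
Lemma cfdot_row_sgnfix (n k : nat) (phi : 'CF([set: 'S_(2 * n)])) :
  phi =1 sgnfix k ->
  ('['Ind[[set: 'S_(2 * n)], row_group (two_parts n)] 1, phi] == 0) =
  ([set T : {set 'I_(2 * n)} | (#|T| == k) && splits_rows (n := n) T] == set0).
Proof.
move=> phiE; rewrite -Frobenius_reciprocity cfdotE.
rewrite (eq_bigr (sgnfix k)); last first.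
  by move=> s Rs; rewrite cfun1E Rs mul1r cfResE ?subsetT // phiE sgnfix_conj.
rewrite sum_sgnfix_rows mulf_eq0 invr_eq0 !pnatr_eq0 eqn0Ngt cardG_gt0 /=.
by rewrite cards_eq0.
Qed.

Lemma splits_rows_even (n : nat) : splits_rows (even_points n).
Proof.
apply/forallP=> i; apply/forallP=> j; apply/implyP; rewrite !inE => /andP[/eqP h /eqP o].
by apply/eqP/ord_inj; lia.
Qed.

Lemma splits_rows_card (n : nat) (T : {set 'I_(2 * n)}) : splits_rows T -> (#|T| <= n)%N.
Proof.
move=> /forallP sT.
have half (i : 'I_(2 * n)) : (i./2 < n)%N by have := ltn_ord i; lia.
rewrite -[leqRHS](card_ord n) -(@card_in_imset _ _ (fun i => Ordinal (half i)) T) ?max_card //.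
move=> i j Ti Tj /(congr1 (@nat_of_ord _)) /= ij; apply/eqP.
by have /forallP/(_ j)/implyP := sT i; apply; rewrite ij Ti Tj !eqxx.
Qed.

Lemma sign_char (m : nat) : sign_cfun m \is a character.
Proof.
have sign_repr : mx_repr [set: 'S_m] (fun s => ((-1) ^+ odd_perm s)%:M : 'M[algC]_1).
  by split=> [|s t _ _]; rewrite ?odd_perm1 // odd_permM signr_addb -scalar_mxM.
have -> : sign_cfun m = cfRepr (MxRepresentation sign_repr).
  by apply/cfunP=> s; rewrite !cfunE inE mulr1n mxtrace_scalar.
exact: cfRepr_char.
Qed.

(** Let A and B be the sign characters induced from the stabilizers of sets of size n and n + 1.
    Orbit counting gives <A, A> = n + 1 and <A, B> = <B, B> = n, so A - B is irreducible up to sign.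
    A set separating the points of every row has at most n elements, so the character R induced from
    the row group satisfies <R, B> = 0 < <R, A>. This fixes the sign and makes A - B a constituent
    of R. *)
Lemma specht_char_two_parts (n : nat) (s : 'S_(2 * n)) : (0 < n)%N ->
  specht_char (two_parts n) s = sgnfix n s - sgnfix n.+1 s.
Proof.
move=> n0; pose G := [set: 'S_(2 * n)]%G.
pose A := 'Ind[G, column_group (two_parts n)] ('Res[column_group (two_parts n)] (sign_cfun (2
  * n))).
have AE : A =1 sgnfix n.
  by move=> t; rewrite /A (@Ind_sign _ n _ (even_points n)) ?card_even_points //;
    apply: mem_column_group.
have [D cD] : exists D : {set 'I_(2 * n)}, #|D| = n.+1.
  exists [set j : 'I_(2 * n) | (j < n.+1)%N].
  by apply: etrans (@card_ord_interval _ 0 n.+1 (fun j => j < n.+1)%N _ _) _ => *; lia.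
pose H := ('N(D | 'P))%g.
pose B := 'Ind[G, [group of H]] ('Res[[group of H]] (sign_cfun (2 * n))).
have BE : B =1 sgnfix n.+1.
  move=> t; rewrite /B (@Ind_sign _ n.+1 _ D) // => u; apply/astabsP/eqP => [h|h k].
    apply/setP=> i; rewrite -[i](permKV u) mem_imset; last exact: perm_inj.
    by rewrite -h.
  by rewrite /= /aperm -{1}h mem_imset //; apply: perm_inj.
have charsgn (K : {group 'S_(2 * n)}) : 'Res[K] (sign_cfun (2 * n)) \is a character.
  exact/cfRes_char/sign_char.
have charA : A \is a character by apply: cfInd_char.
have charB : B \is a character by apply: cfInd_char.
have AA : '[A, A] = n.+1%:R.
  rewrite (cfdot_sgnfix AE AE); congr _%:R.
  by apply: etrans (@card_ord_interval _ 0 n.+1 (fun j => [&& n + n <= j + 2 * n,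
    j <= n & j <= n])%N _ _) _ => *; lia.
have AB : '[A, B] = n%:R.
  rewrite (cfdot_sgnfix AE BE); congr _%:R.
  by apply: etrans (@card_ord_interval _ 1 n.+1 (fun j => [&& n + n.+1 <= j + 2 * n,
    j <= n & j <= n.+1])%N _ _) _ => *; lia.
have BB : '[B, B] = n%:R.
  rewrite (cfdot_sgnfix BE BE); congr _%:R.
  by apply: etrans (@card_ord_interval _ 2 n.+2 (fun j => [&& n.+1 + n.+1 <= j + 2 * n,
    j <= n.+1 & j <= n.+1])%N _ _) _ => *; lia.
have BA : '[B, A] = n%:R by rewrite cfdotC AB conjC_nat.
have norm : '[A - B] = 1.
  by rewrite cfdotBl !cfdotBr AA AB BA BB -natr1; ring.
have Zpsi : A - B \in 'Z[irr G]%g by apply: rpredB; apply: char_vchar.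
pose RR := 'Ind[G, row_group (two_parts n)] 1.
have charR : RR \is a character by apply/cfInd_char/cfun1_char.
have RB : '[RR, B] = 0.
  apply/eqP; rewrite (cfdot_row_sgnfix BE); apply/eqP/setP=> T; rewrite !inE.
  by apply/negP=> /andP[/eqP cT /splits_rows_card]; rewrite cT ltnn.
have RA : '[RR, A] != 0.
  rewrite (cfdot_row_sgnfix AE); apply/set0Pn; exists (even_points n).
  by rewrite inE card_even_points eqxx splits_rows_even.
have RApos : 0 < '[RR, A].
  by rewrite lt_def RA /= natr_ge0 // Cnat_cfdot_char.
have [b [i psiE]] := vchar_norm1P Zpsi norm.
have Rpsi : 0 < '[RR, A - B] by rewrite cfdotBr RB subr0.
have {}psiE : A - B = 'chi_i.
  move: psiE Rpsi; case: b => //; last by rewrite expr0 scale1r.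
  rewrite expr1 scaleN1r => ->; rewrite cfdotNr oppr_gt0 => /lt_geF.
  by rewrite natr_ge0 // Cnat_cfdot_char ?irr_char.
have Bpsi : A = 'chi_i + B by rewrite -psiE subrK.
have iR : i \in irr_constt RR.
  by rewrite irr_consttE -psiE; apply: lt0r_neq0.
have iA : i \in irr_constt A.
  rewrite irr_consttE -psiE cfdotBr AA AB -natr1 addrAC subrr add0r.
  exact: oner_neq0.
rewrite /specht_char; case: pickP => [j /andP[jR jA]|/(_ i)]; last first.
  by rewrite /= iR; move: iA; rewrite /A => ->.
(* The result of [pick] has to be unique: a constituent of R does not occur in B, and A is the sum
   of ['chi_i] and B, so a common constituent of R and A is ['chi_i]. *)
suff -> : j = i by rewrite -psiE !cfunE -AE -BE.
apply/eqP; apply: contraTT jA => neq.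
have jB : '[B, 'chi_j] = 0.
  have terms_ge0 k : true -> 0 <= '[RR, 'chi_k] * ('[B, 'chi_k])^*.
    by move=> _; apply: mulr_ge0; rewrite ?conj_natr ?natr_ge0 ?Cnat_cfdot_char_irr.
  have := RB; rewrite cfdot_sum_irr => /(psumr_eq0P terms_ge0)/(_ j isT)/eqP.
  rewrite mulf_eq0 conjC_eq0 => /orP[/eqP|/eqP//].
  by move/eqP; rewrite -[_ == 0]negbK -irr_consttE jR.
by rewrite irr_consttE negbK -/A Bpsi cfdotDl jB addr0 cfdot_irr [i == j]eq_sym (negPf neq).
Qed.

Lemma chi_two_parts (n : nat) (s : 'S_(2 * n)) : (0 < n)%N ->
  chi (two_parts n) s =
  (-1) ^+ odd_perm s * (#|fixed_sets n s|%:Z - #|fixed_sets n.+1 s|%:Z).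
Proof.
move=> n0; rewrite /chi specht_char_two_parts // /sgnfix -mulrBr.
set z := RHS; rewrite (_ : _ * _ = z%:~R) ?intrKfloor //.
by rewrite rmorphM rmorph_sign rmorphB /= !pmulrn.
Qed.

(** * The immanant as a sum of products of determinants *)

Section MaskedDeterminants.
Variable R : comNzRingType.

(** Up to a simultaneous permutation of rows and columns this is block diagonal with blocks B[S] and
    B[~S]; zeroing the mixed entries avoids reindexing submatrices. *)
Definition mask_mx (m : nat) (S : {set 'I_m}) (B : 'M[R]_m) : 'M[R]_m :=
  \matrix_(i, j) if (i \in S) == (j \in S) then B i j else 0.

(** The exponent records #|S|, so that the sum over all S can be factored before the two
    coefficients needed for the immanant are extracted. *)
Definition mask_poly (m : nat) (B : 'M[R]_m) : {poly R} :=
  \sum_(S : {set 'I_m}) (\det (mask_mx S B))%:P * 'X^#|S|.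

Lemma fixed_setP (m : nat) (s : 'S_m) (S : {set 'I_m}) :
  reflect (forall i, (s i \in S) = (i \in S)) (s @: S == S).
Proof.
apply: (iffP eqP) => [e i|h].
  by rewrite -{1}e mem_imset //; apply: perm_inj.
by apply/setP=> i; rewrite -[i](permKV s) mem_imset ?h //; apply: perm_inj.
Qed.

Lemma det_mask (m : nat) (S : {set 'I_m}) (B : 'M[R]_m) :
  \det (mask_mx S B) =
  \sum_(s : 'S_m | s @: S == S) (-1) ^+ odd_perm s * \prod_i B i (s i).
Proof.
rewrite big_mkcond; apply: eq_bigr => s _.
case: (boolP (s @: S == S)) => [/fixed_setP h|h].
  by congr (_ * _); apply: eq_bigr => i _; rewrite mxE h eqxx.
have [i ni] : exists i, (i \in S) != (s i \in S).
  apply/existsP; apply: contraNT h => /existsPn h; apply/fixed_setP=> i.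
  by have := h i; rewrite negbK => /eqP.
by rewrite (bigD1 i) //= mxE (negPf ni) mul0r mulr0.
Qed.

Lemma Imm_two_parts (n : nat) (B : 'M[R]_(2 * n)) : (0 < n)%N ->
  Imm (two_parts n) B = (mask_poly B)`_n - (mask_poly B)`_n.+1.
Proof.
move=> n0.
have coefG k : (mask_poly B)`_k =
    \sum_(s : 'S_(2 * n)) (-1) ^+ odd_perm s * (#|fixed_sets k s|%:R * \prod_i B i (s i)).
  rewrite coef_sum (eq_bigr (fun S : {set 'I_(2 * n)} =>
    if #|S| == k then \det (mask_mx S B) else 0)).
    rewrite -big_mkcond (eq_bigr _ (fun S _ => det_mask S B)).
    rewrite (exchange_big_dep xpredT) //=; apply: eq_bigr => s _.
    rewrite sumr_const mulrCA mulr_natl; congr (_ *+ _).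
    by apply: eq_card => S; rewrite inE.
  by move=> S _; rewrite coefMXn coefC ltn_neqAle subn_eq0; case: ltngtP.
rewrite !coefG -sumrB; apply: eq_bigr => s _; rewrite chi_two_parts //.
by rewrite rmorphM rmorphB rmorph_sign /= -!pmulrn -mulrBr -mulrBl mulrA.
Qed.

Definition join_sets (a b : nat) (A : {set 'I_a}) (B : {set 'I_b}) : {set 'I_(a + b)} :=
  [set i | match split i with inl j => j \in A | inr j => j \in B end].

Lemma join_setsl a b (A : {set 'I_a}) (B : {set 'I_b}) i : (lshift b i \in join_sets A B) =
  (i \in A).
Proof. by rewrite inE (unsplitK (inl i)). Qed.

Lemma join_setsr a b (A : {set 'I_a}) (B : {set 'I_b}) i : (rshift a i \in join_sets A B) =
  (i \in B).
Proof. by rewrite inE (unsplitK (inr i)). Qed.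

Lemma card_join_sets a b (A : {set 'I_a}) (B : {set 'I_b}) : #|join_sets A B| = (#|A| + #|B|)%N.
Proof.
rewrite -!sum1_card big_mkcond big_split_ord /= [in RHS]big_mkcond [in X in (_ =
  _ + X)%N]big_mkcond.
by congr (_ + _)%N; apply: eq_bigr => i _; rewrite (join_setsl, join_setsr).
Qed.

Lemma sum_join_sets (V : nmodType) a b (F : {set 'I_(a + b)} -> V) :
  \sum_S F S = \sum_(A : {set 'I_a}) \sum_(B : {set 'I_b}) F (join_sets A B).
Proof.
rewrite pair_bigA (reindex (fun p : {set 'I_a} * {set 'I_b} => join_sets p.1 p.2)) //=.
exists (fun S : {set 'I_(a + b)} => (@lshift a b @^-1: S : {set 'I_a},
  @rshift a b @^-1: S : {set 'I_b})) => [[A B]|S] _ /=.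
  by congr pair; apply/setP=> i; rewrite inE (join_setsl, join_setsr).
apply/setP=> i; rewrite inE; case: split_ordP => j ->; by rewrite inE.
Qed.

(* Eliminating the vertices that carry a unit loop (a Schur complement) *)
Lemma det_mask_block a b (U : 'M[R]_(a, b)) (V : 'M[R]_(b, a)) A B :
  \det (mask_mx (join_sets A B) (block_mx 0 U V 1%:M)) =
  \det (\matrix_(i, j) if (i \in A) == (j \in A)
                       then - \sum_(e | (e \in B) == (i \in A)) U i e * V e j else 0).
Proof.
pose U' : 'M[R]_(a, b) := \matrix_(i, e) if (e \in B) == (i \in A) then U i e else 0.
pose V' : 'M[R]_(b, a) := \matrix_(e, i) if (e \in B) == (i \in A) then V e i else 0.
have -> : mask_mx (join_sets A B) (block_mx 0 U V 1%:M) = block_mx 0 U' V' 1%:M.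
  apply/matrixP=> i j; rewrite !mxE.
  case: (split_ordP i) => i' ->; case: (split_ordP j) => j' ->;
    rewrite ?(join_setsl, join_setsr) ?mxE ?(unsplitK (inl _)) ?(unsplitK (inr _)) ?mxE //.
  - by rewrite if_same.
  - by rewrite eq_sym.
  - by case: (i' =P j') => [->|_]; rewrite ?eqxx ?if_same.
have -> : \det (block_mx 0 U' V' 1%:M) = \det (- (U' *m V')).
  have := det_mulmx (block_mx 0 U' V' 1%:M) (block_mx 1%:M 0 (- V') 1%:M).
  rewrite mulmx_block !mulmx0 !mul0mx !mulmx1 !mul1mx !add0r ?addr0 addrN mulmxN.
  by rewrite det_ublock det_lblock !det1 !mulr1.
congr (\det _); apply/matrixP=> i j; rewrite !mxE.
have [e|ne] := eqVneq (i \in A) (j \in A).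
  congr (- _); rewrite [RHS]big_mkcond; apply: eq_bigr => k _.
  by rewrite !mxE -e; case: ifP; rewrite ?mul0r.
rewrite big1 ?oppr0 // => k _; rewrite !mxE.
by case: eqP => [->|]; rewrite ?mul0r // (negPf ne) mulr0.
Qed.
End MaskedDeterminants.

(** * The permanent as an immanant *)

Section PairedVertices.
Variables (R : comNzRingType) (n : nat).

Definition side (k : 'I_(n + n)) : bool := if split k is inl _ then true else false.
Definition base (k : 'I_(n + n)) : 'I_n := match split k with inl i => i | inr i => i end.

Lemma side_lshift i : side (lshift n i) = true. Proof. by rewrite /side (unsplitK (inl i)). Qed.
Lemma side_rshift i : side (rshift n i) = false. Proof. by rewrite /side (unsplitK (inr i)). Qed.
Lemma base_lshift i : base (lshift n i) = i. Proof. by rewrite /base (unsplitK (inl i)). Qed.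
Lemma base_rshift i : base (rshift n i) = i. Proof. by rewrite /base (unsplitK (inr i)). Qed.
Definition pairE := (side_lshift, side_rshift, base_lshift, base_rshift).

(** Exchanges the two copies of each i outside A. When the left copies are coloured by A and the
    right ones by its complement, the left half becomes a single colour class. *)
Definition flip_pairs (A : {set 'I_n}) (k : 'I_(n + n)) : 'I_(n + n) :=
  if (base k \in A) == side k then lshift n (base k) else rshift n (base k).

Lemma flip_pairsK A : involutive (flip_pairs A).
Proof.
move=> k; case: (split_ordP k) => i ->; rewrite /flip_pairs !pairE;
  by case Ai: (i \in A); rewrite /= !pairE Ai.
Qed.

Lemma det_conj_perm m (s : 'S_m) (M : 'M[R]_m) : \det (\matrix_(i, j) M (s i) (s j)) = \det M.
Proof.
have -> : \matrix_(i, j) M (s i) (s j) = perm_mx s *m M *m perm_mx s^-1.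
  by rewrite -row_permE -col_permE; apply/matrixP=> i j; rewrite !mxE.
by rewrite !det_mulmx !det_perm odd_permV mulrAC -expr2 sqrr_sign mul1r.
Qed.

(* Two twin vertices [lshift n i] and [rshift n i] of the same colour give equal
   rows; otherwise the two colour classes contain one copy of each vertex. *)
Lemma det_twins (f : bool -> bool -> 'M[R]_n) (A0 A1 : {set 'I_n}) :
  \det (\matrix_(k, l) let c := k \in join_sets A0 A1 in
        if c == (l \in join_sets A0 A1) then f c (side l) (base k) (base l) else 0) =
  if A1 == ~: A0 then
    \det (\matrix_(i, j) f true (j \in A0) i j) *
    \det (\matrix_(i, j) f false (j \notin A0) i j)
  else 0.
Proof.
case: eqP => [->|ne].
  rewrite -(det_conj_perm (perm (inv_inj (@flip_pairsK A0)))).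
  rewrite -(det_lblock _ (0 : 'M_(n, n))); congr (\det _).
  apply/matrixP=> k l; rewrite !mxE !permE.
  case: (split_ordP k) => i ->; case: (split_ordP l) => j ->;
    rewrite /flip_pairs !pairE ?mxE ?(unsplitK (inl _)) ?(unsplitK (inr _)) ?mxE;
    case Ai: (i \in A0); case Aj: (j \in A0);
    by rewrite /= ?(join_setsl, join_setsr) ?pairE ?inE ?Ai ?Aj.
have [i ei] : exists i, (i \in A0) == (i \in A1).
  apply/existsP; apply: contra_notT ne => /existsPn h; apply/setP=> i; rewrite inE.
  by have := h i; case: (i \in A0); case: (i \in A1).
apply: (@determinant_alternate _ _ _ (lshift n i) (rshift n i)); first by rewrite eq_lrshift.
by move=> l; rewrite !mxE join_setsl join_setsr !pairE (eqP ei).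
Qed.
End PairedVertices.

Lemma sum_two_sets (R : comNzRingType) (I : finType) (g : I -> bool -> bool -> R) :
  \sum_(P : {set I}) \sum_(Q : {set I}) \prod_e g e (e \in P) (e \in Q) =
  \prod_e (g e true true + g e true false + (g e false true + g e false false)).
Proof.
rewrite bigA_distr; apply: eq_bigr => P _.
rewrite (eq_bigr (fun e => g e (e \in P) true + g e (e \in P) false)); last first.
  by move=> e _; case: (e \in P).
rewrite bigA_distr; apply: eq_bigr => Q _; apply: eq_bigr => e _.
by case: (e \in Q).
Qed.

Lemma big_mxvec_index (T : Type) (idx : T) (op : Monoid.com_law idx) m n (G : 'I_(m * n) -> T) :
  \big[op/idx]_e G e = \big[op/idx]_(i < m) \big[op/idx]_(j < n) G (mxvec_index i j).
Proof.
rewrite pair_bigA (reindex (uncurry (@mxvec_index m n))) /=; first by apply: eq_bigr => -[].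
by have [F FK KF] := @curry_mxvec_bij m n; exists F => x _; [apply: FK | apply: KF].
Qed.

(** From (k + 1) C(2k, k + 1) = k C(2k, k). Strictness keeps the constant of the gadget nonzero. *)
Lemma central_bin_lt (k : nat) : ('C(2 * k, k.+1) < 'C(2 * k, k))%N.
Proof.
have pos : (0 < 'C(2 * k, k))%N by rewrite bin_gt0 mul2n -addnn leq_addr.
have := mul_bin_left (2 * k) k; rewrite (_ : 2 * k - k = k)%N; last by lia.
nia.
Qed.

(** * The gadget matrix and its generating polynomial *)

Section Gadget.
Variables (R : comNzRingType) (n : nat) (A : 'M[R]_n).

(* Each pair (i, j) has two vertices with unit loops, reached from both copies of i with
   the opposite weights 1 and -1, and leading to the two copies of j with the weights
   [A i j] and 1. *)
Definition out_weights : 'M[R]_(n + n, n * n + n * n) :=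
  \matrix_(k, e) match split e with
    | inl e => mxvec (\matrix_(i, j) (i == base k)%:R) 0 e
    | inr e => - mxvec (\matrix_(i, j) (i == base k)%:R) 0 e end.

Definition in_weight (b : bool) (i j : 'I_n) : R := if b then A i j else 1.

Definition in_weights : 'M[R]_(n * n + n * n, n + n) :=
  \matrix_(e, l) match split e with inl e | inr e =>
     mxvec (\matrix_(i, j) ((j == base l)%:R * in_weight (side l) i j)) 0 e end.

Definition gadget : 'M[R]_((n + n) + (n * n + n * n)) :=
  block_mx 0 out_weights in_weights 1%:M.

(** Weight of the passage from i to j inside colour class c once the two vertices of (i, j) are
    eliminated; P and Q are the parts of S among the vertices of out-weight 1 and -1. It vanishes
    when both vertices have the same colour, and changes sign with c. *)
Definition route (P Q : {set 'I_(n * n)}) (c : bool) (i j : 'I_n) : R :=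
  ((mxvec_index i j \in Q) == c)%:R - ((mxvec_index i j \in P) == c)%:R.

Lemma sum_routes P Q c k l :
  - (\sum_(e | (e \in join_sets P Q) == c) out_weights k e * in_weights e l) =
  route P Q c (base k) (base l) * in_weight (side l) (base k) (base l).
Proof.
rewrite big_mkcond big_split_ord /= !big_mxvec_index.
have one (f : 'I_n -> 'I_n -> R) :
  \sum_i \sum_j (i == base k)%:R * ((j == base l)%:R * f i j) = f (base k) (base l).
  rewrite (bigD1 (base k)) //= (bigD1 (base l)) //= !eqxx !mul1r !big1 ?addr0 //.
    by move=> i /negPf ->; rewrite big1 // => j _; rewrite mul0r.
  by move=> j /negPf ->; rewrite mul0r mulr0.
transitivity (- (\sum_i \sum_j (i == base k)%:R * ((j == base l)%:R *
      (((mxvec_index i j \in P) == c)%:R * in_weight (side l) i j))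
  + \sum_i \sum_j (i == base k)%:R * ((j == base l)%:R *
      (- ((mxvec_index i j \in Q) == c)%:R * in_weight (side l) i j)))).
  congr (- (_ + _)); apply: eq_bigr => i _; apply: eq_bigr => j _.
    rewrite join_setsl !mxE (unsplitK (inl _)) !mxvecE !mxE.
    by case: eqP => _; rewrite /= ?mul1r ?mul0r ?mulr0.
  rewrite join_setsr !mxE (unsplitK (inr _)) !mxvecE !mxE.
  by case: (_ == c); rewrite /= ?oppr0 ?mulN1r ?mulNr ?mulrN ?mul0r ?mulr0.
by rewrite !one /route; ring.
Qed.

(** The sum factors over the pairs (i, j). A pair used by neither permutation contributes (1 + X)^2.
    Used by one only, its two nonzero terms X and -X cancel. Used by both, each of the two unequal
    colourings contributes -X. Hence only s = t survives, with n used pairs. *)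
Lemma sum_route_sets (s t : 'S_n) :
  \sum_(P : {set 'I_(n * n)}) \sum_(Q : {set 'I_(n * n)})
    (\prod_i (route P Q true i (s i) * route P Q false i (t i)))%:P * 'X^(#|P| + #|Q|) =
  if s == t then ('X *- 2) ^+ n * (1 + 'X) ^+ (2 * (n * n - n)) else 0.
Proof.
pose d (c p q : bool) : {poly R} := ((q == c)%:R - (p == c)%:R)%:P.
pose g (i j : 'I_n) (p q : bool) : {poly R} := (if j == s i then d true p q else 1) *
   (if j == t i then d false p q else 1) * ((if p then 'X else 1) * (if q then 'X else 1)).
have pick (f : 'I_n -> 'I_n -> {poly R}) (u : 'S_n) : \prod_i f i (u i) =
  \prod_i \prod_j if j == u i then f i j else 1.
  by apply: eq_bigr => i _; rewrite -big_mkcond big_pred1_eq.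
have powX (P : {set 'I_(n * n)}) : 'X^#|P| =
  \prod_i \prod_j if mxvec_index i j \in P then 'X else 1 :> {poly R}.
  by rewrite -prodr_const big_mkcond big_mxvec_index.
transitivity (\sum_(P : {set 'I_(n * n)}) \sum_(Q : {set 'I_(n * n)})
    \prod_i \prod_j g i j (mxvec_index i j \in P) (mxvec_index i j \in Q)).
  apply: eq_bigr => P _; apply: eq_bigr => Q _.
  rewrite exprD !powX rmorph_prod (eq_bigr _ (fun i _ => rmorphM polyC _ _)) big_split /=.
  rewrite (pick (fun i j => (route P Q true i j)%:P)) (pick (fun i j =>
    (route P Q false i j)%:P)).
  rewrite -!big_split; apply: eq_bigr => i _; rewrite -!big_split; apply: eq_bigr => j _.
  by [].
have g4 i j : g i j true true + g i j true false + (g i j false true + g i j false false) =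
   if (j == s i) && (j == t i) then 'X *- 2 else if (j == s i) || (j == t i) then 0 else (1 +
     'X) ^+ 2.
  rewrite /g /d; case: (j == s i); case: (j == t i);
    rewrite /= ?subrr ?subr0 ?sub0r ?rmorphN ?rmorph1 ?rmorph0; ring.
transitivity (\prod_i \prod_j (g i j true true + g i j true false + (g i j false true + g i j
  false false))).
  have [F FK KF] := @curry_mxvec_bij n n.
  pose h' e p q := g (F e).1 (F e).2 p q.
  have hE i j p q : g i j p q = h' (mxvec_index i j) p q.
    by rewrite /h'; have := FK (i, j) isT; rewrite /= => ->.
  rewrite (eq_bigr (fun P : {set 'I_(n * n)} =>
    \sum_(Q : {set 'I_(n * n)}) \prod_e h' e (e \in P) (e \in Q))) ?sum_two_sets; last first.
    move=> P _; apply: eq_bigr => Q _; rewrite big_mxvec_index.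
    by apply: eq_bigr => i _; apply: eq_bigr => j _; rewrite hE.
  rewrite big_mxvec_index.
  by apply: eq_bigr => i _; apply: eq_bigr => j _; rewrite !hE.
have [est|ne] := eqVneq s t.
  rewrite (eq_bigr (fun=> 'X *- 2 * (1 + 'X) ^+ (2 * (n - 1)))) => [|i _].
    rewrite big_split /= !prodr_const card_ord -exprM; congr (_ * _ ^+ _).
    by rewrite mulnBr muln1; nia.
  rewrite (bigD1 (t i)) //= g4 est !eqxx /=; congr (_ * _).
  rewrite (eq_bigr (fun=> (1 + 'X) ^+ 2)) => [|j /negPf nj]; last by rewrite g4 est nj.
  rewrite prodr_const -exprM; congr (_ ^+ (_ * _)).
  by rewrite cardC1 card_ord subn1.
have [i nsi] : exists i, s i != t i.
  apply/existsP; apply: contraNT ne => /existsPn h; apply/eqP/permP => i.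
  by have := h i; rewrite negbK => /eqP.
by rewrite (bigD1 i) //= (bigD1 (s i)) //= g4 eqxx (negPf nsi) /= !mul0r.
Qed.

(** The colour classes must contain complementary copies of the vertices, which leaves 2^n choices
    of A0, each of weight X^n. For given A0 and j, the copy of j in one class carries the weight A i
    j and the other copy the weight 1. So the terms with s = t give the product of the A i (s i),
    and their two signs cancel. *)
Lemma mask_poly_gadget :
  mask_poly gadget =
  (per A)%:P * ('X^n *+ 2 ^ n * (('X *- 2) ^+ n * (1 + 'X) ^+ (2 * (n * n - n)))).
Proof.
rewrite /mask_poly sum_join_sets.
pose f P Q (c b : bool) : 'M[R]_n := \matrix_(i, j) (route P Q c i j * in_weight b i j).
pose D (A0 : {set 'I_n}) P Q := \det (\matrix_(i, j) f P Q true (j \in A0) i j) *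
                 \det (\matrix_(i, j) f P Q false (j \notin A0) i j).
have detE A0 A1 P Q :
    \det (mask_mx (join_sets (join_sets A0 A1) (join_sets P Q)) gadget) =
    if A1 == ~: A0 then D A0 P Q else 0.
  rewrite det_mask_block -(det_twins (f P Q)); congr (\det _); apply/matrixP=> k l.
  by rewrite !mxE /=; case: eqP => // _; rewrite sum_routes !mxE.
rewrite sum_join_sets.
transitivity (\sum_(A0 : {set 'I_n}) 'X^n *
  \sum_(P : {set 'I_(n * n)}) \sum_(Q : {set 'I_(n * n)}) (D A0 P Q)%:P * 'X^(#|P| + #|Q|)).
  apply: eq_bigr => A0 _.
  rewrite (bigD1 (~: A0)) //= [X in _ + X]big1 ?addr0 => [|A1 /negPf nA].
    rewrite sum_join_sets mulr_sumr; apply: eq_bigr => P _.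
    rewrite mulr_sumr; apply: eq_bigr => Q _.
    rewrite detE eqxx !card_join_sets cardsC card_ord exprD; ring.
  rewrite sum_join_sets big1 // => P _; rewrite big1 // => Q _.
  by rewrite detE nA mul0r.
pose W := ('X *- 2) ^+ n * (1 + 'X) ^+ (2 * (n * n - n)) : {poly R}.
rewrite (eq_bigr (fun=> 'X^n * ((per A)%:P * W))).
  rewrite sumr_const (_ : #|_| = 2 ^ n)%N; last first.
    have := card_powerset [set: 'I_n]; rewrite cardsT card_ord => <-.
    by apply: eq_card => S; rewrite !inE subsetT.
  by rewrite -/W mulrnAl mulrnAr mulrCA.
move=> A0 _; congr (_ * _).
transitivity (\sum_(s : 'S_n) \sum_(t : 'S_n) ((-1) ^+ odd_perm s * (-1) ^+ odd_perm t *
   \prod_i (in_weight (s i \in A0) i (s i) * in_weight (t i \notin A0) i (t i)))%:P *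
   (if s == t then W else 0)).
  transitivity (\sum_(P : {set 'I_(n * n)}) \sum_(Q : {set 'I_(n * n)})
    \sum_(s : 'S_n) \sum_(t : 'S_n) ((-1) ^+ odd_perm s * (-1) ^+ odd_perm t *
   \prod_i (in_weight (s i \in A0) i (s i) * in_weight (t i \notin A0) i (t i)))%:P *
    ((\prod_i (route P Q true i (s i) * route P Q false i (t i)))%:P * 'X^(#|P| + #|Q|))).
    apply: eq_bigr => P _; apply: eq_bigr => Q _.
    rewrite /D /determinant mulr_suml rmorph_sum mulr_suml; apply: eq_bigr => s _.
    rewrite mulr_sumr rmorph_sum mulr_suml; apply: eq_bigr => t _.
    rewrite [RHS]mulrA -polyCM; congr (_%:P * _).
    rewrite mulrACA -!mulrA; congr (_ * (_ * _)).
    rewrite -!big_split; apply: eq_bigr => i _ /=; rewrite !mxE /=; ring.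
  rewrite (eq_bigr _ (fun P _ => exchange_big _ _ _ _ _ _)) exchange_big; apply: eq_bigr => s _.
  rewrite (eq_bigr _ (fun P _ => exchange_big _ _ _ _ _ _)) exchange_big; apply: eq_bigr => t _.
  rewrite -sum_route_sets mulr_sumr; apply: eq_bigr => P _.
  by rewrite mulr_sumr.
rewrite /per rmorph_sum mulr_suml; apply: eq_bigr => s _.
rewrite (bigD1 s) //= eqxx [X in _ + X]big1 ?addr0 => [|t nt]; last first.
  by rewrite eq_sym (negPf nt) mulr0.
congr (_%:P * _); rewrite -expr2 sqrr_sign mul1r; apply: eq_bigr => i _.
by case: (s i \in A0); rewrite /= ?mulr1 ?mul1r.
Qed.

(** The generating polynomial is a scalar times X^(2n) (1 + X)^(2M), and its central degree is 2n +
    M = n + n^2; hence the two middle binomials. *)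
Lemma mask_poly_gadget_coef (M := (n * n - n)%N) :
  (mask_poly gadget)`_(n + n * n) - (mask_poly gadget)`_(n + n * n).+1 =
  per A * ((-1) ^+ n * (4 ^ n * ('C(2 * M, M) - 'C(2 * M, M.+1)))%:R).
Proof.
have lin (r : R) (p q : {poly R}) : p = r%:P * (q * 'X^(2 * n)) ->
    forall k, p`_(2 * n + k) = r * q`_k.
  by move=> -> k; rewrite coefCM coefMXn ltnNge leq_addr addKn.
have e : mask_poly gadget = (per A * ((-1) ^+ n * (4 ^ n)%:R))%:P * ((1 + 'X) ^+ (2 * M) *
  'X^(2 * n)).
  have X2 : 'X^(2 * n) = 'X^n * 'X^n :> {poly R} by rewrite mul2n -addnn exprD.
  rewrite mask_poly_gadget -/M X2 !polyCM rmorphXn rmorphN rmorph1 rmorph_nat.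
  have -> : 'X *- 2 = -1 * 2%:R * 'X :> {poly R} by ring.
  rewrite -mulr_natl !exprMn !natrX (_ : 4%:R = 2%:R * 2%:R :> {poly R}); last by ring.
  by rewrite exprMn; ring.
have bin k : ((1 + 'X : {poly R}) ^+ (2 * M))`_k = 'C(2 * M, k)%:R.
  rewrite exprDn coef_sum.
  case: (ltnP k (2 * M).+1) => [lk|gk].
    rewrite (bigD1 (Ordinal lk)) //= big1 => [|i ni].
      by rewrite expr1n mul1r coefMn coefXn eqxx addr0 mulr1n.
    rewrite expr1n mul1r coefMn coefXn; case: eqP => [ki|_]; last by rewrite mul0rn.
    by case/eqP: ni; apply: ord_inj.
  rewrite bin_small // big1 // => i _.
  rewrite expr1n mul1r coefMn coefXn; case: eqP => [ki|_]; last by rewrite mul0rn.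
  by have := ltn_ord i; rewrite -ki ltnNge gk.
have -> : (n + n * n = 2 * n + M)%N by rewrite /M; nia.
rewrite -addnS !(lin _ _ _ e) !bin -mulrBr -mulrA; congr (_ * _).
rewrite natrM natrB ?mulrA //.
exact/ltnW/central_bin_lt.
Qed.
End Gadget.

Lemma Imm_scale_row (R : comNzRingType) m (la : partition_of m) (c : R) (i0 : 'I_m) (B :
  'M[R]_m) :
  Imm la (\matrix_(i, j) ((if i == i0 then c else 1) * B i j)) = c * Imm la B.
Proof.
rewrite /Imm mulr_sumr; apply: eq_bigr => s _; rewrite mulrCA; congr (_ * _).
rewrite (bigD1 i0) //= [in RHS](bigD1 i0) //= mxE eqxx mulrA; congr (_ * _).
by apply: eq_bigr => i /negPf ni; rewrite mxE ni mul1r.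
Qed.

Lemma mask_poly_cast (R : comNzRingType) m m' (e : m = m') (B : 'M[R]_m) :
  mask_poly (castmx (e, e) B) = mask_poly B.
Proof. by case: _ / e; rewrite castmx_id. Qed.

Definition gadget_size (n : nat) : nat := n + n * n.

Fact gadget_sizeE (n : nat) : (n + n + (n * n + n * n) = 2 * gadget_size n)%N.
Proof. by rewrite /gadget_size; lia. Qed.

Definition entry_val (F : fieldType) (n : nat) (R : comNzRingType) (phi : F -> R)
    (A : 'M[R]_n) (e : F + 'I_n * 'I_n) : R :=
  match e with inl c => phi c | inr (p, q) => A p q end.

Definition gadget_const (n : nat) (M := (n * n - n)%N) : nat :=
  4 ^ n * ('C(2 * M, M) - 'C(2 * M, M.+1)).

Lemma gadget_const_gt0 n : (0 < gadget_const n)%N.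
Proof. by rewrite muln_gt0 expn_gt0 subn_gt0 central_bin_lt. Qed.

Lemma Imm_gadget (R : comNzRingType) n (A : 'M[R]_n) : (0 < n)%N ->
  Imm (two_parts (gadget_size n)) (castmx (gadget_sizeE n, gadget_sizeE n) (gadget A)) =
  per A * ((-1) ^+ n * (gadget_const n)%:R).
Proof.
move=> n0; rewrite Imm_two_parts ?mask_poly_cast ?mask_poly_gadget_coef //.
by rewrite /gadget_size addn_gt0 n0.
Qed.

(** The scaled row lies in the upper half of the gadget, where all entries are constants: zeros and
    out-weights. So c is absorbed without multiplying an entry of A. Quantifying over R and phi
    gives one pattern for matrices over F and matrices of polynomials. *)
Lemma gadget_entry (F : fieldType) n (c : F) (k0 : 'I_(n + n)) i j :
  exists e : F + 'I_n * 'I_n,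
  forall (R : comNzRingType) (phi : {rmorphism F -> R}) (A : 'M[R]_n),
    entry_val phi A e = (if i == lshift (n * n + n * n) k0 then phi c else 1) * gadget A i j.
Proof.
case: (split_ordP i) => i' ->; case: (split_ordP j) => j' ->.
- by exists (inl 0) => R phi A /=; rewrite block_mxEul mxE mulr0 rmorph0.
- exists (inl ((if i' == k0 then c else 1) * out_weights F n i' j')) => R phi A /=.
  rewrite block_mxEur eq_lshift rmorphM; congr (_ * _); first by case: ifP; rewrite ?rmorph1.
  rewrite !mxE; case: (split_ordP j') => e _; case/mxvec_indexP: e => p q.
    by rewrite !mxvecE !mxE rmorph_nat.
  by rewrite !mxvecE !mxE rmorphN rmorph_nat.
- have [e eE] : exists e : F + 'I_n * 'I_n, forall (R : comNzRingType) (phi : {rmorphism F ->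
  R}) (A : 'M[R]_n),
    entry_val phi A e = in_weights A i' j'.
    have [e eE] : exists e : 'I_(n * n), forall (R : comNzRingType) (A : 'M[R]_n),
       in_weights A i' j' = mxvec (\matrix_(i, j) ((j == base j')%:R * in_weight A (side j')
         i j)) 0 e.
      by exists (match split i' with inl e | inr e => e end) => R A; rewrite mxE; case: split.
    move: eE; case/mxvec_indexP: e => p q eE.
    exists (if q == base j' then if side j' then inr (p, q) else inl 1 else inl 0) => R phi A.
    rewrite eE mxvecE !mxE /in_weight.
    by case: eqP => _; case: side; rewrite /= ?mul1r ?mul0r ?rmorph0 ?rmorph1.
  by exists e => R phi A; rewrite eE block_mxEdl eq_rlshift mul1r.
exists (inl (i' == j')%:R) => R phi A.
by rewrite /= block_mxEdr eq_rlshift mul1r mxE rmorph_nat.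
Qed.

Lemma per_as_Imm (F : fieldType) (charF0 : [pchar F] =i pred0) n : (0 < n)%N ->
  exists P : mx_pattern F n (2 * gadget_size n),
  forall (R : comNzRingType) (phi : {rmorphism F -> R}) (A : 'M[R]_n),
    Imm (two_parts (gadget_size n)) (\matrix_(i, j) entry_val phi A (P i j)) = per A.
Proof.
move=> n0; pose K : F := (-1) ^+ n * (gadget_const n)%:R.
have K0 : K != 0.
  rewrite mulf_neq0 ?signr_eq0 //.
  by rewrite ((pcharf0P F).1 charF0) -lt0n gadget_const_gt0.
pose k0 := lshift n (Ordinal n0).
have [P PE] := fin_all_exists (fun ij : 'I_(n + n + (n * n + n * n)) * 'I_(n + n + (n * n + n
  * n)) => gadget_entry K^-1 k0 ij.1 ij.2).
pose ce := cast_ord (esym (gadget_sizeE n)).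
exists (\matrix_(i, j) P (ce i, ce j)) => R phi A.
transitivity (Imm (two_parts (gadget_size n)) (\matrix_(i, j)
   ((if i == cast_ord (gadget_sizeE n) (lshift _ k0) then phi K^-1 else 1) *
     castmx (gadget_sizeE n, gadget_sizeE n) (gadget A) i j))).
  congr Imm; apply/matrixP=> i j; rewrite !mxE PE castmxE /=.
  by congr (_ * _); rewrite -(inj_eq (@cast_ord_inj _ _ (gadget_sizeE n))) cast_ordKV.
rewrite Imm_scale_row Imm_gadget // mulrCA.
have -> : (-1) ^+ n * (gadget_const n)%:R =
  phi K by rewrite /K (rmorphM phi) rmorphXn rmorphN1 rmorph_nat.
by rewrite -rmorphM mulVf // rmorph1 mulr1.
Qed.

(** * Coefficients of the product of all variables *)

Section TopCoefficient.
Variables (R : comNzRingType) (n : nat).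
Implicit Types (p q T A B C D : {mpoly R[n]}) (i z : 'I_n).

Definition all_ones : 'X_{1..n} := [multinom 1%N | _ < n].
Definition top p : R := p@_all_ones.

Lemma topD p q : top (p + q) = top p + top q. Proof. exact: mcoeffD. Qed.
Lemma topZ c p : top (c *: p) = c * top p. Proof. exact: mcoeffZ. Qed.
Lemma topC c p : top (c%:MP * p) = c * top p. Proof. by rewrite mul_mpolyC topZ. Qed.
Lemma top_sum (I : Type) (r : seq I) (P : pred I) (F : I -> {mpoly R[n]}) :
  top (\sum_(k <- r | P k) F k) = \sum_(k <- r | P k) top (F k).
Proof. exact: raddf_sum. Qed.

Definition mfree i p := all (fun m : 'X_{1..n} => m i == 0%N) (msupp p).

Lemma mfreeP i p : reflect (forall m, m \in msupp p -> m i = 0%N) (mfree i p).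
Proof. by apply: (iffP allP) => h m /h => [/eqP|->]. Qed.

Lemma mfreeD i p q : mfree i p -> mfree i q -> mfree i (p + q).
Proof.
move=> /mfreeP hp /mfreeP hq; apply/mfreeP=> m /msuppD_le.
by rewrite mem_cat => /orP[/hp|/hq].
Qed.

Lemma mfreeN i p : mfree i p -> mfree i (- p).
Proof. by move=> /mfreeP hp; apply/mfreeP=> m; rewrite (perm_mem (msuppN p)) => /hp. Qed.

Lemma mfreeM i p q : mfree i p -> mfree i q -> mfree i (p * q).
Proof.
move=> /mfreeP hp /mfreeP hq; apply/mfreeP=> m /msuppM_le /allpairsP[[a b] /= [/hp ha /hq hb ->]].
by rewrite mnmDE ha hb.
Qed.

Lemma mfreeC i c : mfree i c%:MP.
Proof.
apply/mfreeP=> m; rewrite msuppC; case: ifP => // _; rewrite inE => /eqP->.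
by rewrite mnm0E.
Qed.

Lemma mfree1 i : mfree i 1. Proof. by rewrite -mpolyC1 mfreeC. Qed.
Lemma mfree0 i : mfree i 0. Proof. by rewrite -mpolyC0 mfreeC. Qed.

Lemma mfreeX i j : i != j -> mfree i 'X_j.
Proof.
move=> ij; apply/mfreeP=> m; rewrite msuppX inE => /eqP->.
by rewrite mnm1E eq_sym (negPf ij).
Qed.

Lemma mfree_sum (I : Type) (r : seq I) (P : pred I) (F : I -> {mpoly R[n]}) i :
  (forall k, P k -> mfree i (F k)) -> mfree i (\sum_(k <- r | P k) F k).
Proof. by move=> h; elim/big_rec: _ => [|k p Pk]; [apply: mfree0 | apply/mfreeD/h]. Qed.

Lemma mfree_prod (I : Type) (r : seq I) (P : pred I) (F : I -> {mpoly R[n]}) i :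
  (forall k, P k -> mfree i (F k)) -> mfree i (\prod_(k <- r | P k) F k).
Proof. by move=> h; elim/big_rec: _ => [|k p Pk]; [apply: mfree1 | apply/mfreeM/h]. Qed.

Lemma top_free i p : mfree i p -> top p = 0.
Proof.
move=> /mfreeP h; apply/eqP; rewrite mcoeff_eq0; apply/negP=> /h.
by rewrite mnmE.
Qed.

(** Together with [top_free] this makes every variable a resource that must be used exactly once. *)
Lemma top_sqr i p : top ('X_i * 'X_i * p) = 0.
Proof.
elim/mpolyind: p => [|c m p _ _ IH]; first by rewrite mulr0 /top mcoeff0.
rewrite mulrDr topD IH addr0 -scalerAr topZ -mulrA -!mpolyXD /top mcoeffX.
case: eqP => [/mnmP/(_ i)|]; last by rewrite mulr0.
by rewrite !mnmDE !mnm1E eqxx mnmE.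
Qed.

Lemma top_sqrM i p q : top (p * 'X_i * 'X_i * q) = 0.
Proof. by rewrite -(top_sqr i (p * q)); congr top; ring. Qed.

(* The quadratic form [C * D - A * B] of rank 4 as a product of four affine forms. *)
Lemma top_gadget z z' A B C D T : z != z' ->
  mfree z A -> mfree z B -> mfree z C -> mfree z D -> mfree z T ->
  mfree z' A -> mfree z' B -> mfree z' C -> mfree z' D -> mfree z' T ->
  top ((A + 'X_z + 'X_z') * (B + 'X_z + 'X_z') * (C - 'X_z + 'X_z') * (D - 'X_z + 'X_z') * T) =
  2%:R * top ('X_z * 'X_z' * (C * D - A * B) * T).
Proof.
move=> zz' A1 B1 C1 D1 T1 A2 B2 C2 D2 T2.
have fz' : mfree z' 'X_z by apply: mfreeX; rewrite eq_sym.
have fz : mfree z 'X_z' by apply: mfreeX.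
(* Sorted by powers of z and z': the first summand is free of z, the second of z', and the last two
   contain the square of z' or of z. Only the third survives. *)
rewrite (_ : _ * T =
  (A + 'X_z') * (B + 'X_z') * (C + 'X_z') * (D + 'X_z') * T
  + 'X_z * ((A + B) * C * D - A * B * (C + D)) * T
  + 2%:R%:MP * ('X_z * 'X_z' * (C * D - A * B) * T)
  + 'X_z * 'X_z' * 'X_z' * ((C + D - A - B) * T)
  + 'X_z * 'X_z * (('X_z ^+ 2 + (A + B - C - D) * 'X_z
      + (A + 'X_z') * (B + 'X_z') + (C + 'X_z') * (D + 'X_z')
      - (A + 'X_z' + (B + 'X_z')) * (C + 'X_z' + (D + 'X_z'))) * T));
  last by rewrite rmorph_nat; ring.
rewrite !topD topC top_sqr top_sqrM !addr0.
rewrite (@top_free z) ?add0r; last by do ![apply: mfreeM | apply: mfreeD].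
rewrite (@top_free z') ?add0r //.
by do ![apply: mfreeM | apply: mfreeD | apply: mfreeN].
Qed.

Definition msubst i q : n.-tuple {mpoly R[n]} := [tuple if j == i then q else 'X_j | j < n].

Lemma comp_mpoly_free i q p : mfree i p -> p \mPo msubst i q = p.
Proof.
move=> /mfreeP h; rewrite {2}[p]mpolyE comp_mpolyEX.
rewrite big_seq [RHS]big_seq; apply: eq_bigr => m /h m0; congr (_ *: _).
rewrite comp_mpolyX mpolyXE_id; apply: eq_bigr => j _.
by rewrite tnth_mktuple; case: eqP => [->|//]; rewrite m0.
Qed.

(** Compared on monomials X_i^k m' with m' free of X_i. For k = 0 the product q m' lacks X_i; for k
    = 1 the term with X_i^2 drops and q X_i m' is the desired one; for k > 1 the left side contains
    X_i^2 and the right side q^2. *)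
Lemma top_subst i q T : mfree i q -> (forall p, top (q * q * p) = 0) ->
  top (('X_i + q) * T) = top ('X_i * (T \mPo msubst i q)).
Proof.
move=> fq q2; elim/mpolyind: T => [|c m p _ _ IH].
  by rewrite comp_mpoly0 !mulr0.
rewrite mulrDr topD IH comp_mpolyD mulrDr topD; congr (_ + _).
rewrite comp_mpolyZ -!scalerAr !topZ; congr (_ * _).
pose m' : 'X_{1..n} := [multinom if j == i then 0%N else m j | j < n].
have mE : 'X_[m] = 'X_i ^+ m i * 'X_[m'] :> {mpoly R[n]}.
  rewrite mpolyXn -mpolyXD; congr 'X_[_]; apply/mnmP=> j.
  rewrite mnmDE mulmnE mnm1E mnmE eq_sym; case: eqP => [->|_].
    by rewrite mul1n addn0.
  by rewrite mul0n.
have fm : mfree i ('X_[m'] : {mpoly R[n]}).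
  by apply/mfreeP=> k; rewrite msuppX inE => /eqP->; rewrite mnmE eqxx.
rewrite mE rmorphM rmorphXn /= (comp_mpoly_free q fm) comp_mpolyXU -tnth_nth tnth_mktuple eqxx.
case: (m i) => [|[|k]].
- by rewrite !mul1r mulrDl topD [X in _ + X](@top_free i) ?addr0 //; apply: mfreeM.
- by rewrite !expr1 mulrDl topD mulrA top_sqr add0r; congr top; ring.
have shuffle (S : comNzRingType) (a x y b : S) : a * (x * (x * y) * b) = x * x * (a * y * b).
  by ring.
have shuffle' x y a : y * (x ^+ k.+2 * a) = x * x * (y * x ^+ k * a) :> {mpoly R[n]}.
  by rewrite 2!exprS; exact: shuffle.
have lhs p' : top (p' * ('X_i ^+ k.+2 * 'X_[m'])) = 0.
  by rewrite shuffle'; exact: top_sqr.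
transitivity (0 : R); last by rewrite shuffle'; exact/esym/q2.
by rewrite mulrDl topD -[RHS]addr0; congr (_ + _); apply: lhs.
Qed.
End TopCoefficient.

Section Eliminations.
Variables (R : comNzRingType) (n : nat).
Local Notation P := {mpoly R[n]}.

Definition gadget_rows (z z' : 'I_n) (A B C D : P) : P :=
  (A + 'X_z + 'X_z') * (B + 'X_z + 'X_z') * (C - 'X_z + 'X_z') * (D - 'X_z + 'X_z').

Lemma mfree_gadget i z z' A B C D : i != z -> i != z' ->
  mfree i A -> mfree i B -> mfree i C -> mfree i D -> mfree i (gadget_rows z z' A B C D).
Proof.
by move=> *; do ![apply: mfreeM | apply: mfreeD | apply: mfreeN | apply: mfreeX].
Qed.

Lemma top_gadgets (G : eqType) (gs : seq G) (z : G * bool -> 'I_n) (A B C D : G -> P) (T : P) :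
  uniq gs -> injective z ->
  (forall k h, mfree (z k) (A h)) -> (forall k h, mfree (z k) (B h)) ->
  (forall k h, mfree (z k) (C h)) -> (forall k h, mfree (z k) (D h)) ->
  (forall g b, g \in gs -> mfree (z (g, b)) T) ->
  top (\prod_(g <- gs) gadget_rows (z (g, true)) (z (g, false)) (A g) (B g) (C g) (D g) * T) =
  2%:R ^+ size gs *
  top (\prod_(g <- gs) ('X_(z (g, true)) * 'X_(z (g, false)) * (C g * D g - A g * B g)) * T).
Proof.
move=> + zI fA fB fC fD; elim: gs T => [|g gs IH] T /=; first by rewrite !big_nil expr0 !mul1r.
case/andP=> g_gs Ugs fT; rewrite !big_cons.
have neq (h h' : G) b b' : h != h' -> z (h, b) != z (h', b').
  by move=> hh'; rewrite (inj_eq zI) xpair_eqE negb_and hh'.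
have fT' b : mfree (z (g, b)) (\prod_(h <- gs)
    gadget_rows (z (h, true)) (z (h, false)) (A h) (B h) (C h) (D h) * T).
  apply: mfreeM; last by apply: fT; rewrite mem_head.
  rewrite big_seq; apply: mfree_prod => h hgs.
  have gh : g != h by apply: contraNneq g_gs => ->.
  by apply: mfree_gadget => //; apply: neq.
rewrite -mulrA top_gadget ?(inj_eq zI) ?xpair_eqE ?andbF //.
rewrite mulrCA IH //; last first.
  move=> h b hgs; have gh : h != g by apply: contraNneq g_gs => <-.
  apply: mfreeM; last by apply: fT; rewrite inE hgs orbT.
  by do ![apply: mfreeM | apply: mfreeD | apply: mfreeN | apply: mfreeX] => //; apply: neq.
by rewrite exprS -[RHS]mulrA; congr (_ * (_ * top _)); rewrite mulrCA mulrA.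
Qed.

(** If the first row takes ['X_(p r)], then row r must take the next variable, and so on along the
    chain. If it takes the far end, ['X_(p r)] is left for row r, and so on. Thus all rows choose
    [a] or all choose [b]. A and B accumulate the choices already forced, as the induction
    requires. *)
Lemma top_chain (p : nat -> 'I_n) (a b : nat -> P) k r (A B T : P) :
  (forall i j, (i <= r + k)%N -> (j <= r + k)%N -> p i = p j -> i = j) ->
  (forall i j, (r <= i <= r + k)%N -> (j < r + k)%N -> mfree (p i) (a j) && mfree (p i) (b j)) ->
  (forall i, (r <= i <= r + k)%N -> [&& mfree (p i) A, mfree (p i) B & mfree (p i) T]) ->
  top ((A * 'X_(p r) + B * 'X_(p (r + k)%N)) *
       \prod_(r <= o < r + k) (a o * 'X_(p o.+1) + b o * 'X_(p o)) * T) =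
  top (\prod_(r <= o < (r + k).+1) 'X_(p o) *
       (A * \prod_(r <= o < r + k) a o + B * \prod_(r <= o < r + k) b o) * T).
Proof.
elim: k r A B T => [|k IH] r A B T pI fab fABT.
  rewrite addn0 big_nat1 !big_geq // !mulr1; congr (top (_ * _)).
  by rewrite -mulrDl mulrC.
set d := (r + k.+1)%N in pI fab fABT *.
have dE : (r.+1 + k)%N = d by rewrite addSnnS.
have rd : (r < d)%N by rewrite -dE ltnS leq_addr.
have rd1 : (r < d.+1)%N by rewrite ltnS ltnW.
rewrite !(big_ltn rd) (big_ltn rd1).
set F := \prod_(r.+1 <= o < d) _; set X := \prod_(r.+1 <= o < d.+1) _.
set Pa := \prod_(r.+1 <= o < d) a o; set Pb := \prod_(r.+1 <= o < d) b o.
have rX i : (i <= d)%N -> (r != i)%N -> p r != p i.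
  by move=> id; apply: contra_neq => /pI; apply=> //; apply: ltnW.
have /and3P[fA fB fT] := fABT r (introT andP (conj (leqnn r) (ltnW rd))).
have fF : mfree (p r) F.
  rewrite /F big_seq; apply: mfree_prod => o; rewrite mem_index_iota => /andP[ro od].
  have /andP[? ?] := fab r o (introT andP (conj (leqnn r) (ltnW rd))) od.
  by apply: mfreeD; apply: mfreeM => //; apply/mfreeX/rX => //;
    rewrite ?(ltnW od) ?ltn_eqF // ltnW.
have /andP[fa fb] := fab r r (introT andP (conj (leqnn r) (ltnW rd))) rd.
(* Of the four products of the first two rows, one contains the square of ['X_(p r)] and one lacks
   this variable; the other two form the shorter chain. *)
rewrite (_ : (A * _ + _) * _ * T =
  'X_(p r) * 'X_(p r) * (A * b r * F * T) + B * 'X_(p d) * (a r * 'X_(p r.+1)) * F * T +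
  (A * a r * 'X_(p r.+1) + B * b r * 'X_(p d)) * F * ('X_(p r) * T)); last by ring.
rewrite !topD top_sqr add0r (@top_free _ _ (p r)) ?add0r; last first.
  by do ![apply: mfreeM] => //; apply/mfreeX/rX; rewrite ?ltn_eqF.
have := IH r.+1 (A * a r) (B * b r) ('X_(p r) * T); rewrite dE => ->.
- by rewrite -/X -/Pa -/Pb; congr top; ring.
- exact: pI.
- by move=> i j /andP[ri id] jd; apply: fab; rewrite // (ltnW ri).
move=> i /andP[ri id]; have rid : (r <= i <= d)%N by rewrite (ltnW ri).
have /and3P[? ? ?] := fABT i rid; have /andP[? ?] := fab i r rid rd.
apply/and3P; split; apply: mfreeM => //.
by apply: mfreeX; rewrite eq_sym; apply: rX; rewrite ?ltn_eqF.
Qed.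
End Eliminations.

Section Eliminations2.
Variables (R : comNzRingType) (n : nat).
Local Notation P := {mpoly R[n]}.

Lemma top_chains (I : eqType) (s : seq I) (d : nat) (p : I -> nat -> 'I_n) (a b : I -> nat ->
  P) (T : P) :
  uniq s ->
  (forall i i' o o', (o <= d)%N -> (o' <= d)%N -> p i o = p i' o' -> i = i' /\ o = o') ->
  (forall i i' o o', (o <= d)%N -> mfree (p i o) (a i' o') && mfree (p i o) (b i' o')) ->
  (forall i o, i \in s -> (o <= d)%N -> mfree (p i o) T) ->
  top (\prod_(i <- s) (('X_(p i 0%N) + 'X_(p i d)) *
         \prod_(0 <= o < d) (a i o * 'X_(p i o.+1) + b i o * 'X_(p i o))) * T) =
  top (\prod_(i <- s) \prod_(0 <= o < d.+1) 'X_(p i o) *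
       \prod_(i <- s) (\prod_(0 <= o < d) a i o + \prod_(0 <= o < d) b i o) * T).
Proof.
move=> + pI fab; elim: s T => [|i s IH] T /=; first by rewrite !big_nil !mul1r.
case/andP=> i_s Us fT; rewrite !(big_cons _ _ i).
have neq i' o o' : i' \in s -> (o <= d)%N -> (o' <= d)%N -> p i o != p i' o'.
  by move=> i's od o'd; apply: contraNneq i_s => /(pI _ _ _ _ od o'd)[-> _].
pose F := \prod_(j <- s) (('X_(p j 0%N) + 'X_(p j d)) *
         \prod_(0 <= o < d) (a j o * 'X_(p j o.+1) + b j o * 'X_(p j o))) : P.
rewrite -/F.
have fF : forall k, (k <= d)%N -> mfree (p i k) F.
  move=> k kd; rewrite /F big_seq; apply: mfree_prod => i' i's.
  apply: mfreeM; first by apply: mfreeD; apply/mfreeX/neq.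
  rewrite big_nat; apply: mfree_prod => o' /andP[_ o'd].
  have /andP[? ?] := fab i i' k o' kd.
  by apply: mfreeD; apply: mfreeM => //; apply/mfreeX/neq; rewrite // ltnW.
have := @top_chain _ _ (p i) (a i) (b i) d 0 1 1 (F * T); rewrite !add0n => chain.
rewrite -mulrA -['X_(p i 0%N)]mul1r -['X_(p i d)]mul1r chain.
- rewrite !mul1r mulrCA IH //; last first.
    move=> i' o i's od; have := fT i' o; rewrite inE i's orbT => /(_ isT od) fT'.
    apply: mfreeM => //; apply: mfreeM.
      rewrite big_nat; apply: mfree_prod => o' /andP[_ o'd].
      by apply: mfreeX; rewrite eq_sym; apply: neq.
    apply: mfreeD; rewrite big_nat; apply: mfree_prod => o' /andP[_ o'd];
      by have /andP[] := fab i' i o o' od.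
  have shuffle (S : comNzRingType) (x y u w t : S) : x * y * (u * w * t) =
    u * x * (w * y) * t by ring.
  by congr top; apply: shuffle.
- by move=> j j' jd j'd /pI[].
- by move=> j j' /andP[_ jd] j'd; apply: fab.
move=> j /andP[_ jd]; rewrite !mfree1 /=; apply: mfreeM; first exact: fF.
by apply: fT; rewrite ?mem_head.
Qed.

(** The factor 1 + X_i supplies X_i precisely when the monomial of used slots lacks it, so it is
    immaterial which slots a value has used. *)
Lemma top_slots (s : seq 'I_n) (Q : pred 'I_n) (T : P) : uniq s ->
  (forall i, i \in s -> mfree i T) ->
  top (\prod_(i <- s) (1 + 'X_i) * \prod_(i <- s | Q i) 'X_i * T) = top (\prod_(i <- s) 'X_i * T).
Proof.
elim: s T => [|i s IH] T /=; first by rewrite !big_nil !mul1r.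
case/andP=> i_s Us fT; rewrite !big_cons.
have fT' : mfree i (\prod_(j <- s) (1 + 'X_j) * \prod_(j <- s | Q j) 'X_j * T).
  have neq j : j \in s -> i != j by move=> js; apply: contraNneq i_s => ->.
  apply: mfreeM; last by apply: fT; rewrite mem_head.
  apply: mfreeM; rewrite big_seq_cond; apply: mfree_prod => j /andP[js _].
    by apply: mfreeD; [apply: mfree1 | apply/mfreeX/neq].
  by apply/mfreeX/neq.
transitivity (top ('X_i * (\prod_(j <- s) (1 + 'X_j) * \prod_(j <- s | Q j) 'X_j * T))).
  case: (Q i).
    rewrite (_ : _ * T = 'X_i * 'X_i * (\prod_(j <- s) (1 + 'X_j) * \prod_(j <- s | Q j) 'X_j * T)
      + 'X_i * (\prod_(j <- s) (1 + 'X_j) * \prod_(j <- s | Q j) 'X_j * T)); last by ring.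
    by rewrite topD top_sqr add0r.
  rewrite (_ : _ * T = (\prod_(j <- s) (1 + 'X_j) * \prod_(j <- s | Q j) 'X_j * T)
      + 'X_i * (\prod_(j <- s) (1 + 'X_j) * \prod_(j <- s | Q j) 'X_j * T)); last by ring.
  by rewrite topD (top_free fT') add0r.
rewrite mulrCA IH //; first by congr top; ring.
move=> j js; apply: mfreeM; last by apply: fT; rewrite inE js orbT.
by apply: mfreeX; apply: contraNneq i_s => <-.
Qed.

Lemma top_all : top (\prod_(i < n) 'X_i : P) = 1.
Proof.
rewrite (_ : \prod_i _ = 'X_[all_ones n]); first by rewrite /top mcoeffX eqxx.
by rewrite mpolyXE_id; apply: eq_bigr => i _; rewrite mnmE.
Qed.

Lemma comp_mpolyA p (t1 t2 : n.-tuple P) :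
  (p \mPo t1) \mPo t2 = p \mPo [tuple tnth t1 i \mPo t2 | i < n].
Proof.
rewrite (comp_mpolyEX p t1) raddf_sum [RHS]comp_mpolyEX /=; apply: eq_bigr => m _.
rewrite !comp_mpolyZ !comp_mpolyX rmorph_prod; congr (_ *: _); apply: eq_bigr => i _.
by rewrite rmorphXn tnth_mktuple.
Qed.

Definition partial_eval (val : 'I_n -> P) (S : seq 'I_n) : n.-tuple P :=
  [tuple if i \in S then val i else 'X_i | i < n].

Lemma partial_evalX val S i :
  'X_i \mPo partial_eval val S = if i \in S then val i else 'X_i.
Proof. by rewrite comp_mpolyXU -tnth_nth tnth_mktuple. Qed.

Lemma partial_eval_rcons val S i p :
  (forall j, j \in S -> mfree i (val j)) -> i \notin S ->
  (p \mPo partial_eval val S) \mPo msubst i (val i) = p \mPo partial_eval val (rcons S i).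
Proof.
move=> fS Si; rewrite comp_mpolyA; congr (_ \mPo _); apply: eq_from_tnth => j.
rewrite !tnth_mktuple mem_rcons inE; have [->|nij] := eqVneq j i.
  by rewrite (negPf Si) comp_mpolyXU -tnth_nth tnth_mktuple eqxx.
case: ifP => Sj /=; first by rewrite comp_mpoly_free // fS.
by rewrite comp_mpolyXU -tnth_nth tnth_mktuple (negPf nij).
Qed.

(* Gates are eliminated bottom-up: when the turn of [i] comes, the gates that its
   defining polynomial [Q i] depends on are already replaced by their values. *)
Lemma top_gates_step (val Q : 'I_n -> P) (s1 s2 : seq 'I_n) (T : P) :
  uniq (s1 ++ s2) ->
  (forall i j, i \in s1 ++ s2 -> mfree i (val j)) ->
  (forall i p, top (val i * val i * p) = 0) ->
  (forall s i s', s1 ++ s2 = s ++ i :: s' -> Q i \mPo partial_eval val s = val i) ->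
  top (\prod_(i <- s1) 'X_i * (\prod_(i <- s2) ('X_i + Q i) * T \mPo partial_eval val s1)) =
  top (\prod_(i <- s1 ++ s2) 'X_i * (T \mPo partial_eval val (s1 ++ s2))).
Proof.
move=> + + sqv; elim: s2 s1 => [|i s2 IH] s1; first by rewrite cats0 big_nil mul1r.
rewrite -cat_rcons => Us fv Qv; apply: (etrans _ (IH (rcons s1 i) Us fv Qv)).
have [i_s1 i_s2 Us1] : [/\ i \notin s1, i \notin s2 & uniq s1].
  by move: Us; rewrite cat_uniq rcons_uniq => /and3P[/andP[-> ->] /hasPn h _]; split=> //;
     apply/negP=> /h; rewrite mem_rcons inE eqxx.
have i_all : i \in rcons s1 i ++ s2 by rewrite mem_cat mem_rcons inE eqxx.
set U := \prod_(j <- s2) ('X_j + Q j) * T.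
have split_i : \prod_(j <- i :: s2) ('X_j + Q j) * T \mPo partial_eval val s1 =
    ('X_i + val i) * (U \mPo partial_eval val s1).
  rewrite big_cons -mulrA rmorphM; congr (_ * _).
  rewrite rmorphD /= partial_evalX (negPf i_s1); congr (_ + _).
  by apply: (Qv s1 i s2); rewrite cat_rcons.
have X_s1 : (\prod_(j <- s1) 'X_j) \mPo msubst i (val i) = \prod_(j <- s1) 'X_j.
  rewrite rmorph_prod big_seq [RHS]big_seq; apply: eq_bigr => j js.
  rewrite /= comp_mpolyXU -tnth_nth tnth_mktuple.
  by case: eqP js i_s1 => // -> ->.
transitivity (top (('X_i + val i) * (\prod_(j <- s1) 'X_j * (U \mPo partial_eval val s1)))).
  by congr top; rewrite split_i mulrCA.
apply: etrans (top_subst _ _ _) _; [exact: fv | exact: sqv |].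
have X_rcons : \prod_(j <- rcons s1 i) 'X_j = 'X_i * \prod_(j <- s1) 'X_j :> P.
  by rewrite -cats1 big_cat big_seq1 mulrC.
apply: congr1; rewrite X_rcons -[RHS]mulrA; congr (_ * _).
apply: etrans (rmorphM _ _ _) _; congr (_ * _); first exact: X_s1.
by apply: partial_eval_rcons => // j _; apply: fv.
Qed.

Lemma top_gates (val Q : 'I_n -> P) (s : seq 'I_n) (T : P) :
  uniq s ->
  (forall i j, i \in s -> mfree i (val j)) ->
  (forall i p, top (val i * val i * p) = 0) ->
  (forall s1 i s2, s = s1 ++ i :: s2 -> Q i \mPo partial_eval val s1 = val i) ->
  top (\prod_(i <- s) ('X_i + Q i) * T) =
  top (\prod_(i <- s) 'X_i * (T \mPo partial_eval val s)).
Proof.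
move=> Us fv sqv Qv; have := @top_gates_step val Q [::] s T Us fv sqv Qv.
rewrite big_nil mul1r (_ : partial_eval val [::] = [tuple 'X_i | i < n]); last first.
  by apply: eq_from_tnth => i; rewrite !tnth_mktuple.
by rewrite comp_mpoly_id.
Qed.
End Eliminations2.

(** * Permanents as coefficients in products of affine forms *)

Section RowsToPermanent.
Variables (R : comNzRingType) (c m : nat).

(* The first c columns hold the coefficients of the variables, the other m columns are
   copies of the column of constant terms. *)
Definition column_var (k : 'I_(c + m)) : option 'I_c :=
  if split k is inl v then Some v else None.

Definition exact_cover (f : 'I_(c + m) -> option 'I_c) : bool :=
  [forall v, #|[set r | f r == Some v]| == 1%N].

Lemma column_varP k v : (column_var k == Some v) = (k == lshift m v).
Proof.
rewrite /column_var; case: (split_ordP k) => j ->.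
  by rewrite (inj_eq Some_inj) (inj_eq (@lshift_inj _ _)).
by rewrite eq_rlshift.
Qed.

Lemma card_None : #|[set k | column_var k == None]| = m.
Proof.
rewrite -[RHS](card_ord m) -(card_imset _ (@rshift_inj c m)); apply: eq_card => k.
rewrite inE /column_var; case: (split_ordP k) => j ->; last by rewrite eqxx imset_f.
by apply/esym/negP=> /imsetP[j' _ /eqP]; rewrite eq_lrshift.
Qed.

Lemma card_perm_column_var :
  #|[set t : 'S_(c + m) | [forall k, column_var (t k) == column_var k]]| = m`!.
Proof.
rewrite -[X in _ = X`!]card_None -card_perm; apply: eq_card => t; rewrite inE.
apply/forallP/idP => [h|on k].
  apply/subsetP=> k; rewrite !inE; apply: contraNT; case ek: (column_var k) => [v|//] _.
  have := h k; rewrite ek column_varP; move/eqP: ek; rewrite column_varP => /eqP -> /eqP ->.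
  by [].
case: (boolP (k \in [set k | column_var k == None])) => kN; last by rewrite (out_perm on).
have := kN; rewrite -(perm_closed k on) inE => /eqP->.
by move: kN; rewrite inE eq_sym.
Qed.

(** Only exact covers lift, since every variable has a single column. In an exact cover the number
    of rows without variable is then m, so a lift exists, and the lifts form a coset of the group
    permuting the m constant columns. *)
Lemma card_lifts (f : 'I_(c + m) -> option 'I_c) :
  #|[set s : 'S_(c + m) | [forall r, column_var (s r) == f r]]| = (exact_cover f * m`!)%N.
Proof.
have colv : exact_cover column_var.
  apply/forallP=> v; rewrite -(cards1 (lshift m v)); apply/eqP; apply: eq_card => k.
  by rewrite !inE column_varP.
case: (boolP (exact_cover f)) => [ef|nf]; last first.
  rewrite mul0n; apply/eqP; rewrite cards_eq0; apply/eqP/setP=> s; rewrite !inE.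
  apply: contraNF nf => /forallP h; apply/forallP=> v; rewrite -(eqP (forallP colv v)).
  rewrite -(card_imset _ (@perm_inj _ s)); apply/eqP; apply: eq_card => k.
  rewrite inE -[k](permKV s) mem_imset ?inE; last exact: perm_inj.
  by rewrite (eqP (h _)).
have tot (g : 'I_(c + m) -> option 'I_c) : (\sum_o #|[set r | g r == o]| = c + m)%N.
  rewrite -[RHS]card_ord -sum1_card (partition_big g xpredT) //=; apply: eq_bigr => o _.
  by rewrite -sum1_card; apply: eq_bigl => r; rewrite inE.
have fib o : #|[set r | f r == o]| = #|[set r | column_var r == o]|.
  case: o => [v|]; first by rewrite (eqP (forallP ef v)) (eqP (forallP colv v)).
  have tot' g := etrans (esym (bigD1 None isT)) (tot g).
  have := etrans (tot' f) (esym (tot' column_var)).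
  rewrite [X in (_ + X = _)%N](_ : _ = \sum_(i | i != None) #|[set r | column_var r == i]|)%N.
    exact: addIn.
  by apply: eq_bigr => -[v|] // _; rewrite (eqP (forallP ef v)) (eqP (forallP colv v)).
have [s0 s0E] := perm_of_equal_fibres fib.
rewrite mul1n -card_perm_column_var -[RHS](card_imset _ (mulgI s0)); apply: eq_card => s.
rewrite inE -[s](mulKVg s0) mem_imset ?inE; last exact: mulgI.
set t := (s0^-1 * s)%g; apply/forallP/forallP => h k.
  by have := h (s0^-1 k)%g; rewrite permM s0E permKV.
by rewrite permM s0E; apply: h.
Qed.

Variable coef : 'I_(c + m) -> option 'I_c -> R.

Definition affine_row r : {mpoly R[c]} :=
  (coef r None)%:MP + \sum_(v < c) (coef r (Some v))%:MP * 'X_v.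

Lemma top_monomials (f : 'I_(c + m) -> option 'I_c) :
  top (\prod_r (if f r is Some v then 'X_v else 1 : {mpoly R[c]})) = (exact_cover f)%:R.
Proof.
transitivity (top ('X_[ [multinom #|[set r | f r == Some v]| | v < c] ] : {mpoly R[c]})).
  congr top; rewrite mpolyXE_id.
  transitivity (\prod_r \prod_(v < c) if f r == Some v then 'X_v else 1 : {mpoly R[c]}).
    apply: eq_bigr => r _; case: (f r) => [v|]; last by rewrite big1.
    rewrite (bigD1 v) //= eqxx big1 ?mulr1 // => w /negPf nw.
    by rewrite (inj_eq Some_inj) eq_sym nw.
  rewrite exchange_big; apply: eq_bigr => v _; rewrite -big_mkcond prodr_const mnmE.
  by congr (_ ^+ _); apply: eq_card => r; rewrite inE.
rewrite /top mcoeffX; congr ((nat_of_bool _)%:R).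
apply/eqP/forallP => [/mnmP h v|h]; first by have := h v; rewrite !mnmE => ->.
by apply/mnmP=> v; rewrite !mnmE; apply/eqP.
Qed.

(** Permutations are grouped by the column labels f that they read. The term of f occurs m! times if
    f is an exact cover and never otherwise; in the expanded product of rows, [top] keeps the same
    f, once each. *)
Lemma per_affine_rows :
  per (\matrix_(r, k) coef r (column_var k)) = (m`!)%:R * top (\prod_r affine_row r).
Proof.
pose w (f : {ffun 'I_(c + m) -> option 'I_c}) := \prod_r coef r (f r).
transitivity (\sum_f w f * ((exact_cover f * m`!)%N)%:R).
  rewrite /per (partition_big (fun s : 'S_(c + m) => [ffun r => column_var (s r)]) xpredT) //=.
  apply: eq_bigr => f _; rewrite -card_lifts -sum1_card natr_sum mulr_sumr.
  apply: eq_big => s.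
    by rewrite inE; apply/eqP/forallP => [<- r|h]; rewrite ?ffunE //; apply/ffunP=> r;
      rewrite ffunE; apply/eqP.
  by move=> /eqP<-; rewrite mulr1; apply: eq_bigr => r _; rewrite mxE ffunE.
rewrite (_ : \prod_r affine_row r = \sum_(f : {ffun 'I_(c + m) -> option 'I_c})
   (w f)%:MP * \prod_r (if f r is Some v then 'X_v else 1)).
  rewrite top_sum mulr_sumr; apply: eq_bigr => f _.
  by rewrite topC top_monomials natrM; ring.
transitivity (\prod_r \sum_(o : option 'I_c) (coef r o)%:MP * (if o is Some v then 'X_v else
  1) : {mpoly R[c]}).
  apply: eq_bigr => r _; rewrite (bigD1 None) //= mulr1; congr (_ + _).
  rewrite (reindex_omap Some id) /=; last by case.
  by apply: eq_bigl => v; rewrite eqxx.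
rewrite bigA_distr_bigA; apply: eq_bigr => f _.
by rewrite big_split /= rmorph_prod.
Qed.
End RowsToPermanent.

(** * Boolean sums of straight-line programs as permanents *)

Section HomogeneousParts.
Variables (F : fieldType) (v u : nat) (e : {ffun 'I_u -> bool}).
Local Notation S := {mpoly F[v]}.

Definition bool_point (i : 'I_(v + u)) : S :=
  match split i with inl j => 'X_j | inr k => ((e k)%:R)%:MP end.

(* The coefficient of 'X^j in [graded p] is the homogeneous component of degree j
   of p, evaluated at Y := e. *)
Definition graded (p : {mpoly F[v + u]}) : {poly S} :=
  mmap (polyC \o @mpolyC v F) (fun i => (bool_point i)%:P * 'X) p.

Lemma graded_is_additive : additive graded.
Proof. exact: mmap_is_additive. Qed.
Lemma graded_is_multiplicative : multiplicative graded.
Proof. exact: mmap_is_multiplicative. Qed.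
HB.instance Definition _ := GRing.isAdditive.Build _ _ graded graded_is_additive.
HB.instance Definition _ := GRing.isMultiplicative.Build _ _ graded graded_is_multiplicative.

Lemma gradedC c : graded c%:MP = c%:MP%:P.
Proof. exact: mmapC. Qed.

Lemma gradedX i : graded 'X_i = (bool_point i)%:P * 'X.
Proof. by rewrite /graded mmapX mmap1U. Qed.

Lemma gradedE p : graded p =
  \sum_(m <- msupp p) ((p@_m)%:MP * \prod_i bool_point i ^+ m i)%:P * 'X^(mdeg m).
Proof.
rewrite /graded /mmap; apply: eq_bigr => m _ /=; rewrite polyCM -mulrA; congr (_ * _).
rewrite /mmap1 rmorph_prod mdegE -prodrXr -big_split; apply: eq_bigr => i _ /=.
by rewrite exprMn rmorphXn.
Qed.

Lemma size_graded p : (size (graded p) <= msize p)%N.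
Proof.
rewrite gradedE big_seq; apply/(leq_trans (size_sum _ _ _))/bigmax_leqP_seq => m pm _.
rewrite mul_polyC (leq_trans (size_scale_leq _ _)) // size_polyXn.
exact: msize_mdeg_lt.
Qed.

Lemma graded0 p : (graded p)`_0 = (p@_0)%:MP.
Proof.
rewrite gradedE coef_sum.
rewrite (eq_bigr (fun m => if m == 0%MM then (p@_0)%:MP else 0)).
  rewrite -big_mkcond; have [p0|p0] := boolP (0%MM \in msupp p).
    by rewrite -big_filter filter_pred1_uniq // ?msupp_uniq // big_seq1.
  by rewrite big_seq_cond big_pred0 ?memN_msupp_eq0 // => m; apply/negP=> /andP[+ /eqP m0];
    rewrite m0; apply/negP.
move=> m _; rewrite coefCM coefXn eq_sym mdeg_eq0; case: eqP => [->|_]; last by rewrite mulr0.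
by rewrite big1 ?mulr1 // => i _; rewrite mnm0E expr0.
Qed.

Lemma graded1 p : (graded p).[1] = eval_bools p e.
Proof.
rewrite gradedE horner_sum /eval_bools comp_mpolyE; apply: eq_bigr => m _.
rewrite hornerM hornerC hornerXn expr1n mulr1 mul_mpolyC; congr (_ *: _).
by apply: eq_bigr => i _; rewrite tnth_mktuple.
Qed.
End HomogeneousParts.

Section Results.
Variables (F : fieldType) (v : nat) (prog : seq (instruction F v)).

Definition nth_instr (k : nat) : instruction F v :=
  nth (Instr OpAdd (OpConst v 0) (OpConst v 0)) prog k.

Lemma slp_results_rcons (s : seq (instruction F v)) i :
  slp_results (rcons s i) = rcons (slp_results s) (instr_val (slp_results s) i).
Proof. by rewrite /slp_results -cats1 foldl_cat. Qed.

Lemma size_slp_results (s : seq (instruction F v)) : size (slp_results s) = size s.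
Proof. by elim/last_ind: s => // s i IH; rewrite slp_results_rcons !size_rcons IH. Qed.

Lemma take_slp_results k : take k (slp_results prog) = slp_results (take k prog).
Proof.
elim/last_ind: prog => [|s i IH]; first by case: k.
case: (leqP k (size s)) => ks; last by rewrite !take_oversize // ?size_slp_results ?size_rcons.
by rewrite slp_results_rcons -!cats1 !takel_cat ?size_slp_results.
Qed.

Lemma nth_slp_results k : (slp_results prog)`_k =
  instr_val (take k (slp_results prog)) (nth_instr k).
Proof.
case: (ltnP k (size prog)) => kL; last first.
  rewrite nth_default ?size_slp_results // /nth_instr nth_default //.
  by rewrite /instr_val /= mpolyC0 addr0.
rewrite take_slp_results -(nth_take 0 (leqnn k.+1)) take_slp_results.
rewrite (take_nth (Instr OpAdd (OpConst v 0) (OpConst v 0))) //.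
by rewrite slp_results_rcons nth_rcons size_slp_results (size_takel (ltnW kL)) ltnn eqxx.
Qed.

End Results.

Lemma partial_eval_perm (R : comNzRingType) n (val : 'I_n -> {mpoly R[n]}) (s1 s2 : seq 'I_n) :
  s1 =i s2 -> partial_eval val s1 = partial_eval val s2.
Proof. by move=> h; apply: eq_from_tnth => i; rewrite !tnth_mktuple h. Qed.

(** Sorting by rank gives the order of elimination: a gate requires that all gates of smaller rank
    already carry their values. *)
Lemma top_gates_rank (R : comNzRingType) n (val Q : 'I_n -> {mpoly R[n]}) (rk : 'I_n -> nat)
    (s : seq 'I_n) (T : {mpoly R[n]}) :
  uniq s ->
  (forall i j, i \in s -> mfree i (val j)) ->
  (forall i p, top (val i * val i * p) = 0) ->
  (forall i s1, i \in s -> (forall j, j \in s -> (rk j < rk i)%N -> j \in s1) ->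
     {subset s1 <= s} -> Q i \mPo partial_eval val s1 = val i) ->
  top (\prod_(i <- s) ('X_i + Q i) * T) =
  top (\prod_(i <- s) 'X_i * (T \mPo partial_eval val s)).
Proof.
move=> Us fv sqv Qv.
have perm_s : perm_eq (sort (fun i j => rk i <= rk j)%N s) s by rewrite perm_sort.
have Us' : uniq (sort (fun i j => rk i <= rk j)%N s) by rewrite (perm_uniq perm_s).
have := @top_gates _ _ val Q _ T Us'; rewrite !(perm_big _ perm_s) /=.
rewrite (partial_eval_perm val (perm_mem perm_s)); apply => //.
  by move=> i j; rewrite (perm_mem perm_s); apply: fv.
move=> s1 i s2 es; apply: Qv.
- by rewrite -(perm_mem perm_s) es mem_cat mem_head orbT.
- move=> j; rewrite -(perm_mem perm_s) es mem_cat => /orP[//|js2] rji.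
  have : sorted (fun i j => rk i <= rk j)%N (s1 ++ i :: s2).
    by rewrite -es; apply: sort_sorted => x y; apply: leq_total.
  case/cat_sorted2=> _ /(order_path_min (fun x y z => @leq_trans (rk x) (rk y) (rk z)))/allP.
  move: js2; rewrite inE => /orP[/eqP ji|js2 /(_ j js2)]; first by rewrite ji ltnn in rji.
  by rewrite leqNgt rji.
by move=> j js1; rewrite -(perm_mem perm_s) es mem_cat js1.
Qed.

(** The end terms have a factor of degree 0, a field constant in the encoding, and so stay affine in
    the gates; only the middle terms need product gates. *)
Lemma coefM_ends (R : comNzRingType) (p q : {poly R}) j : (0 < j)%N ->
  (p * q)`_j = p`_0 * q`_j + q`_0 * p`_j + \sum_(1 <= a < j) p`_a * q`_(j - a).
Proof.
case: j => // j _; rewrite coefM -(big_mkord xpredT (fun i => p`_i * q`_(j.+1 - i))).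
rewrite big_ltn // big_nat_recr //= subn0 subnn; ring.
Qed.

(** * The encoding of a straight-line program by affine rows *)

Section Encoding.
Variables (F : fieldType) (v u d : nat).
Variables (prog : seq (instruction F (v + u))) (out : operand F (v + u)).
Local Notation S := {mpoly F[v]}.
Local Notation D := d.+1.
Local Notation K := (size prog).+1.
Local Notation res := (slp_results prog).
Local Notation leafT := ('I_(v + u) * 'I_D)%type.
Local Notation nodeT := ('I_K * 'I_D * 'I_D)%type.
Local Notation prodT := ('I_K * 'I_D * 'I_D * 'I_D)%type.
Local Notation gateT := (leafT + (nodeT + prodT))%type.
Local Notation gadgetT := (prodT + 'I_u * 'I_D)%type.
(** The kinds of variables: D slots; the gates, that is leaves, nodes and product nodes; two
    auxiliary variables for each quadratic gadget; and D + 1 chain links for each boolean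
    variable. *)
Local Notation varT := ('I_D + (gateT + (gadgetT * bool + 'I_u * 'I_D.+1)))%type.

Definition nb_vars : nat := #|{: varT}|.
Local Notation P := {mpoly S[nb_vars]}.

Definition idx (x : varT) : 'I_nb_vars := enum_rank x.
Lemma idx_inj : injective idx. Proof. exact: enum_rank_inj. Qed.

Definition slot_idx (o : 'I_D) := idx (inl o).
Definition gate_idx (g : gateT) := idx (inr (inl g)).
Definition aux_idx (g : gadgetT * bool) := idx (inr (inr (inl g))).
Definition link_idx (p : 'I_u * 'I_D.+1) := idx (inr (inr (inr p))).

Definition slot (o : nat) : P := 'X_(slot_idx (inord o)).
Definition leaf (i : 'I_(v + u)) (o : nat) : P := 'X_(gate_idx (inl (i, inord o))).
Definition node (k j o : nat) : P := 'X_(gate_idx (inr (inl (inord k, inord j, inord o)))).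
Definition prod_node (k j o a : nat) : P :=
  'X_(gate_idx (inr (inr (inord k, inord j, inord o, inord a)))).
Definition slots (o j : nat) : P := \prod_(o <= i < o + j) slot i.

(* [node k j o] and [opX k A j o] stand for the homogeneous components of degree j of
   the result of instruction k and of its operand A, computed with the slots
   o, ..., o + j - 1: each occurrence of a variable uses up one slot, so that the two
   factors of a product never share a gate. *)
Definition opX (k : nat) (A : operand F (v + u)) (j o : nat) : P :=
  match A with
  | OpVar i => if j == 1%N then leaf i o else 0
  | OpConst _ => 0
  | OpRes k' => if (k' < k)%N then node k' j o else 0
  end.

Definition op_poly (k : nat) (A : operand F (v + u)) := operand_val (take k res) A.
Definition op_const (k : nat) (A : operand F (v + u)) : P := ((op_poly k A)@_0)%:MP%:MP.
Local Notation left_op k := (instr_left (nth_instr prog k)).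
Local Notation right_op k := (instr_right (nth_instr prog k)).
Local Notation op k := (instr_op (nth_instr prog k)).

Definition is_mul (o : arith_op) : bool := if o is OpMul then true else false.

(** Triples with j = 0, or whose interval exceeds the D slots, get the polynomial 0: their variable
    is eliminated with value 0, and the gates can be indexed by a full product type. *)
Definition nodeQ (k j o : nat) : P :=
  if (0 < j)%N && (o + j <= D)%N then
    match op k with
    | OpAdd => opX k (left_op k) j o + opX k (right_op k) j o
    | OpSub => opX k (left_op k) j o - opX k (right_op k) j o
    | OpMul => op_const k (left_op k) * opX k (right_op k) j o
               + op_const k (right_op k) * opX k (left_op k) j o
               + \sum_(1 <= a < j) prod_node k j o a
    end
  else 0.

Definition valid_prod (k j o a : nat) : bool :=
  [&& is_mul (op k), (0 < a < j)%N & (o + j <= D)%N].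
Definition prodL (k j o a : nat) : P :=
  if valid_prod k j o a then opX k (left_op k) a o else 0.
Definition prodR (k j o a : nat) : P :=
  if valid_prod k j o a then opX k (right_op k) (j - a) (o + a) else 0.

Section Values.
Variable e : {ffun 'I_u -> bool}.

Definition op_val (k : nat) A (j o : nat) : P := ((graded e (op_poly k A))`_j)%:MP * slots o j.
Definition leaf_val (i : 'I_(v + u)) (o : nat) : P := (bool_point F e i)%:MP * slot o.
Definition node_val (k j o : nat) : P :=
  if (0 < j)%N && (o + j <= D)%N then ((graded e res`_k)`_j)%:MP * slots o j else 0.
Definition prod_val (k j o a : nat) : P :=
  if valid_prod k j o a then op_val k (left_op k) a o * op_val k (right_op k) (j - a) (o + a)
  else 0.

Definition gate_val (g : gateT) : P :=
  match g with
  | inl (i, o) => leaf_val i o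
  | inr (inl (k, j, o)) => node_val k j o
  | inr (inr (k, j, o, a)) => prod_val k j o a
  end.

Definition gateQ (g : gateT) : P :=
  match g with
  | inl (i, o) => leaf_val i o
  | inr (inl (k, j, o)) => nodeQ k j o
  | inr (inr (k, j, o, a)) => prodL k j o a * prodR k j o a
  end.

Definition idx_val (i : 'I_nb_vars) : P :=
  if (enum_val i : varT) is inr (inl g) then gate_val g else 0.
Definition idxQ (i : 'I_nb_vars) : P :=
  if (enum_val i : varT) is inr (inl g) then gateQ g else 0.

Lemma idx_val_gate g : idx_val (gate_idx g) = gate_val g.
Proof. by rewrite /idx_val /gate_idx /idx enum_rankK. Qed.
Lemma idxQ_gate g : idxQ (gate_idx g) = gateQ g.
Proof. by rewrite /idxQ /gate_idx /idx enum_rankK. Qed.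

(** A node of instruction k comes after its product nodes, and these after all nodes of earlier
    instructions. *)
Definition gate_rank (g : gateT) : nat :=
  match g with
  | inl _ => 0
  | inr (inl (k, _, _)) => k.*2.+2
  | inr (inr (k, _, _, _)) => k.*2.+1
  end.
Definition idx_rank (i : 'I_nb_vars) : nat :=
  if (enum_val i : varT) is inr (inl g) then gate_rank g else 0.
Lemma idx_rank_gate g : idx_rank (gate_idx g) = gate_rank g.
Proof. by rewrite /idx_rank /gate_idx /idx enum_rankK. Qed.

Definition gates : seq 'I_nb_vars := [seq gate_idx g | g <- enum {: gateT}].

Lemma mem_gates g : gate_idx g \in gates.
Proof. by rewrite map_f // mem_enum. Qed.

Lemma slotsM o a b : slots o (a + b) = slots o a * slots (o + a) b.
Proof. by rewrite /slots addnA -big_cat_nat ?leq_addr. Qed.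

Lemma op_valM k A B j o a : (a <= j)%N ->
  op_val k A a o * op_val k B (j - a) (o + a) =
  ((graded e (op_poly k A))`_a * (graded e (op_poly k B))`_(j - a))%:MP * slots o j.
Proof.
move=> aj; rewrite /op_val mulrACA -slotsM subnKC //; congr (_ * _).
by apply: esym; apply: mpolyCM.
Qed.

Section EvalAt.
Variable s : seq 'I_nb_vars.
Local Notation eval p := (p \mPo partial_eval idx_val s).

Lemma eval_gate g : gate_idx g \in s -> eval ('X_(gate_idx g)) = gate_val g.
Proof. by move=> gs; rewrite partial_evalX gs idx_val_gate. Qed.

Lemma eval_slot o : {subset s <= gates} -> eval (slot o) = slot o.
Proof.
move=> sg; rewrite partial_evalX; case: ifP => // /sg /mapP[g _ /idx_inj].
by [].
Qed.

Lemma eval_opX k A j o : (0 < j < D)%N -> (o + j <= D)%N -> (k < K)%N ->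
  (forall i, gate_idx (inl i) \in s) ->
  (forall (k' : 'I_K) (j' o' : 'I_D), (k' < k)%N -> gate_idx (inr (inl (k', j', o'))) \in s) ->
  eval (opX k A j o) = op_val k A j o.
Proof.
move=> /andP[j0 jD] oj kK ls ns; have oD : (o < D)%N by lia.
case: A => [i|c|k'] /=; rewrite /op_val /op_poly /=.
- rewrite gradedX coefMX coefC; case: eqP => [->|j1].
    by rewrite eval_gate // /slots addn1 big_nat1 /= inordK.
  by case: j j0 jD oj j1 => [|[|j]] //= *; rewrite rmorph0 !mpolyC0 mul0r.
- rewrite gradedC coefC; case: eqP => [jz|_]; first by rewrite jz in j0.
  by rewrite rmorph0 mpolyC0 mul0r.
case: ifP => k'k.
  rewrite eval_gate /=; last by apply: ns; rewrite inordK // (ltn_trans k'k).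
  by rewrite /node_val !inordK ?(ltn_trans k'k) // j0 oj nth_take.
have -> : (take k res)`_k' = 0 by rewrite nth_default // size_take_min geq_min leqNgt k'k.
by rewrite !rmorph0 coef0 mpolyC0 mul0r.
Qed.

(** The defining polynomials follow the recursion of homogeneous components. For a product, the
    intervals starting at o and o + a, of lengths a and j - a, join to the interval of the
    result. *)
Lemma eval_gateQ g : {subset s <= gates} ->
  (forall h, (gate_rank h < gate_rank g)%N -> gate_idx h \in s) ->
  eval (gateQ g) = gate_val g.
Proof.
move=> sg lows; case: g lows => [[i o]|[[[k j] o]|[[[k j] o] a]]] lows /=.
- by rewrite rmorphM /= comp_mpolyC; congr (_ * _); apply: eval_slot.
- have ls i : gate_idx (inl i) \in s by apply: lows.
  have ns (k' : 'I_K) (j' o' : 'I_D) : (k' < k)%N -> gate_idx (inr (inl (k', j', o'))) \in s.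
    by move=> k'k; apply: lows; rewrite /= !ltnS ltn_double.
  rewrite /nodeQ /node_val; case: ifP => [/andP[j0 oj]|_]; last by rewrite rmorph0.
  have jD : (0 < j < D)%N by rewrite j0 ltn_ord.
  rewrite nth_slp_results /instr_val -/(op_poly k _) -/(op_poly k _).
  case eop: (op k).
  + apply: etrans (rmorphD _ _ _) _; rewrite /= !eval_opX // /op_val -mulrDl; congr (_ * _).
    have -> : graded e (op_poly k (left_op k) + op_poly k (right_op k)) =
        graded e (op_poly k (left_op k)) + graded e (op_poly k (right_op k)) by apply: rmorphD.
    by rewrite coefD mpolyCD.
  + apply: etrans (rmorphB _ _ _) _; rewrite /= !eval_opX // /op_val -mulrBl; congr (_ * _).
    have -> : graded e (op_poly k (left_op k) - op_poly k (right_op k)) =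
        graded e (op_poly k (left_op k)) - graded e (op_poly k (right_op k)) by apply: rmorphB.
    by rewrite coefB mpolyCB.
  have prodE a : (1 <= a < j)%N -> eval (prod_node k j o a) =
    ((graded e (op_poly k (left_op k)))`_a * (graded e (op_poly k (right_op k)))`_(j - a))%:MP
      * slots o j.
    move=> /andP[a1 aj]; have aD : (a < D)%N by apply: ltn_trans (ltn_ord j).
    rewrite eval_gate; last by apply: lows; rewrite /= !inordK.
    rewrite /= !inordK //; rewrite /prod_val /valid_prod eop a1 aj oj.
    by apply: op_valM; apply: ltnW.
  have opE A B : eval (op_const k A * opX k B j o) =
      ((graded e (op_poly k A))`_0 * (graded e (op_poly k B))`_j)%:MP * slots o j.
    transitivity (op_const k A * op_val k B j o).
      apply: etrans (rmorphM _ _ _) _; congr (_ * _); [exact: comp_mpolyC | exact: eval_opX].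
    rewrite /op_const -(graded0 e) /op_val; apply: etrans (mulrA _ _ _) _; congr (_ * _).
    exact/esym/mpolyCM.
  have -> : graded e (op_poly k (left_op k) * op_poly k (right_op k)) =
      graded e (op_poly k (left_op k)) * graded e (op_poly k (right_op k)) by apply: rmorphM.
  rewrite coefM_ends // !mpolyCD !mulrDl; apply: etrans (rmorphD _ _ _) _; congr (_ + _).
    by apply: etrans (rmorphD _ _ _) _; congr (_ + _); apply: opE.
  rewrite /= raddf_sum /= raddf_sum mulr_suml; apply: eq_big_nat => a aj.
  exact: prodE.
rewrite /prod_val /prodL /prodR; case: ifP => [/and3P[_ /andP[a0 aj] oj]|_];
  last by rewrite mul0r rmorph0.
have ls i : gate_idx (inl i) \in s by apply: lows.
have ns (k' : 'I_K) (j' o' : 'I_D) : (k' < k)%N -> gate_idx (inr (inl (k', j', o'))) \in s.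
  by move=> k'k; apply: lows; rewrite /= ltnS; lia.
have := ltn_ord j; have := ltn_ord k => kK jD.
apply: etrans (rmorphM _ _ _) _; congr (_ * _); apply: eval_opX => //; lia.
Qed.
End EvalAt.
End Values.

Lemma mfree_slot x o : (forall o', x != inl o') -> mfree (idx x) (slot o).
Proof. by move=> h; apply: mfreeX; rewrite (inj_eq idx_inj). Qed.

Lemma mfree_gate x g : (forall g', x != inr (inl g')) -> mfree (idx x) ('X_(gate_idx g) : P).
Proof. by move=> h; apply: mfreeX; rewrite (inj_eq idx_inj). Qed.

Lemma mfree_opX x k A j o : (forall g, x != inr (inl g)) -> mfree (idx x) (opX k A j o).
Proof.
move=> h; case: A => [i|c|k'] /=; [|exact: mfree0|]; case: ifP => _;
  by [exact: mfree0 | exact: mfree_gate].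
Qed.

Lemma mfree_prodL x k j o a : (forall g, x != inr (inl g)) -> mfree (idx x) (prodL k j o a).
Proof. by move=> h; rewrite /prodL; case: ifP => _; [apply: mfree_opX | apply: mfree0]. Qed.

Lemma mfree_prodR x k j o a : (forall g, x != inr (inl g)) -> mfree (idx x) (prodR k j o a).
Proof. by move=> h; rewrite /prodR; case: ifP => _; [apply: mfree_opX | apply: mfree0]. Qed.

Lemma mfree_nodeQ x k j o : (forall g, x != inr (inl g)) -> mfree (idx x) (nodeQ k j o).
Proof.
move=> h; rewrite /nodeQ; case: ifP => _; last exact: mfree0.
case: (op k).
- by apply: mfreeD; apply: mfree_opX.
- by apply: mfreeD; [|apply: mfreeN]; apply: mfree_opX.
apply: mfreeD; first by apply: mfreeD; apply: mfreeM; by [apply: mfreeC | apply: mfree_opX].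
by apply: mfree_sum => a _; apply: mfree_gate.
Qed.

Definition link (i : 'I_u) (o : nat) : P := 'X_(link_idx (i, inord o)).

(* The gadget of a product node contributes [C * D - A * B], i.e. the node plus the
   product of its operands.  The one of (i, o) contributes
   [leaf * link i o.+1 + (leaf + slot o) * link i o]; as each link must be used once,
   either the first or the second term is chosen for all o simultaneously, which sets
   the i-th boolean variable to 0 or to 1. *)
Definition gA (g : gadgetT) : P :=
  match g with
  | inl (k, j, o, a) => - prodL k j o a
  | inr (i, o) => - (leaf (rshift v i) o + slot o)
  end.
Definition gB (g : gadgetT) : P :=
  match g with inl (k, j, o, a) => prodR k j o a | inr (i, o) => link i o end.
Definition gC (g : gadgetT) : P :=
  match g with inl _ => 1 | inr (i, o) => leaf (rshift v i) o end.
Definition gD (g : gadgetT) : P :=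
  match g with inl (k, j, o, a) => prod_node k j o a | inr (i, o) => link i o.+1 end.

(** The only rows with a coefficient outside F; it is a single variable, as a projection demands. *)
Definition leaf_row (x : 'I_v * 'I_D) : P :=
  leaf (lshift u x.1) x.2 + ('X_(x.1))%:MP * slot x.2.
Definition chain_row (i : 'I_u) : P := link i 0 + link i D.
Definition node_row (n : nodeT) : P :=
  let: (k, j, o) := n in 'X_(gate_idx (inr (inl n))) + nodeQ k j o.
(** The component of degree j uses up the first j slots; the rows [1 + slot o] supply the others. *)
Definition out_row : P :=
  op_const (size prog) out + \sum_(1 <= j < D) opX (size prog) out j 0.

Definition other_rows : P :=
  \prod_x leaf_row x * \prod_i chain_row i * \prod_n node_row n * \prod_(o < D) (1 + slot o)
    * out_row.

Definition all_rows : P :=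
  \prod_(g : gadgetT) gadget_rows (aux_idx (g, true)) (aux_idx (g,
    false)) (gA g) (gB g) (gC g) (gD g)
  * other_rows.

Definition aux_prod : P := \prod_(g : gadgetT) ('X_(aux_idx (g, true)) * 'X_(aux_idx (g, false))).

Lemma mfree_aux_other k : mfree (aux_idx k) other_rows.
Proof.
have ng g : inr (inr (inl k)) != inr (inl g) :> varT by [].
have ns o : inr (inr (inl k)) != inl o :> varT by [].
have nl i o : mfree (aux_idx k) (link i o) by apply: mfreeX; rewrite (inj_eq idx_inj).
rewrite /other_rows; repeat apply: mfreeM.
- apply: mfree_prod => x _; apply: mfreeD; first exact: mfree_gate.
  by apply: mfreeM; [apply: mfreeC | apply: mfree_slot].
- by apply: mfree_prod => i _; apply: mfreeD.
- apply: mfree_prod => -[[n1 n2] n3] _; apply: mfreeD; first exact: mfree_gate.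
  exact: mfree_nodeQ.
- apply: mfree_prod => o _; apply: mfreeD; first exact: mfree1.
  exact: mfree_slot.
apply: mfreeD; first exact: mfreeC.
by apply: mfree_sum => j _; apply: mfree_opX.
Qed.

Lemma top_all_rows_gadgets : top all_rows =
  2%:R ^+ #|{: gadgetT}| *
  top (aux_prod * \prod_(g : gadgetT) (gC g * gD g - gA g * gB g) * other_rows).
Proof.
have ng k g : inr (inr (inl k)) != inr (inl g) :> varT by [].
have ns k o : inr (inr (inl k)) != inl o :> varT by [].
have nl k i o : mfree (aux_idx k) (link i o) by apply: mfreeX; rewrite (inj_eq idx_inj).
rewrite /all_rows top_gadgets.
- rewrite -sum1_size sum1_card big_split /=.
  by rewrite (eq_card (B := {: gadgetT})).
- exact: index_enum_uniq.
- by move=> k k' /idx_inj [].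
- move=> k [[[[? ?] ?] ?]|[i o]] /=; apply: mfreeN; first exact: mfree_prodL.
  by apply: mfreeD; [apply: mfree_gate | apply: mfree_slot].
- by move=> k [[[[? ?] ?] ?]|[i o]] /=; [apply: mfree_prodR | apply: nl].
- by move=> k [[[[? ?] ?] ?]|[i o]] /=; [apply: mfree1 | apply: mfree_gate].
- by move=> k [[[[? ?] ?] ?]|[i o]] /=; [apply: mfree_gate | apply: nl].
by move=> g b _; apply: mfree_aux_other.
Qed.

Definition bool_leaves (e : {ffun 'I_u -> bool}) : P :=
  \prod_i \prod_(0 <= o < D) (leaf (rshift v i) o + (e i)%:R * slot o).

Definition prod_rows : P := \prod_(x : prodT) (let: (k, j, o, a) := x in
  prod_node k j o a + prodL k j o a * prodR k j o a).

Definition unchained_rows : P :=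
  \prod_x leaf_row x * prod_rows * \prod_n node_row n * \prod_(o < D) (1 + slot o) * out_row
    * aux_prod.

Lemma mfree_link_unchained p : mfree (link_idx p) unchained_rows.
Proof.
have ng g : inr (inr (inr p)) != inr (inl g) :> varT by [].
have ns o : inr (inr (inr p)) != inl o :> varT by [].
rewrite /unchained_rows; repeat apply: mfreeM.
- apply: mfree_prod => x _; apply: mfreeD; first exact: mfree_gate.
  by apply: mfreeM; [apply: mfreeC | apply: mfree_slot].
- apply: mfree_prod => -[[[n1 n2] n3] n4] _; apply: mfreeD; first exact: mfree_gate.
  by apply: mfreeM; [apply: mfree_prodL | apply: mfree_prodR].
- apply: mfree_prod => -[[n1 n2] n3] _; apply: mfreeD; first exact: mfree_gate.
  exact: mfree_nodeQ.
- apply: mfree_prod => o _; apply: mfreeD; first exact: mfree1.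
  exact: mfree_slot.
- apply: mfreeD; first exact: mfreeC.
  by apply: mfree_sum => j _; apply: mfree_opX.
by apply: mfree_prod => g _; apply: mfreeM; apply: mfreeX; rewrite (inj_eq idx_inj).
Qed.

Definition link_prod : P := \prod_i \prod_(0 <= o < D.+1) link i o.

Lemma link_chains :
  \prod_(g : gadgetT) (gC g * gD g - gA g * gB g) * \prod_i chain_row i =
  prod_rows * \prod_i ((link i 0 + link i D) * \prod_(0 <= o < D)
      (leaf (rshift v i) o * link i o.+1 + (leaf (rshift v i) o + slot o) * link i o)).
Proof.
rewrite big_sumType /= -[LHS]mulrA; congr (_ * _).
  by apply: eq_bigr => -[[[k j] o] a] _ /=; rewrite mul1r mulNr opprK.
rewrite big_split /= mulrC; congr (_ * _).
transitivity (\prod_(x : 'I_u * 'I_D) (leaf (rshift v x.1) x.2 * link x.1 x.2.+1 +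
     (leaf (rshift v x.1) x.2 + slot x.2) * link x.1 x.2)).
  by apply: eq_bigr => -[i o] _ /=; rewrite mulNr opprK.
rewrite -(pair_bigA _ (fun i (o : 'I_D) => leaf (rshift v i) o * link i o.+1 +
     (leaf (rshift v i) o + slot o) * link i o)).
by apply: eq_bigr => i _; rewrite big_mkord.
Qed.

Lemma sum_bool_leaves :
  \prod_i (\prod_(0 <= o < D) leaf (rshift v i) o + \prod_(0 <= o < D) (leaf (rshift v i) o +
    slot o)) =
  \sum_(e : {ffun 'I_u -> bool}) bool_leaves e.
Proof.
rewrite -(bigA_distr_bigA (fun i (b : bool) =>
   \prod_(0 <= o < D) (leaf (rshift v i) o + b%:R * slot o))).
apply: eq_bigr => i _; rewrite big_bool /= addrC; congr (_ + _);
  by apply: eq_bigr => o _; rewrite ?mul1r ?mul0r ?addr0.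
Qed.

(** By [top_chains] the chain of a boolean variable yields two products, one for each of its values;
    distributing over the variables produces the sum over all assignments e. *)
Lemma top_all_rows_links : top all_rows =
  2%:R ^+ #|{: gadgetT}| *
  \sum_(e : {ffun 'I_u -> bool}) top (link_prod * bool_leaves e * unchained_rows).
Proof.
rewrite top_all_rows_gadgets; congr (_ * _).
transitivity (top (\prod_i ((link i 0 + link i D) * \prod_(0 <= o < D)
      (leaf (rshift v i) o * link i o.+1 + (leaf (rshift v i) o + slot o) * link i o))
   * unchained_rows)).
  have shuffle (T : comNzRingType) (x y a c b p q r h : T) : y * c = h * b ->
      x * y * (a * c * p * q * r) = b * (a * h * p * q * r * x).
    move=> e; rewrite (_ : x * y * _ = y * c * (x * a * p * q * r)); last by ring.
    by rewrite e; ring.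
  by congr top; apply: shuffle; apply: link_chains.
have li i i' o o' : (o <= D)%N -> (o' <= D)%N ->
    link_idx (i, inord o) = link_idx (i', inord o') -> i = i' /\ o = o'.
  by move=> oD o'D /idx_inj [-> /(congr1 (@nat_of_ord _))]; rewrite !inordK.
have := @top_chains _ _ _ (index_enum 'I_u) D (fun i o => link_idx (i, inord o))
  (fun i o => leaf (rshift v i) o) (fun i o => leaf (rshift v i) o + slot o) unchained_rows
  (index_enum_uniq _) li => ->; last 2 first.
- move=> i i' o o' _; rewrite mfree_gate //=.
  by apply: mfreeD; [apply: mfree_gate | apply: mfree_slot].
- by move=> i o _ _; apply: mfree_link_unchained.
rewrite sum_bool_leaves -top_sum; apply: congr1.
by rewrite mulr_sumr mulr_suml.
Qed.

Lemma gates_rows e :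
  bool_leaves e * (\prod_x leaf_row x * prod_rows * \prod_n node_row n) =
  \prod_(i <- gates) ('X_i + idxQ e i).
Proof.
rewrite big_map big_enum /=.
rewrite (eq_bigr (fun g => 'X_(gate_idx g) + gateQ e g)); last first.
  by move=> g _; rewrite idxQ_gate.
rewrite big_sumType /= big_sumType /=.
have prodE : \prod_(x : prodT) ('X_(gate_idx (inr (inr x))) + gateQ e (inr (inr x))) = prod_rows.
  apply: eq_bigr => -[[[k j] o] a] _ /=.
  by rewrite /prod_node !inord_val.
have nodeE : \prod_(n : nodeT) ('X_(gate_idx (inr (inl n))) + gateQ e (inr (inl n))) =
    \prod_n node_row n.
  by apply: eq_bigr => -[[k j] o] _ /=.
have leafE : \prod_(x : leafT) ('X_(gate_idx (inl x)) + gateQ e (inl x)) =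
    \prod_x leaf_row x * bool_leaves e.
  transitivity (\prod_(i < v + u) \prod_(o < D) (leaf i o + leaf_val e i o)).
    rewrite pair_bigA; apply: eq_bigr => -[i o] _ /=.
    by rewrite /leaf inord_val.
  rewrite big_split_ord /=; congr (_ * _).
    rewrite pair_bigA; apply: eq_bigr => -[i o] _ /=.
    by rewrite /leaf_val /bool_point (unsplitK (inl i)).
  apply: eq_bigr => i _; rewrite big_mkord; apply: eq_bigr => o _.
  rewrite /leaf_val /bool_point (unsplitK (inr i)); congr (_ + _ * _).
  by case: (e i); rewrite ?mpolyC1 ?mpolyC0.
rewrite prodE nodeE leafE.
have shuffle (T : comNzRingType) (a b c d' : T) : a * (b * c * d') = b * a * (d' * c) by ring.
exact: shuffle.
Qed.

Definition ungated_rows : P := link_prod * aux_prod * \prod_(o < D) (1 + slot o) * out_row.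

Definition out_val (e : {ffun 'I_u -> bool}) : P :=
  \sum_(0 <= j < D) ((graded e (op_poly (size prog) out))`_j)%:MP * slots 0 j.

Lemma slot_notin_gates x : (forall g, x != inr (inl g)) -> idx x \in gates = false.
Proof.
move=> h; apply/negP=> /mapP[g _ /idx_inj xg].
by have := h g; rewrite xg eqxx.
Qed.

Lemma eval_ungated_rows e :
  ungated_rows \mPo partial_eval (idx_val e) gates =
  link_prod * aux_prod * \prod_(o < D) (1 + slot o) * out_val e.
Proof.
have evX x : (forall g, x != inr (inl g)) ->
    'X_(idx x) \mPo partial_eval (idx_val e) gates = 'X_(idx x).
  by move=> h; rewrite partial_evalX slot_notin_gates.
apply: etrans (rmorphM _ _ _) _; congr (_ * _).
  apply: etrans (rmorphM _ _ _) _; congr (_ * _).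
    apply: etrans (rmorphM _ _ _) _; congr (_ * _).
      apply: etrans (rmorph_prod _ _ _ _) _; apply: eq_bigr => i _.
      by apply: etrans (rmorph_prod _ _ _ _) _; apply: eq_bigr => o _; apply: evX.
    apply: etrans (rmorph_prod _ _ _ _) _; apply: eq_bigr => g _.
    by apply: etrans (rmorphM _ _ _) _; congr (_ * _); apply: evX.
  apply: etrans (rmorph_prod _ _ _ _) _; apply: eq_bigr => o _.
  apply: etrans (rmorphD _ _ _) _; congr (_ + _); first exact: rmorph1.
  exact: evX.
rewrite /out_row /out_val [in RHS]big_ltn //.
apply: etrans (rmorphD _ _ _) _; congr (_ + _).
  by apply: etrans (comp_mpolyC _ _) _; rewrite graded0 /slots big_geq // mulr1.
apply: etrans (raddf_sum _ _ _ _) _; apply: eq_big_nat => j /andP[j0 jD].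
apply: eval_opX; rewrite ?j0 ?(ltnW jD) // => *; exact: mem_gates.
Qed.

Lemma top_gates_rows e :
  top (link_prod * bool_leaves e * unchained_rows) =
  top (\prod_(i <- gates) 'X_i * (link_prod * aux_prod * \prod_(o < D) (1 + slot o) * out_val e)).
Proof.
rewrite -eval_ungated_rows -(@top_gates_rank _ _ (idx_val e) (idxQ e) idx_rank).
- rewrite -gates_rows; congr top.
  have shuffle (T : comNzRingType) (l b x p n o r a : T) :
    l * b * (x * p * n * o * r * a) = b * (x * p * n) * (l * a * o * r) by ring.
  exact: shuffle.
- by rewrite map_inj_uniq ?enum_uniq // => g g' /idx_inj [].
- move=> i j /mapP[g _ ->]; rewrite /idx_val; case: (enum_val j) => [o|[h|x]]; try exact: mfree0.
  have fs o : mfree (gate_idx g) (slot o) by apply: mfree_slot.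
  have fss o k : mfree (gate_idx g) (slots o k) by apply: mfree_prod.
  have fo k A o j' : mfree (gate_idx g) (op_val e k A o j') by apply: mfreeM; [apply: mfreeC |].
  case: h => [[i' o]|[[[k j'] o]|[[[k j'] o] a]]] /=.
  + by apply: mfreeM; [apply: mfreeC |].
  + by rewrite /node_val; case: ifP => _; [apply: mfreeM; [apply: mfreeC |] | apply: mfree0].
  by rewrite /prod_val; case: ifP => _; [apply: mfreeM | apply: mfree0].
- move=> i p; rewrite /idx_val; case: (enum_val i) => [o|[h|x]];
  try by rewrite !mul0r /top mcoeff0.
  (* Every gate value is 0 or contains a slot variable, its degree being positive; so its square
     contains a squared variable. *)
  have sq (q : P) o : top (slot o * q * (slot o * q) * p) = 0.
    rewrite -[RHS](top_sqr (slot_idx (inord o)) (q * q * p)); congr top.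
    have shuffle (T : comNzRingType) (s q' p' : T) : s * q' * (s * q') * p' =
      s * s * (q' * q' * p') by ring.
    exact: shuffle.
  have slotsE o j : (0 < j)%N -> slots o j = slot o * slots o.+1 j.-1.
    by case: j => // j _; rewrite /slots big_ltn ?addSnnS // addnS ltnS leq_addr.
  have op_sq (c : S) (o j : nat) (q : P) : (0 < j)%N ->
     top (c%:MP * slots o j * q * (c%:MP * slots o j * q) * p) = 0.
    move=> j0; rewrite (slotsE o j j0).
    transitivity (top (slot o * (c%:MP * slots o.+1 j.-1 * q) *
                       (slot o * (c%:MP * slots o.+1 j.-1 * q)) * p)); last exact: sq.
    apply: (congr1 (@top _ _)).
    have shuffle (T : comNzRingType) (s q' p' c' z : T) :
       c' * (s * z) * q' * (c' * (s * z) * q') * p' =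
         s * (c' * z * q') * (s * (c' * z * q')) * p' by ring.
    exact: shuffle.
  case: h => [[i' o]|[[[k j'] o]|[[[k j'] o] a]]] /=.
  + by rewrite /leaf_val [_ * slot _]mulrC; apply: sq.
  + rewrite /node_val; case: ifP => [/andP[j0 _]|_]; last by rewrite !mul0r /top mcoeff0.
    by rewrite -[X in X * _ * _]mulr1 -[X in _ * X * _]mulr1; apply: op_sq.
  rewrite /prod_val; case: ifP => [/and3P[_ /andP[a0 _] _]|_];
    last by rewrite !mul0r /top mcoeff0.
  exact: op_sq.
move=> i s1 /mapP[g _ ->] lows sub; rewrite idxQ_gate idx_val_gate; apply: eval_gateQ => //.
by move=> h hg; apply: lows; rewrite ?mem_gates // !idx_rank_gate.
Qed.

Lemma prod_all_vars :
  \prod_(i < nb_vars) 'X_i =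
  \prod_(o < D) slot o * (\prod_(i <- gates) 'X_i * (link_prod * aux_prod)) :> P.
Proof.
transitivity (\prod_(x : varT) 'X_(idx x) : P).
  by rewrite (reindex idx) //; exists enum_val => x _; [apply: enum_rankK | apply: enum_valK].
rewrite big_sumType /=; congr (_ * _).
  by apply: eq_bigr => o _; rewrite /slot inord_val.
rewrite big_sumType /= [X in _ * X]big_sumType /=.
congr (_ * _); first by rewrite big_map big_enum.
rewrite mulrC; congr (_ * _).
  rewrite /link_prod; apply: esym.
  transitivity (\prod_i \prod_(o < D.+1) link i o).
    by apply: eq_bigr => i _; rewrite big_mkord.
  rewrite pair_bigA; apply: eq_bigr => -[i o] _ /=.
  by rewrite /link inord_val.
rewrite /aux_prod; apply: esym.
transitivity (\prod_(g : gadgetT) \prod_(b : bool) ('X_(aux_idx (g, b)) : P)).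
  by apply: eq_bigr => g _; rewrite big_bool.
by rewrite pair_bigA; apply: eq_bigr => -[g b] _.
Qed.

Lemma top_slot_rows j : (j <= D)%N ->
  top (\prod_(o < D) (1 + slot o) * slots 0 j * (\prod_(i <- gates) 'X_i * (link_prod *
    aux_prod))) = 1.
Proof.
move=> jD; pose ss := [seq slot_idx o | o <- enum 'I_D].
pose Q (i : 'I_nb_vars) := if (enum_val i : varT) is inl o then (o < j)%N else false.
have slotE o : (o < D)%N -> slot o = 'X_(slot_idx (inord o)) by [].
have -> : \prod_(o < D) (1 + slot o) = \prod_(i <- ss) (1 + 'X_i).
  by rewrite big_map big_enum; apply: eq_bigr => o _; rewrite /slot inord_val.
have -> : slots 0 j = \prod_(i <- ss | Q i) 'X_i.
  rewrite big_map big_enum_cond /= /slots add0n big_mkord (big_ord_widen D (fun i => slot i) jD).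
  apply: eq_big => o; first by rewrite /Q /slot_idx /idx enum_rankK.
  by rewrite /slot inord_val.
rewrite top_slots; last 2 first.
- by rewrite map_inj_uniq ?enum_uniq // => o o' /idx_inj [].
- move=> i /mapP[o _ ->]; apply: mfreeM; last apply: mfreeM.
  + rewrite big_map; apply: mfree_prod => g _; apply: mfreeX.
    by rewrite (inj_eq idx_inj).
  + by do 2!(apply: mfree_prod => ? _); apply: mfreeX; rewrite (inj_eq idx_inj).
  by apply: mfree_prod => ? _; apply: mfreeM; apply: mfreeX; rewrite (inj_eq idx_inj).
rewrite -[RHS](top_all _ nb_vars) prod_all_vars; congr (top (_ * _)).
by rewrite big_map big_enum; apply: eq_bigr => o _; rewrite /slot inord_val.
Qed.

(** After the elimination each homogeneous component is multiplied by a slot monomial whose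
    completed product has [top] equal to 1, so the components are added up; the degree bound ensures
    that none is missing. *)
Lemma top_all_rows : (msize (op_poly (size prog) out) <= D)%N ->
  top all_rows = 2%:R ^+ #|{: gadgetT}| *
    \sum_(e : {ffun 'I_u -> bool}) eval_bools (op_poly (size prog) out) e.
Proof.
move=> sz; rewrite top_all_rows_links; congr (_ * _); apply: eq_bigr => e _.
rewrite top_gates_rows -graded1 (horner_coef_wide 1 (leq_trans (size_graded e _) sz)).
pose W := \prod_(o < D) (1 + slot o).
pose X := \prod_(i <- gates) 'X_i * (link_prod * aux_prod).
transitivity (top (\sum_(0 <= j < D)
   ((graded e (op_poly (size prog) out))`_j)%:MP * (W * slots 0 j * X))).
  apply: (congr1 (@top _ _)).
  transitivity (out_val e * (W * X)).
    have shuffle (T : comNzRingType) (g l a w z : T) : g * (l * a * w * z) =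
      z * (w * (g * (l * a))).
      by ring.
    exact: shuffle.
  rewrite /out_val mulr_suml; apply: eq_bigr => j _.
  have shuffle (T : comNzRingType) (c s w x : T) : c * s * (w * x) = c * (w * s * x) by ring.
  exact: shuffle.
rewrite top_sum big_mkord; apply: eq_bigr => j _.
by rewrite topC top_slot_rows ?(ltnW (ltn_ord j)) // mulr1 expr1n mulr1.
Qed.

End Encoding.

(** * Rows whose coefficients are admissible matrix entries *)

Section AffineRows.
Variables (F : fieldType) (v c : nat).
Local Notation P := {mpoly {mpoly F[v]}[c]}.

Definition entry_poly (a : F + 'I_v) : {mpoly F[v]} :=
  match a with inl x => x%:MP | inr j => 'X_j end.

Definition affine (p : P) : Prop := exists b : option 'I_c -> F,
  p = (b None)%:MP%:MP + \sum_(w < c) (b (Some w))%:MP%:MP * 'X_w.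

Definition pattern_row (p : P) : Prop := exists a : option 'I_c -> F + 'I_v,
  p = (entry_poly (a None))%:MP + \sum_(w < c) (entry_poly (a (Some w)))%:MP * 'X_w.

Lemma affine_pattern p : affine p -> pattern_row p.
Proof. by case=> b ->; exists (fun o => inl (b o)). Qed.

Lemma affineC x : affine x%:MP%:MP.
Proof.
exists (fun o => if o is None then x else 0); rewrite big1 ?addr0 // => w _.
by rewrite !mpolyC0 mul0r.
Qed.

Lemma affine0 : affine 0.
Proof. by have := affineC 0; rewrite !mpolyC0. Qed.

Lemma affine1 : affine 1.
Proof. by have := affineC 1; rewrite !mpolyC1. Qed.

Lemma affineX w : affine 'X_w.
Proof.
exists (fun o => (o == Some w)%:R); rewrite /= !mpolyC0 add0r (bigD1 w) //= eqxx.
rewrite !mpolyC1 mul1r big1 ?addr0 // => w' /negPf nw.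
by rewrite (inj_eq Some_inj) nw !mpolyC0 mul0r.
Qed.

Lemma affineD p q : affine p -> affine q -> affine (p + q).
Proof.
case=> a -> [b ->]; exists (fun o => a o + b o).
rewrite addrACA !mpolyCD -big_split; congr (_ + _); apply: eq_bigr => w _.
by rewrite !mpolyCD mulrDl.
Qed.

Lemma affineZ x p : affine p -> affine (x%:MP%:MP * p).
Proof.
case=> a ->; exists (fun o => x * a o).
rewrite mulrDr !mpolyCM mulr_sumr; congr (_ + _); apply: eq_bigr => w _.
by rewrite !mpolyCM mulrA.
Qed.

Lemma affineN p : affine p -> affine (- p).
Proof. by move/(affineZ (-1)); rewrite !mpolyCN !mpolyC1 mulN1r. Qed.

Lemma affine_sum (I : Type) (r : seq I) (Q : pred I) (f : I -> P) :
  (forall i, Q i -> affine (f i)) -> affine (\sum_(i <- r | Q i) f i).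
Proof. by move=> h; elim/big_rec: _ => [|i p Qi]; [apply: affine0 | apply/affineD/h]. Qed.

Lemma pattern_row_var (w w' : 'I_c) (j : 'I_v) : w != w' ->
  pattern_row ('X_w + ('X_j)%:MP * 'X_w').
Proof.
move=> ww'; exists (fun o => if o == Some w' then inr j else inl (o == Some w)%:R).
rewrite /= !mpolyC0 add0r (bigD1 w') //= (bigD1 w) //= !eqxx (inj_eq Some_inj) (negPf ww') /=.
rewrite !mpolyC1 mul1r addrC big1 ?addr0 // => k /andP[/negPf nk' /negPf nk].
by rewrite !(inj_eq Some_inj) nk' nk /= !mpolyC0 mul0r.
Qed.

Lemma per_of_pattern_rows m (ls : seq P) : size ls = (c + m)%N ->
  (forall p, p \in ls -> pattern_row p) ->
  exists M : 'M[F + 'I_v]_(c + m),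
    per (map_mx entry_poly M) = (m`!)%:R * top (\prod_(p <- ls) p).
Proof.
move=> sz pat; have prow (r : 'I_(c + m)) : pattern_row (nth 0 ls r).
  by apply: pat; rewrite mem_nth ?sz.
have [a aE] := fin_all_exists prow.
exists (\matrix_(r, k) a r (column_var k)).
rewrite (big_nth 0) sz big_mkord (eq_bigr _ (fun r _ => aE r)).
rewrite -(per_affine_rows (fun r o => entry_poly (a r o))); congr per.
by apply/matrixP=> r k; rewrite !mxE.
Qed.
End AffineRows.

Section EncodingRows.
Variables (F : fieldType) (v u d : nat).
Variables (prog : seq (instruction F (v + u))) (out : operand F (v + u)).
Local Notation S := {mpoly F[v]}.
Local Notation D := d.+1.
Local Notation K := (size prog).+1.
Local Notation leafT := ('I_(v + u) * 'I_D)%type.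
Local Notation nodeT := ('I_K * 'I_D * 'I_D)%type.
Local Notation prodT := ('I_K * 'I_D * 'I_D * 'I_D)%type.
Local Notation gateT := (leafT + (nodeT + prodT))%type.
Local Notation gadgetT := (prodT + 'I_u * 'I_D)%type.
Local Notation nbv := (@nb_vars F v u d prog).
Local Notation P := {mpoly S[nbv]}.
Local Notation aux g b := ('X_(aux_idx (prog := prog) (d := d) (g, b)) : P).

Definition gadget_list (g : gadgetT) : seq P :=
  [:: (gA g : P) + aux g true + aux g false; (gB g : P) + aux g true + aux g false;
      (gC g : P) - aux g true + aux g false; (gD g : P) - aux g true + aux g false].

Definition row_list : seq P :=
  flatten [seq gadget_list g | g <- enum {: gadgetT}] ++
  [seq leaf_row prog x | x <- enum {: 'I_v * 'I_D}] ++
  [seq chain_row d prog i | i <- enum 'I_u] ++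
  [seq node_row n | n <- enum {: nodeT}] ++
  [seq 1 + slot d prog (nat_of_ord o) | o <- enum 'I_D] ++ [:: out_row d prog out].

Lemma prod_row_list : \prod_(p <- row_list) p = all_rows d prog out.
Proof.
rewrite /row_list !big_cat big_flatten !big_map big_seq1 /=.
rewrite /all_rows /other_rows -!mulrA; congr (_ * _).
apply: eq_bigr => g _; rewrite /gadget_list !big_cons big_nil mulr1 /gadget_rows.
by rewrite !mulrA.
Qed.

(* The number of rows minus the number of variables. *)
Definition spare : nat := K * D * D * D + 2.

Lemma nb_varsE : nbv = (D + ((v + u) * D + (K * D * D + K * D * D * D)
   + ((K * D * D * D + u * D) * 2 + u * D.+1)))%N.
Proof. by rewrite /nb_vars !(card_sum, card_prod, card_ord, card_bool). Qed.

(** The successor accounts for the constant row that [bool_sum_as_per] prepends in order to cancel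
    the scalar factor. *)
Lemma size_row_list : (size row_list).+1 = (nbv + spare)%N.
Proof.
have szE (T : finType) (A : Type) (f : T -> A) : size [seq f x | x <- enum {: T}] = #|{: T}|.
  by rewrite size_map -cardE.
have szF (T : finType) (f : T -> seq P) : (forall x, size (f x) = 4) ->
    size (flatten [seq f x | x <- enum {: T}]) = (4 * #|{: T}|)%N.
  move=> f4; rewrite cardE; elim: (enum _) => [|x r IH] /=; first by rewrite muln0.
  by rewrite size_cat f4 IH mulnS.
rewrite /row_list !size_cat szF // !szE /=.
rewrite !(card_sum, card_prod, card_ord) nb_varsE /spare.
set K3 := (_ * D * D * D)%N; set K2 := (_ * D * D)%N.
rewrite mulnDl mulnS; set a := (v * D)%N; set b := (u * D)%N.
lia.
Qed.

Lemma affine_opX k A j o : affine (opX d prog k A j o : P).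
Proof. by case: A => [i|x|k'] /=; [|exact: affine0|]; case: ifP => _; try exact: affine0;
  apply: affineX. Qed.

Lemma affine_row_list p : p \in row_list -> pattern_row p.
Proof.
have aL k j o a : affine (prodL d prog k j o a : P).
  by rewrite /prodL; case: ifP => _; [apply: affine_opX | apply: affine0].
have aR k j o a : affine (prodR d prog k j o a : P).
  by rewrite /prodR; case: ifP => _; [apply: affine_opX | apply: affine0].
have afA (g : gadgetT) : affine (gA g : P).
  case: g => [[[[k j] o] a]|[i o]] /=; apply: affineN; first exact: aL.
  by apply: affineD; apply: affineX.
have afB (g : gadgetT) : affine (gB g : P).
  case: g => [[[[k j] o] a]|[i o]] /=; [exact: aR | exact: affineX].
have afC (g : gadgetT) : affine (gC g : P).
  by case: g => [[[[k j] o] a]|[i o]] /=; [exact: affine1 | exact: affineX].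
have afD (g : gadgetT) : affine (gD g : P).
  by case: g => [[[[k j] o] a]|[i o]] /=; exact: affineX.
rewrite !mem_cat inE => /or4P[|||/or3P[|| /eqP ->]].
- case/flattenP=> _ /mapP[g _ ->]; rewrite !inE => /or4P[] /eqP ->; apply: affine_pattern;
    by apply: affineD; [apply: affineD => //; try apply: affineN|]; apply: affineX.
- case/mapP=> -[i o] _ ->; apply: pattern_row_var.
  by rewrite (inj_eq (@idx_inj _ _ _ _ _)).
- by case/mapP=> i _ ->; apply: affine_pattern; apply: affineD; apply: affineX.
- case/mapP=> -[[k j] o] _ ->; apply: affine_pattern; apply: affineD; first exact: affineX.
  rewrite /nodeQ; case: ifP => _; last exact: affine0.
  case: (instr_op _).
  + by apply: affineD; apply: affine_opX.
  + by apply: affineD; [|apply: affineN]; apply: affine_opX.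
  apply: affineD; first by apply: affineD; apply: affineZ; apply: affine_opX.
  by apply: affine_sum => a _; apply: affineX.
- by case/mapP=> o _ ->; apply: affine_pattern; apply: affineD; [apply: affine1 | apply: affineX].
apply: affine_pattern; apply: affineD; first exact: affineC.
by apply: affine_sum => j _; apply: affine_opX.
Qed.

Lemma bool_sum_as_per (charF0 : [pchar F] =i pred0) :
  (msize (op_poly prog (size prog) out) <= D)%N ->
  exists M : 'M[F + 'I_v]_(nbv + spare),
    \sum_(e : {ffun 'I_u -> bool}) eval_bools (op_poly prog (size prog) out) e =
    per (map_mx (@entry_poly F v) M).
Proof.
(* The factorial comes from the identical constant columns, the power of 2 from the gadgets. *)
move=> sz; pose N := (spare`! * 2 ^ #|{: gadgetT}|)%N.
have N0 : N%:R != 0 :> F.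
  by rewrite ((pcharf0P F).1 charF0) -lt0n muln_gt0 fact_gt0 expn_gt0.
have [|p|M perM] := @per_of_pattern_rows F v nbv spare ((N%:R^-1)%:MP%:MP :: row_list).
- exact: size_row_list.
- rewrite inE => /orP[/eqP ->|]; last exact: affine_row_list.
  by apply: affine_pattern; apply: affineC.
exists M; rewrite perM big_cons prod_row_list topC top_all_rows //.
have cN : (N%:R^-1)%:MP * N%:R = 1 :> S.
  by rewrite -(rmorph_nat (@mpolyC v F)) -mpolyCM mulVf ?mpolyC1.
have NE : N%:R = (spare`!)%:R * 2%:R ^+ #|{: gadgetT}| :> S by rewrite natrM natrX.
rewrite -[LHS]mul1r -[X in X * _ = _]cN [X in _ * X * _ = _]NE.
have shuffle (T : comNzRingType) (a b c x : T) : c * (a * b) * x = a * (c * (b * x)) by ring.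
exact: shuffle.
Qed.
End EncodingRows.

(** * Hardness *)

Lemma p_bounded_le (f g : nat -> nat) : p_bounded g -> (forall n, (0 < n)%N ->
  (f n <= g n)%N) -> p_bounded f.
Proof. by case=> p gp fg; exists p => n n0; apply: leq_trans (fg n n0) (gp n n0). Qed.

Lemma p_bounded_const c : p_bounded (fun=> c).
Proof. by exists c%:P => n _; rewrite hornerC. Qed.

Lemma p_bounded_id : p_bounded id.
Proof. by exists 'X => n _; rewrite hornerX. Qed.

Lemma p_bounded_add f g : p_bounded f -> p_bounded g -> p_bounded (fun n => f n + g n)%N.
Proof.
case=> p fp [q gq]; exists (p + q) => n n0.
by rewrite hornerD leq_add ?fp ?gq.
Qed.

Lemma p_bounded_mul f g : p_bounded f -> p_bounded g -> p_bounded (fun n => f n * g n)%N.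
Proof.
case=> p fp [q gq]; exists (p * q) => n n0.
by rewrite hornerM leq_mul ?fp ?gq.
Qed.

(** Closed form of [nb_vars + spare], the size of the permanent, for a program with L
    instructions. *)
Definition per_size (v u d L : nat) : nat :=
  (d.+1 + ((v + u) * d.+1 + (L.+1 * d.+1 * d.+1 + L.+1 * d.+1 * d.+1 * d.+1)
   + ((L.+1 * d.+1 * d.+1 * d.+1 + u * d.+1) * 2 + u * d.+2))
   + (L.+1 * d.+1 * d.+1 * d.+1 + 2))%N.

Ltac p_bounded_tac := repeat first
  [ assumption | apply: p_bounded_add | apply: p_bounded_mul | apply: p_bounded_const
  | apply: p_bounded_id ].

Lemma p_bounded_per_size v u d L : p_bounded v -> p_bounded u -> p_bounded d -> p_bounded L ->
  p_bounded (fun n => per_size (v n) (u n) (d n) (L n)).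
Proof.
move=> pv pu pd pL.
have pS f : p_bounded f -> p_bounded (fun n => (f n).+1).
  by move=> pf; apply: p_bounded_le (p_bounded_add pf (p_bounded_const 1)) _ => n _;
    rewrite addn1.
have pd1 := pS _ pd; have pd2 := pS _ pd1; have pL1 := pS _ pL.
by rewrite /per_size; p_bounded_tac.
Qed.

Lemma p_bounded_gadget_size f : p_bounded f -> p_bounded (fun n => gadget_size (f n)).
Proof. by move=> pf; rewrite /gadget_size; p_bounded_tac. Qed.

Lemma comp_Imm_generic (F : fieldType) m (la : partition_of m) v (a : 'I_(m * m) ->
  {mpoly F[v]}) :
  Imm la (generic_mx F m) \mPo [tuple a k | k < m * m] =
  Imm la (\matrix_(i, j) a (mxvec_index i j)).
Proof.
apply: etrans (rmorph_sum _ _ _ _) _; apply: eq_bigr => s _.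
apply: etrans (rmorphM _ _ _) _; congr (_ * _); first exact: rmorph_int.
apply: etrans (rmorph_prod _ _ _ _) _; apply: eq_bigr => i _.
by rewrite !mxE; apply: etrans (comp_mpolyXU _ _) _; rewrite -tnth_nth tnth_mktuple.
Qed.

Lemma per_projection (F : fieldType) (charF0 : [pchar F] =i pred0) v N
    (M : 'M[F + 'I_v]_N) : (0 < N)%N ->
  is_projection (per (map_mx (@entry_poly F v) M))
                (Imm (two_parts (gadget_size N)) (generic_mx F (2 * gadget_size N))).
Proof.
move=> N0; have [P PE] := per_as_Imm charF0 N0.
pose B := \matrix_(i, j) match P i j with inl c => inl c | inr (p, q) => M p q end.
exists (fun k => (mxvec B) 0 k); rewrite comp_Imm_generic -(PE _ (@mpolyC v F)); congr Imm.
apply/matrixP=> i j; rewrite !mxE mxvecE mxE.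
by case: (P i j) => [c|[p q]] //=; rewrite mxE; case: (M p q).
Qed.

Lemma VNP_projection (F : fieldType) (charF0 : [pchar F] =i pred0) (f : mpoly_family F) :
  VNP f -> p_projection f (imm_two_family F).
Proof.
case=> -[pv _] [u [g [pu [[_ pd] [L pL cL]] fE]]].
pose d n := (msize (g n)).-1; pose t n := per_size (nvars f n) (u n) (d n) (L n).
exists (fun n => gadget_size (t n)).
  by apply/p_bounded_gadget_size/p_bounded_per_size.
move=> n n0; have t0 : (0 < t n)%N by rewrite /t /per_size addnS.
split; first by rewrite /gadget_size addn_gt0 t0.
have [[prog [o oE] szL] _] := cL n n0.
have gE : op_poly prog (size prog) o = g n.
  by rewrite /op_poly -(size_slp_results prog) take_size.
have [|M fM] := @bool_sum_as_per F _ _ (d n) prog o charF0; first by rewrite gE leqSpred.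
have tE : (nb_vars (d n) prog + spare (d n) prog)%N = t n.
  by rewrite nb_varsE /spare szL.
rewrite fE // -gE fM /=; move: M {fM}; rewrite tE => M.
exact: per_projection.
Qed.

(** * Membership *)

Section Cost.
Variables (F : fieldType) (v : nat).
Local Notation P := {mpoly F[v]}.
Implicit Types (p q : P) (l : nat) (Q Pg : seq (instruction F v)).

(* Starting from an arbitrary program Pg makes these bounds add up. *)
Definition cost p l : Prop := forall Pg, exists Q (o : operand F v),
  (size Q <= l)%N /\ forall Q', operand_val (slp_results (Pg ++ Q ++ Q')) o = p.

Lemma cost_op (op : arith_op) p q l1 l2 : cost p l1 -> cost q l2 ->
  cost (match op with OpAdd => p + q | OpSub => p - q | OpMul => p * q end) (l1 + l2).+1.
Proof.
move=> cp cq Pg; have [Q1 [o1 [s1 v1]]] := cp Pg; have [Q2 [o2 [s2 v2]]] := cq (Pg ++ Q1).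
exists (Q1 ++ Q2 ++ [:: Instr op o1 o2]), (OpRes F v (size (Pg ++ Q1 ++ Q2))); split.
  by rewrite !size_cat /= addn1 addnS ltnS leq_add.
move=> Q' /=; set k := size _; rewrite nth_slp_results.
have eP : Pg ++ (Q1 ++ Q2 ++ [:: Instr op o1 o2]) ++ Q' =
  (Pg ++ Q1 ++ Q2) ++ Instr op o1 o2 :: Q'.
  by rewrite -!catA.
rewrite eP take_slp_results take_size_cat // /nth_instr nth_cat ltnn subnn /=.
rewrite /instr_val /= v1.
have := v2 [::]; rewrite cats0 -catA => ->.
by case: op {eP}.
Qed.

Lemma cost_computes p l : cost p l -> exists2 Q, slp_computes Q p & (size Q <= l)%N.
Proof.
case/(_ [::]) => Q [o [sQ vQ]]; exists Q => //.
by exists o; have := vQ [::]; rewrite cats0.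
Qed.

(** A formula with l operations has at most l + 1 leaves, hence degree at most l + 1; so a single
    number bounds both complexity and degree ([msize] exceeds the degree by one). *)
Definition small p l : Prop := cost p l /\ (msize p <= l.+2)%N.

Lemma small_le p l l' : (l <= l')%N -> small p l -> small p l'.
Proof.
move=> ll' [cp dp]; split; last by apply: leq_trans dp _; rewrite !ltnS.
move=> Pg; have [Q [o [sQ vQ]]] := cp Pg; exists Q, o.
by split=> //; apply: leq_trans sQ ll'.
Qed.

Lemma smallX i : small 'X_i 0.
Proof. by split; [move=> Pg; exists [::], (OpVar F i) | rewrite msizeX mdeg1]. Qed.

Lemma smallC c : small c%:MP 0.
Proof.
split; first by move=> Pg; exists [::], (OpConst v c).
by rewrite msizeC; case: (c == 0).
Qed.

Lemma smallD p q l1 l2 : small p l1 -> small q l2 -> small (p + q) (l1 + l2).+1.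
Proof.
move=> [cp dp] [cq dq]; split; first exact: (cost_op OpAdd).
rewrite (leq_trans (msizeD_le _ _)) // geq_max.
by rewrite (leq_trans dp) ?(leq_trans dq) //; lia.
Qed.

Lemma smallB p q l1 l2 : small p l1 -> small q l2 -> small (p - q) (l1 + l2).+1.
Proof.
move=> [cp dp] [cq dq]; split; first exact: (cost_op OpSub).
rewrite (leq_trans (msizeD_le _ _)) // msizeN geq_max.
by rewrite (leq_trans dp) ?(leq_trans dq) //; lia.
Qed.

Lemma smallM p q l1 l2 : small p l1 -> small q l2 -> small (p * q) (l1 + l2).+1.
Proof.
move=> [cp dp] [cq dq]; split; first exact: (cost_op OpMul).
have [->|p0] := eqVneq p 0; first by rewrite mul0r msize0.
have [->|q0] := eqVneq q 0; first by rewrite mulr0 msize0.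
rewrite msizeM //; move: dp dq; set a := msize p; set b := msize q; lia.
Qed.

Lemma small1 : small 1 0. Proof. by have := smallC 1; rewrite mpolyC1. Qed.
Lemma small0 : small 0 0. Proof. by have := smallC 0; rewrite mpolyC0. Qed.

Lemma small_sum (I : finType) (f : I -> P) l :
  (forall i, small (f i) l) -> small (\sum_i f i) (#|I| * l.+1).
Proof.
move=> sf; rewrite cardE -big_enum /=; elim: (enum I) => [|i s IH].
  by rewrite big_nil; apply: small0.
by rewrite big_cons; apply: small_le (smallD (sf i) IH); rewrite /= mulSn addSn.
Qed.

Lemma small_prod (I : finType) (f : I -> P) l :
  (forall i, small (f i) l) -> small (\prod_i f i) (#|I| * l.+1).
Proof.
move=> sf; rewrite cardE -big_enum /=; elim: (enum I) => [|i s IH].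
  by rewrite big_nil; apply: small1.
by rewrite big_cons; apply: small_le (smallM (sf i) IH); rewrite /= mulSn addSn.
Qed.
End Cost.

(** * A short formula for the terms of the immanant *)

Section Formula.
Variables (F : fieldType) (m : nat) (w : nat -> F).

Definition vandermonde_const : F :=
  \prod_(i < m) \prod_(j < m) if (i < j)%N then j%:R - i%:R else 1.

Section Def.
Variables (R : comNzRingType) (phi : F -> R).
Variables (e : 'I_m -> 'I_m -> R) (d : 'I_m -> R) (b : 'I_m -> 'I_m -> R).

Definition row_value (i : 'I_m) : R := \sum_(j < m) phi j%:R * e i j.
(** At boolean arguments the first two factors test that row i of e is one-hot at j, and the third
    that d agrees at i and j; what is left is an entry of the masked matrix. *)
Definition row_factor (i : 'I_m) : R :=
  \sum_(j < m) e i j * (\prod_(k < m) if k == j then 1 else 1 - e i k) *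
    (d i * d j + (1 - d i) * (1 - d j)) * b i j.
(** For rows that are one-hot at s i this is the product of s j - s i over i < j. It vanishes unless
    s is injective, and is otherwise the sign of s times [vandermonde_const]: it tests for a
    permutation and computes the sign at once. *)
Definition value_vandermonde : R :=
  \prod_(i < m) \prod_(j < m) if (i < j)%N then row_value j - row_value i else 1.
(* Lagrange interpolation of [w] at [0, ..., m], evaluated at the sum of the [d i] *)
Definition weight_factor : R :=
  \sum_(k < m.+1) phi (w k / \prod_(l < m.+1) if l == k then 1 else k%:R - l%:R) *
    \prod_(l < m.+1) if l == k then 1 else \sum_i d i - phi l%:R.
Definition imm_formula : R :=
  phi vandermonde_const^-1 * weight_factor * value_vandermonde * \prod_i row_factor i.
End Def.

Lemma rmorph_imm_formula (R R' : comNzRingType) (h : {rmorphism R ->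
  R'}) phi phi' e e' d d' b b' :
  (forall x, h (phi x) = phi' x) -> (forall i j, h (e i j) = e' i j) ->
  (forall i, h (d i) = d' i) -> (forall i j, h (b i j) = b' i j) ->
  h (imm_formula phi e d b) = imm_formula phi' e' d' b'.
Proof.
move=> hphi he hd hb; have h1B x : h (1 - x) = 1 - h x by rewrite rmorphB rmorph1.
rewrite /imm_formula !rmorphM !rmorph_prod rmorph_sum hphi; congr (_ * _ * _ * _).
- apply: eq_bigr => k _; rewrite rmorphM rmorph_prod hphi; congr (_ * _).
  apply: eq_bigr => l _; case: ifP; rewrite ?rmorph1 // rmorphB rmorph_sum hphi.
  by rewrite (eq_bigr _ (fun i _ => hd i)).
- apply: eq_bigr => i _; rewrite rmorph_prod; apply: eq_bigr => j _.
  have hv k : h (row_value phi e k) = row_value phi' e' k.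
    by rewrite rmorph_sum; apply: eq_bigr => l _; rewrite rmorphM hphi he.
  by case: ifP; rewrite ?rmorph1 // rmorphB !hv.
apply: eq_bigr => i _; rewrite rmorph_sum; apply: eq_bigr => j _.
rewrite !rmorphM rmorphD !rmorphM !h1B rmorph_prod he hb !hd; congr (_ * _ * _ * _).
by apply: eq_bigr => k _; case: ifP; rewrite ?rmorph1 ?h1B ?he.
Qed.

Hypothesis charF0 : [pchar F] =i pred0.

Lemma natr_neq (k l : nat) : k != l -> (k%:R - l%:R : F) != 0.
Proof.
move=> kl; wlog lk : k l kl / (l < k)%N => [hwlog|].
  case: (ltnP l k) => [|kl']; first exact: hwlog.
  by rewrite -oppr_eq0 opprB hwlog // 1?eq_sym // ltn_neqAle kl.
by rewrite -natrB ?(ltnW lk) // ((pcharf0P F).1 charF0) subn_eq0 -ltnNge.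
Qed.

Lemma vandermonde_const_neq0 : vandermonde_const != 0.
Proof.
apply/prodf_neq0 => i _; apply/prodf_neq0 => j _.
by case: ifP => [ij|_]; [rewrite natr_neq // gtn_eqF | apply: oner_neq0].
Qed.

Section Value.
Variables (R : comNzRingType) (phi : {rmorphism F -> R}) (b : 'I_m -> 'I_m -> R).

Lemma weight_factor_bool (S : {set 'I_m}) : weight_factor phi (fun i =>
  (i \in S)%:R) = phi (w #|S|).
Proof.
have Sm : (#|S| < m.+1)%N by rewrite ltnS -[leqRHS]card_ord max_card.
have sumS : \sum_i (i \in S)%:R = #|S|%:R :> R.
  by rewrite -sum1_card natr_sum [RHS]big_mkcond; apply: eq_bigr => i _; case: (i \in S).
rewrite /weight_factor sumS (bigD1 (Ordinal Sm)) //= [X in _ + X]big1 ?addr0 => [|k nk].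
  set c := \prod_(l < m.+1) if l == Ordinal Sm then 1 else #|S|%:R - l%:R.
  have c0 : c != 0.
    apply/prodf_neq0 => l _; case: ifPn => [_|nl]; first exact: oner_neq0.
    by apply: natr_neq; rewrite eq_sym.
  rewrite (_ : \prod_(l < m.+1) _ = phi c); first by rewrite -rmorphM divfK.
  rewrite rmorph_prod; apply: eq_bigr => l _; case: ifP => _; rewrite ?rmorph1 //.
  by rewrite rmorphB !rmorph_nat.
rewrite [X in _ * X](bigD1 (Ordinal Sm)) //= [Ordinal Sm == k]eq_sym (negPf nk).
by rewrite rmorph_nat subrr mul0r mulr0.
Qed.

Definition one_hot (E : 'I_m -> 'I_m -> bool) (s : 'I_m -> 'I_m) : bool :=
  [forall i, forall j, E i j == (j == s i)].

Definition select_weight (S : {set 'I_m}) (s : 'I_m -> 'I_m) : R :=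
  phi (vandermonde_const^-1 * w #|S| *
    \prod_(i < m) \prod_(j < m) if (i < j)%N then (s j)%:R - (s i)%:R else 1) *
  \prod_(i < m) if (i \in S) == (s i \in S) then b i (s i) else 0.

Lemma prod_bool (Q : pred 'I_m) : \prod_i (Q i)%:R = [forall i, Q i]%:R :> R.
Proof.
case: (boolP [forall i, Q i]) => [/forallP h|/forallPn[i ni]].
  by rewrite big1 // => i _; rewrite h.
by rewrite (bigD1 i) //= (negPf ni) mul0r.
Qed.

Lemma imm_formula_bool (E : 'I_m -> 'I_m -> bool) (S : {set 'I_m}) :
  imm_formula phi (fun i j => (E i j)%:R) (fun i => (i \in S)%:R) b =
  \sum_(s : {ffun 'I_m -> 'I_m} | one_hot E s) select_weight S s.
Proof.
rewrite /imm_formula weight_factor_bool.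
have rowE i : row_factor (fun i j => (E i j)%:R) (fun i => (i \in S)%:R) b i =
    \sum_j [forall k, E i k == (k == j)]%:R * (if (i \in S) == (j \in S) then b i j else 0).
  apply: eq_bigr => j _; rewrite -mulrA; congr (_ * _); last first.
    by case: (i \in S); case: (j \in S); rewrite /= ?subr0 ?subrr; ring.
  rewrite -prod_bool (bigD1 j) //= [in RHS](bigD1 j) //= eqxx mul1r eqb_id; congr (_ * _).
  apply: eq_bigr => k /negPf ->; rewrite eqbF_neg.
  by case: (E i k); rewrite /= ?subr0 ?subrr.
rewrite (eq_bigr _ (fun i _ => rowE i)) bigA_distr_bigA mulr_sumr [RHS]big_mkcond.
apply: eq_bigr => s _; rewrite big_split /= prod_bool -/(one_hot E s).
case: (boolP (one_hot E s)) => [/forallP Es|_]; last by rewrite mul0r mulr0.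
rewrite mul1r /select_weight !rmorphM; congr (_ * _ * _).
rewrite /value_vandermonde rmorph_prod; apply: eq_bigr => i _; rewrite rmorph_prod.
have rv k : row_value phi (fun i j => (E i j)%:R) k = (s k)%:R.
  rewrite /row_value (bigD1 (s k)) //= big1 ?addr0 => [|j /negPf nj].
    by have /forallP/(_ (s k))/eqP -> := Es k; rewrite eqxx mulr1 rmorph_nat.
  by have /forallP/(_ j)/eqP -> := Es k; rewrite nj mulr0.
apply: eq_bigr => j _; rewrite !rv; case: ifP => _; rewrite ?rmorph1 //.
by rewrite rmorphB !rmorph_nat.
Qed.

(** Permuting the nodes permutes the columns of the Vandermonde matrix. *)
Lemma vandermonde_perm (s : 'S_m) :
  \prod_(i < m) \prod_(j < m) (if (i < j)%N then (s j)%:R - (s i)%:R else 1) =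
  (-1) ^+ odd_perm s * vandermonde_const.
Proof.
pose a (t : 'I_m -> 'I_m) : 'rV[F]_m := \row_i (t i)%:R.
have prodE (t : 'I_m -> 'I_m) : \prod_(i < m) \prod_(j < m) (if (i < j)%N then (t j)%:R - (t
  i)%:R else 1) =
    \det (Vandermonde m (a t)).
  rewrite det_Vandermonde; apply: eq_bigr => i _; rewrite [RHS]big_mkcond.
  by apply: eq_bigr => j _; rewrite !mxE.
rewrite (prodE s) /vandermonde_const (prodE (fun i =>
  i)) -(odd_permV s) -det_perm mulrC -det_mulmx -col_permE.
by congr (\det _); apply/matrixP=> i j; rewrite !mxE.
Qed.

Lemma sum_select_weight (S : {set 'I_m}) :
  \sum_(s : {ffun 'I_m -> 'I_m}) select_weight S s =
  phi (w #|S|) * \det (mask_mx S (\matrix_(i, j) b i j)).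
Proof.
rewrite (bigID (fun s : {ffun 'I_m -> 'I_m} => injectiveb s)) /= addrC big1 ?add0r => [|s].
  have s0 : 'S_m := 1%g.
  rewrite (reindex (fun s : 'S_m => pval s)) /=; last first.
    exists (insubd s0) => [s _|s si]; first exact: valKd.
    exact: insubdK.
  rewrite mulr_sumr; apply: eq_big => [s|s _]; first exact: (valP s).
  rewrite /select_weight (eq_bigr (fun i => mask_mx S (\matrix_(i, j) b i j) i (s i)));
    last first.
    by move=> i _; rewrite !mxE pvalE.
  rewrite (eq_bigr (fun i : 'I_m => \prod_(j < m) if (i < j)%N then (s j)%:R - (s i)%:R else
    1)); last first.
    by move=> i _; apply: eq_bigr => j _; rewrite !pvalE.
  rewrite vandermonde_perm (_ : _^-1 * _ * _ = w #|S| * (-1) ^+ odd_perm s).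
    by rewrite rmorphM rmorphXn rmorphN rmorph1 -mulrA.
  by rewrite -mulrA mulrC -!mulrA (mulfV vandermonde_const_neq0) mulr1.
case/injectivePn=> i [j]; rewrite neq_ltn /select_weight => ij eij.
suff -> : \prod_(i < m) \prod_(j < m) (if (i < j)%N then (s j)%:R - (s i)%:R else 1) = 0 :> F.
  by rewrite mulr0 rmorph0 mul0r.
case/orP: ij => ij; [rewrite (bigD1 i) //= (bigD1 j) //= | rewrite (bigD1 j) //= (bigD1 i) //=];
  by rewrite ij eij subrr !mul0r.
Qed.
End Value.
End Formula.

Lemma minimal_nat (Q : nat -> Prop) : (exists n, Q n) ->
  exists n, Q n /\ forall k, Q k -> (n <= k)%N.
Proof.
case=> n; elim/ltn_ind: n => n IH Qn.
have [[k [kn Qk]]|none] := classic (exists k, (k < n)%N /\ Q k); first exact: IH kn Qk.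
exists n; split=> // k Qk; rewrite leqNgt; apply/negP=> kn.
by apply: none; exists k.
Qed.

(** [complexity] asks for the exact minimum, which exists by well-ordering and classical logic;
    choice collects these minima into a function, bounded by the programs that [small] provides. *)
Lemma small_p_computable (F : fieldType) (v : nat ->
  nat) (g : forall n, {mpoly F[v n]}) (l : nat -> nat) :
  p_bounded v -> p_bounded l -> (forall n, (0 < n)%N -> small (g n) (l n)) ->
  p_computable (MPolyFamily g).
Proof.
move=> pv pl sg; split.
  split=> //; apply: p_bounded_le (p_bounded_add pl (p_bounded_const 1)) _ => n n0.
  by rewrite addn1 -ltnS /=; have [_] := sg n n0; case: (msize _).
have [n0|L LP] := functional_choice (fun n L => (0 < n)%N -> complexity (g n) L /\ (L <= l n)%N).
  case: (posnP n0) => [->|npos]; first by exists 0%N.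
  have [cg _] := sg _ npos; have [Q Qg sQ] := cost_computes cg.
  have [|L [[Q' Q'g sQ'] minL]] := @minimal_nat (fun k => exists2 Q,
    slp_computes Q (g n0) & size Q = k).
    by exists (size Q), Q.
  exists L => _; split; last by apply: leq_trans sQ; apply: minL; exists Q.
  split; first by exists Q'.
  by move=> Q'' Q''g; apply: minL; exists Q''.
exists L; last by move=> n /LP[].
by apply: p_bounded_le pl _ => n /LP[].
Qed.

Section Membership.
Variable (F : fieldType).

Definition formula_size (m : nat) : nat :=
  (m.+1 * (m.+1 * (m * 1).+2).+2 + m * (m * ((m * 2) + (m * 2)).+2).+1 +
   m * (m * (m * 2 + 9)).+1 + 3)%N.

Lemma small_imm_formula v m (w : nat -> F) (e : 'I_m -> 'I_m -> {mpoly F[v]}) d b :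
  (forall i j, small (e i j) 0) -> (forall i, small (d i) 0) -> (forall i j, small (b i j) 0) ->
  small (imm_formula w (@mpolyC v F) e d b) (formula_size m).
Proof.
move=> se sd sb.
have sum_ord k (f : 'I_k -> {mpoly F[v]}) l : (forall i, small (f i) l) ->
    small (\sum_i f i) (k * l.+1) by move=> sf; have := small_sum sf; rewrite card_ord.
have prod_ord k (f : 'I_k -> {mpoly F[v]}) l : (forall i, small (f i) l) ->
    small (\prod_i f i) (k * l.+1) by move=> sf; have := small_prod sf; rewrite card_ord.
have s1B p : small p 0 -> small (1 - p) 1 by move=> sp; apply: smallB (small1 _ _) sp.
have if1 l (c : bool) p : small p l -> small (if c then 1 else p) l.
  by move=> sp; case: c => //; apply: small_le (small1 _ _).
have sW : small (weight_factor w (@mpolyC v F) d) (m.+1 * (m.+1 * (m * 1).+2).+2).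
  apply: (sum_ord) => k; apply: (@smallM _ _ _ _ 0 (m.+1 * (m * 1).+2)) (smallC _ _) _;
    apply: (prod_ord) => l; apply: (if1).
  by have := smallB (sum_ord _ _ _ sd) (smallC v l%:R); rewrite addn0.
have sval i : small (row_value (@mpolyC v F) e i) (m * 2).
  by apply: (sum_ord) => j; apply: smallM (smallC _ _) (se i j).
have sV : small (value_vandermonde (@mpolyC v F) e) (m * (m * ((m * 2) + (m * 2)).+2).+1).
  apply: (prod_ord) => i; apply: (prod_ord) => j; case: ifP => _; first exact: smallB.
  exact: small_le (small1 _ _).
have sR : small (\prod_i row_factor e d b i) (m * (m * (m * 2 + 9)).+1).
  apply: (prod_ord) => i.
  have e9 : (m * 2 + 9 = (((0 + m * 2).+1 + ((0 + 0).+1 + (1 + 1).+1).+1).+1 + 0).+2)%N by lia.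
  rewrite e9; apply: (sum_ord) => j; apply: smallM (sb i j); apply: smallM; last first.
    by apply: smallD; [exact: smallM | apply: smallM; apply: s1B].
  apply: (@smallM _ _ _ _ 0 (m * 2)) (se i j) _; apply: (prod_ord) => k; apply: (if1); exact: s1B.
apply: small_le (smallM (smallM (smallM (smallC v (vandermonde_const F m)^-1) sW) sV) sR).
rewrite /formula_size.
set x := (m.+1 * _)%N; set y := (m * (m * (_ + _).+2).+1)%N; set z := (m * (m * _).+1)%N; lia.
Qed.

Lemma p_bounded_formula_size f : p_bounded f -> p_bounded (fun n => formula_size (f n)).
Proof.
move=> pf.
have pS g : p_bounded g -> p_bounded (fun n => (g n).+1).
  by move=> pg; apply: p_bounded_le (p_bounded_add pg (p_bounded_const 1)) _ => n _;
    rewrite addn1.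
have p2 := p_bounded_mul pf (p_bounded_const 2).
have pa := p_bounded_mul (pS _ pf) (pS _ (pS _ (p_bounded_mul pf (p_bounded_const 1)))).
have pb := p_bounded_mul pf (pS _ (pS _ (p_bounded_add p2 p2))).
have pc := p_bounded_mul pf (p_bounded_add p2 (p_bounded_const 9)).
apply: p_bounded_add (p_bounded_add (p_bounded_add _ _) _) (p_bounded_const 3).
- exact: p_bounded_mul (pS _ pf) (pS _ (pS _ pa)).
- exact: p_bounded_mul pf (pS _ pb).
exact: p_bounded_mul pf (pS _ pc).
Qed.

Hypothesis charF0 : [pchar F] =i pred0.

Lemma Imm_two_parts_sets (R : comNzRingType) (phi : {rmorphism F ->
  R}) n (B : 'M[R]_(2 * n)) : (0 < n)%N ->
  Imm (two_parts n) B =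
  \sum_(S : {set 'I_(2 * n)}) phi ((#|S| == n)%:R - (#|S| == n.+1)%:R) * \det (mask_mx S B).
Proof.
move=> n0; rewrite Imm_two_parts //.
have coefG k : (mask_poly B)`_k = \sum_(S : {set 'I_(2 * n)}) (#|S| == k)%:R * \det (mask_mx S B).
  rewrite coef_sum; apply: eq_bigr => S _; rewrite coefCM coefXn eq_sym mulrC.
  by [].
rewrite !coefG -sumrB; apply: eq_bigr => S _.
by rewrite rmorphB !rmorph_nat mulrBl.
Qed.

(* The boolean variables are the entries of a permutation matrix followed by the
   indicator of a set of indices. *)
Section Witness.
Variables (m : nat) (w : nat -> F).

Definition entry_var (i j : 'I_m) : {mpoly F[m * m + (m * m + m)]} :=
  'X_(rshift _ (lshift _ (mxvec_index i j))).
Definition set_var (i : 'I_m) : {mpoly F[m * m + (m * m + m)]} := 'X_(rshift _ (rshift _ i)).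
Definition matrix_var (i j : 'I_m) : {mpoly F[m * m + (m * m + m)]} :=
  'X_(lshift _ (mxvec_index i j)).

Definition imm_witness : {mpoly F[m * m + (m * m + m)]} :=
  imm_formula w (@mpolyC _ F) entry_var set_var matrix_var.

Lemma small_imm_witness : small imm_witness (formula_size m).
Proof. by apply: small_imm_formula => *; apply: smallX. Qed.

Lemma eval_imm_witness (eps : {ffun 'I_(m * m + m) -> bool}) :
  eval_bools imm_witness eps =
  \sum_(s : {ffun 'I_m -> 'I_m} | one_hot (fun i j => eps (lshift _ (mxvec_index i j))) s)
    select_weight w (@mpolyC _ F) (generic_mx F m) [set i | eps (rshift _ i)] s.
Proof.
rewrite -imm_formula_bool //.
have evX i : eval_bools ('X_i : {mpoly F[m * m + (m * m + m)]}) eps =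
   match split i with inl j => 'X_j | inr k => ((eps k)%:R)%:MP end.
  by rewrite /eval_bools comp_mpolyXU -tnth_nth tnth_mktuple.
have nat_bool (c : bool) : (c%:R)%:MP = c%:R :> {mpoly F[m * m]} by case: c;
  rewrite ?mpolyC1 ?mpolyC0.
rewrite /eval_bools /imm_witness; apply: rmorph_imm_formula => [x|i j|i|i j].
- exact: comp_mpolyC.
- by rewrite [LHS]evX (unsplitK (inr _)) nat_bool.
- by rewrite [LHS]evX (unsplitK (inr _)) nat_bool inE.
by rewrite [LHS]evX (unsplitK (inl _)) mxE.
Qed.

Lemma sum_imm_witness :
  \sum_(eps : {ffun 'I_(m * m + m) -> bool}) eval_bools imm_witness eps =
  \sum_(S : {set 'I_m}) (w #|S|)%:MP * \det (mask_mx S (generic_mx F m)).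
Proof.
rewrite (eq_bigr _ (fun eps _ => eval_imm_witness eps)).
rewrite (exchange_big_dep xpredT) //=.
transitivity (\sum_(s : {ffun 'I_m -> 'I_m}) \sum_(S : {set 'I_m})
    select_weight w (@mpolyC _ F) (generic_mx F m) S s); last first.
  apply: etrans (exchange_big _ _ _ _ _ _) _; apply: eq_bigr => S _ /=.
  apply: etrans (sum_select_weight w charF0 (@mpolyC (m * m) F) (generic_mx F m) S) _.
  by congr (_ * \det (mask_mx _ _)); apply/matrixP=> i j; rewrite !mxE.
apply: eq_bigr => s _.
(* For fixed s, the assignments whose matrix part is one-hot at s are parametrized by the set S. *)
pose mk (S : {set 'I_m}) : {ffun 'I_(m * m + m) -> bool} := [ffun k => match split k with
   | inl q => mxvec (\matrix_(i, j) (j == s i)) 0 q | inr i => i \in S end].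
have mkl S i j : mk S (lshift _ (mxvec_index i j)) = (j == s i).
  by rewrite ffunE (unsplitK (inl _)) mxvecE mxE.
have mkr S i : mk S (rshift _ i) = (i \in S) by rewrite ffunE (unsplitK (inr _)).
rewrite (reindex_onto mk (fun eps => [set i | eps (rshift _ i)])) /=.
  apply: eq_big => [S|S _]; last first.
    by congr (select_weight _ _ _ _ s); apply/setP=> i; rewrite inE mkr.
  apply/andP; split.
    by apply/forallP=> i; apply/forallP=> j; rewrite mkl.
  by apply/eqP/setP=> i; rewrite inE mkr.
move=> eps /forallP oh; apply/ffunP=> k.
case: (split_ordP k) => q ->; last by rewrite mkr inE.
case/mxvec_indexP: q => i j; rewrite mkl.
by have /forallP/(_ j)/eqP -> := oh i.
Qed.
End Witness.

Lemma msize_Imm_generic m (la : partition_of m) :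
  (msize (Imm la (generic_mx F m)) <= m.+1)%N.
Proof.
rewrite /Imm; elim/big_rec: _ => [|s p _ sp]; first by rewrite msize0.
rewrite (leq_trans (msizeD_le _ _)) // geq_max sp andbT.
rewrite -(rmorph_int (@mpolyC _ F)) mul_mpolyC (leq_trans (msizeZ_le _ _)) //.
rewrite (eq_bigr (fun i => 'X_[U_(mxvec_index i (s i))])); last by move=> i _; rewrite mxE.
rewrite -(big_morph (fun k : 'X_{1..m * m} =>
  'X_[k] : {mpoly F[m * m]}) (@mpolyXD _ _) (mpolyX0 _ _)) msizeX mdeg_sum (eq_bigr (fun=>
    1%N)) => [|i _]; last exact: mdeg1.
by rewrite sum1_card card_ord.
Qed.

Lemma VNP_imm_two_family : VNP (imm_two_family F).
Proof.
pose w n (k : nat) : F := (k == n)%:R - (k == n.+1)%:R.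
have p2 : p_bounded (fun n => 2 * n)%N by p_bounded_tac.
have pv : p_bounded (fun n => 2 * n * (2 * n))%N by p_bounded_tac.
have pu : p_bounded (fun n => 2 * n * (2 * n) + 2 * n)%N by p_bounded_tac.
split.
  split; first exact: pv.
  apply: p_bounded_le p2 _ => n _ /=.
  by rewrite -subn1 leq_subLR add1n; apply: msize_Imm_generic.
exists (fun n => 2 * n * (2 * n) + 2 * n)%N, (fun n => imm_witness (2 * n) (w n)); split.
- exact: pu.
- apply: (small_p_computable (l := fun n => formula_size (2 * n))).
  + exact: p_bounded_add pv pu.
  + exact: p_bounded_formula_size p2.
  by move=> n _; apply: small_imm_witness.
move=> n n0; rewrite sum_imm_witness /=.
exact: (Imm_two_parts_sets (@mpolyC _ F)).
Qed.
End Membership.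

Theorem theorem1p3 (F : fieldType) (charF0 : [pchar F] =i pred0) :
  VNP_complete (imm_two_family F) /\
  exists (N : nat -> nat) (Pi : forall n : nat, mx_pattern F n (2 * N n)),
    [/\ exists c : nat, forall n : nat, (0 < n)%N -> (N n <= c * n ^ 2)%N,
        p_bounded (fun n : nat => (2 * N n)%N)
      & forall n : nat, (0 < n)%N -> forall A : 'M[F]_n,
          Imm (two_parts (N n)) (mx_subst (Pi n) A) = per A].
Proof.
split; first by split; [apply: VNP_imm_two_family | move=> f; apply: VNP_projection].
have exPi n : exists P : mx_pattern F n (2 * gadget_size n), (0 < n)%N -> forall A : 'M[F]_n,
    Imm (two_parts (gadget_size n)) (mx_subst P A) = per A.
  (* A default pattern at the ignored index 0. *)
  have [->|n0] := posnP n; first by exists (const_mx (inl 0)).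
  have [Q QE] := per_as_Imm charF0 n0; exists Q => _ A.
  by rewrite -[RHS](QE F idfun); congr Imm.
exists gadget_size, (fun n => sval (constructive_indefinite_description _ (exPi n))); split.
- by exists 2 => n n0; rewrite /gadget_size mul2n -addnn mulnn leq_add2r leq_pmulr.
- by apply: p_bounded_mul (p_bounded_const 2) (p_bounded_gadget_size p_bounded_id).
by move=> n n0 A; apply: (svalP (constructive_indefinite_description _ (exPi n))).
Qed.
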